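(* Let $m\ge1$ be an integer and $c\in\mathbb C\setminus\mathbb Z_{\le0}$. Consider the $(m+1)$-dimensional space of solutions of $D^c_{m+1}F=0$ with ordered basis (column vector) $\mathcal B=(Li_{m,c}(z),\ b_{m-1}(z),\ b_{m-2}(z),\dots,b_0(z))$, where $b_j(z)=\frac{1}{j!}z^{1-c}(\log z)^j$, taken as germs at $z=-1$. For $j\in\{0,1\}$, analytic continuation of $\mathcal B$ along the loop $Z_j$ yields $\rho_{m,c}([Z_j])\mathcal B$, where $\rho_{m,c}([Z_0])$ is the $(m+1)\times(m+1)$ matrix with first row $(1,0,\dots,0)$ and, for $2\le i\le m+1$, $(i,l)$-entry equal to $e^{-2\pi i c}\frac{(2\pi i)^{l-i}}{(l-i)!}$ for $l\ge i$ and $0$ for $l<i$; and $\rho_{m,c}([Z_1])$ is the identity matrix except that its $(1,2)$-entry is $-2\pi i$. The image of the monodromy representation $\rho_{m,c}$ of $\pi_1(\mathbb P^1(\mathbb C)\setminus\{0,1,\infty\},-1)=\langle[Z_0],[Z_1]\rangle$ lies in a Borel subgroup of $GL(m+1,\mathbb C)$; it is unipotent if $c\in\mathbb Z_{>1}$ and quasi-unipotent if $c\in\mathbb Q\setminus\mathbb Z$.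
   Context: $D^c_{m+1}=z^2\frac{d}{dz}\left(\frac{1-z}{z}\right)\left(z\frac{d}{dz}+c-1\right)^m$. $Li_{m,c}(z)$ is the analytic continuation of $\sum_{n\ge0}\frac{z^{n+1}}{(n+c)^m}$ from $|z|<1$ to $\mathbb C\setminus((-\infty,0]\cup[1,\infty))$. $\log$ is the principal branch, $z^{1-c}=e^{(1-c)\log z}$; germs at the base point $z=-1$ are those obtained as limits from the upper half-plane (so $\log(-1)=\pi i$). $Z_0$: a simple closed curve based at $-1$ enclosing $0$ counterclockwise and not enclosing $1$. $Z_1$: a simple closed curve based at $-1$ enclosing $1$ counterclockwise, not enclosing $0$, passing above $0$ (not meeting $\{-it:t\ge0\}$). *)

(* Defs.v *)
From Stdlib Require Import Reals Lra Arith.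
From Coquelicot Require Import Coquelicot.
Open Scope R_scope.

Definition Cexp (z : C) : C :=
  (exp (Re z) * cos (Im z), exp (Re z) * sin (Im z)).

(* principal argument, in (-PI, PI] (for z <> 0) *)
Definition Carg (z : C) : R :=
  if Rle_dec 0 (Im z) then acos (Re z / Cmod z) else - acos (Re z / Cmod z).

Definition Clog (z : C) : C := (ln (Cmod z), Carg z).

Definition Cpowc (z a : C) : C := Cexp (a * Clog z)%C.

Definition twopii : C := (0, 2 * PI).

Definition bfun (c : C) (j : nat) (z : C) : C :=
  (/ RtoC (INR (fact j)) * Cpowc z (1 - c) * Cpow (Clog z) j)%C.

Fixpoint Csum (f : nat -> C) (n : nat) : C :=
  match n with
  | O => 0%C
  | S n' => (Csum f n' + f n')%C
  end.

Definition disk (z0 : C) (r : R) (z : C) : Prop := Cmod (z - z0) < r.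

Definition holo_on (U : C -> Prop) (f : C -> C) : Prop :=
  forall z, U z -> @ex_derive C_AbsRing C_NormedModule f z.

Definition cut_plane (z : C) : Prop :=
  ~ (Im z = 0 /\ (Re z <= 0 \/ 1 <= Re z)).

Definition m1 : C := RtoC (-1).

(* G is (a representative of) the germ at -1 of f obtained as the limit
   from the upper half-plane: G is holomorphic on a disk around -1 and
   coincides with f on the upper half of that disk. *)
Definition upper_germ_at_m1 (f G : C -> C) : Prop :=
  exists r, 0 < r /\ holo_on (disk m1 r) G /\
    forall z, disk m1 r z -> 0 < Im z -> G z = f z.

Definition I01 (t : R) : Prop := 0 <= t <= 1.

(* Analytic continuation of (the germ at gamma 0 of) f along the path
   gamma : [0,1] -> C, ending with (the germ at gamma 1 of) g.
   A family of holomorphic functions F t on disks around gamma t, such that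
   for s close to t, gamma s lies in the disk of F t and F s and F t have
   the same germ at gamma s. *)
Definition continues_along (f : C -> C) (gamma : R -> C) (g : C -> C) : Prop :=
  exists (F : R -> C -> C) (r : R -> R),
    (forall t, I01 t -> 0 < r t /\ holo_on (disk (gamma t) (r t)) (F t)) /\
    (forall t, I01 t -> exists d, 0 < d /\
        forall s, I01 s -> Rabs (s - t) < d ->
          disk (gamma t) (r t) (gamma s) /\
          exists e, 0 < e /\ forall z, disk (gamma s) e z -> F s z = F t z) /\
    (exists e, 0 < e /\ forall z, disk (gamma 0) e z -> F 0 z = f z) /\
    (exists e, 0 < e /\ forall z, disk (gamma 1) e z -> F 1 z = g z).

Definition punctured (z : C) : Prop := z <> 0%C /\ z <> 1%C.

Definition path_cont (gamma : R -> C) : Prop :=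
  forall t, I01 t -> filterlim gamma (within I01 (locally t)) (locally (gamma t)).

Definition is_loop (gamma : R -> C) : Prop :=
  path_cont gamma /\ gamma 0 = m1 /\ gamma 1 = m1 /\
  forall t, I01 t -> punctured (gamma t).

Definition I01sq (p : R * R) : Prop := I01 (fst p) /\ I01 (snd p).

Definition loop_homotopic (g1 g2 : R -> C) : Prop :=
  exists H : R -> R -> C,
    (forall p, I01sq p ->
       filterlim (fun q : R * R => H (fst q) (snd q)) (within I01sq (locally p))
                 (locally (H (fst p) (snd p)))) /\
    (forall t, I01 t -> H 0 t = g1 t /\ H 1 t = g2 t) /\
    (forall s, I01 s -> H s 0 = m1 /\ H s 1 = m1) /\
    (forall s t, I01 s -> I01 t -> punctured (H s t)).

(* Representative of Z_0: the circle of centre -1/4 and radius 3/4,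
   run counterclockwise from -1 (encloses 0, not 1). *)
Definition loopZ0 (t : R) : C :=
  (-/4 - 3/4 * cos (2 * PI * t), - (3/4) * sin (2 * PI * t)).

(* Representative of Z_1: from -1 along the upper half of the circle
   |z + 1/4| = 3/4 to 1/2 (passing above 0), once counterclockwise around
   the circle |z - 1| = 1/2, and back along the same upper arc to -1. *)
Definition loopZ1 (t : R) : C :=
  if Rle_dec t (1/3) then
    (-/4 + 3/4 * cos (PI * (1 - 3 * t)), 3/4 * sin (PI * (1 - 3 * t)))
  else if Rle_dec t (2/3) then
    (1 + /2 * cos (PI + 2 * PI * (3 * t - 1)), /2 * sin (PI + 2 * PI * (3 * t - 1)))
  else
    (-/4 + 3/4 * cos (PI * (3 * t - 2)), 3/4 * sin (PI * (3 * t - 2))).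

Definition in_class (Z : R -> C) (gamma : R -> C) : Prop :=
  is_loop gamma /\ loop_homotopic gamma Z.

(* Matrices (square, size n, entries indexed by nat; only indices < n  *)
(* are relevant)                                                       *)

Definition Mat := nat -> nat -> C.

Definition mat_id : Mat := fun i j => if Nat.eqb i j then 1%C else 0%C.

Definition mmul (n : nat) (A B : Mat) : Mat :=
  fun i j => Csum (fun k => (A i k * B k j)%C) n.

Definition msub (A B : Mat) : Mat := fun i j => (A i j - B i j)%C.

Fixpoint mpow (n : nat) (A : Mat) (k : nat) : Mat :=
  match k with
  | O => mat_id
  | S k' => mmul n (mpow n A k') A
  end.

Definition mat_eq (n : nat) (A B : Mat) : Prop :=
  forall i j, (i < n)%nat -> (j < n)%nat -> A i j = B i j.

Definition mat_inv (n : nat) (A N : Mat) : Prop :=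
  mat_eq n (mmul n A N) mat_id /\ mat_eq n (mmul n N A) mat_id.

Inductive in_gen (n : nat) (A B : Mat) : Mat -> Prop :=
  | gen_id : in_gen n A B mat_id
  | gen_mulA X : in_gen n A B X -> in_gen n A B (mmul n X A)
  | gen_mulB X : in_gen n A B X -> in_gen n A B (mmul n X B)
  | gen_mulAinv X N : in_gen n A B X -> mat_inv n A N -> in_gen n A B (mmul n X N)
  | gen_mulBinv X N : in_gen n A B X -> mat_inv n B N -> in_gen n A B (mmul n X N).

Definition upper_tri (n : nat) (A : Mat) : Prop :=
  forall i j, (i < n)%nat -> (j < i)%nat -> A i j = 0%C.

(* the group lies in a Borel subgroup: it is contained in a conjugate
   P (upper triangular) P^-1 of the standard Borel subgroup *)
Definition in_Borel (n : nat) (S : Mat -> Prop) : Prop :=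
  exists P Q : Mat, mat_inv n P Q /\
    forall X, S X -> upper_tri n (mmul n (mmul n Q X) P).

Definition unipotent (n : nat) (A : Mat) : Prop :=
  mat_eq n (mpow n (msub A mat_id) n) (fun _ _ => 0%C).

Definition quasi_unipotent (n : nat) (A : Mat) : Prop :=
  exists k, (0 < k)%nat /\ unipotent n (mpow n A k).

(* The basis and the monodromy matrices (0-based indices 0..m)        *)

Definition Bvec (m : nat) (c : C) (Li : C -> C) (k : nat) : C -> C :=
  match k with
  | O => Li
  | S _ => bfun c (m - k) 
  end.

Definition rhoZ0 (c : C) : Mat := fun i l =>
  match i with
  | O => if Nat.eqb l 0 then 1%C else 0%C
  | S _ => if Nat.ltb l i then 0%C
           else (Cexp (- (twopii * c)) * Cpow twopii (l - i)
                   / RtoC (INR (fact (l - i))))%C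
  end.

Definition rhoZ1 : Mat := fun i l =>
  if andb (Nat.eqb i 0) (Nat.eqb l 1) then (- twopii)%C
  else mat_id i l.

Definition is_int (c : C) : Prop := exists k : Z, c = RtoC (IZR k).
Definition is_rat (c : C) : Prop :=
  exists p q : Z, q <> 0%Z /\ c = RtoC (IZR p / IZR q).

(* Main.v *)
Require Import Defs.
From Stdlib Require Import Reals Arith ZArith Lra Lia Psatz Classical ClassicalEpsilon FunctionalExtensionality.
From Coquelicot Require Import Coquelicot.
Open Scope R_scope.

(** The functions [1, Li_{1,c}, ..., Li_{m,c}] form a solution of a triangular first-order
    system, holomorphic off [0] and [1]. On a convex domain a solution is determined by its
    value at one point and exists for every value, so solutions can be transported along
    paths, and transport only depends on the homotopy class (subdivision of the square).
    It is then enough to follow explicit solutions along the two given loops. The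
    [b_j] are functions of a branch of [log z]. The series defining [Li] is one-valued in
    the unit disk, hence invariant around [0]. Around [1], put [z = 1 - exp w] with
    [Re w < 0]: the difference between the values at [w + 2 i pi] and [w] satisfies a
    homogeneous system, and its behaviour as [Re w] tends to minus infinity identifies it
    with [- 2 i pi b_{m-1}].

    That the given germs at [-1] are the expected ones needs the identity theorem for merely
    complex differentiable functions; it follows from Goursat's theorem and the mean value
    property by a Holmgren-type argument: multiplying by [exp (n phi)] with a suitable
    quadratic [phi] kills the part of a circle on which nothing is known. *)

(** * Complex differentiability *)

(** The obstacle is the base point: -1 lies on the boundary of the disk of convergence and on the
    cut of the principal logarithm, so the prescribed germs are known only above the real axis, and
    the series only inside the unit disk. Each germ is therefore compared, on a thin wedge with
    vertex -1 where both descriptions hold, with component [m] of a solution that is holomorphic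
    across -1. This is the sole use of the identity theorem; everything else rests on uniqueness for
    the system, hence on primitives and an integrating factor. What is transported is a sequence of
    values at a point, not a germ, so that homotopy invariance becomes a finite computation on a
    grid. Germs reappear only when an analytic continuation in the sense of [continues_along] is
    assembled. The system has infinitely many components, each driven by the previous one, so [m]
    enters only when a component is finally read off. *)

Definition ccont (f : C -> C) (z : C) : Prop :=
  forall eps, 0 < eps -> exists del, 0 < del /\
    forall w, Cmod (w - z) < del -> Cmod (f w - f z) < eps.

(* Caratheodory's form of complex differentiability *)
Definition cderiv (f : C -> C) (z l : C) : Prop :=
  exists phi, phi z = l /\ ccont phi z /\
    forall w, f w = (f z + phi w * (w - z))%C.

Lemma Cmod_sym (a b : C) : Cmod (a - b) = Cmod (b - a).
Proof. rewrite <- Cmod_opp. f_equal. ring. Qed.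

Lemma Cmod_tri3 (a b c : C) : Cmod (a - c) <= Cmod (a - b) + Cmod (b - c).
Proof. replace (a - c)%C with ((a - b) + (b - c))%C by ring. apply Cmod_triangle. Qed.

Lemma Cmod_self (a : C) : Cmod (a - a) = 0.
Proof. replace (a - a)%C with (RtoC 0) by ring. apply Cmod_0. Qed.

Lemma Cmod_rev_tri (a b : C) : Cmod a - Cmod b <= Cmod (a - b).
Proof.
  pose proof (Cmod_triangle (a - b) b) as H.
  replace (a - b + b)%C with a in H by ring. lra.
Qed.

Lemma C_eq (a b : C) : Re a = Re b -> Im a = Im b -> a = b.
Proof. destruct a, b; simpl; intros; subst; auto. Qed.

Lemma Cmod_sub_eq0 (a b : C) : Cmod (a - b) <= 0 -> a = b.
Proof.
  intros H. apply Ceq_minus, Cmod_eq_0.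
  pose proof (Cmod_ge_0 (a - b)). lra.
Qed.

Lemma im_le_Cmod (z : C) : Rabs (Im z) <= Cmod z.
Proof. eapply Rle_trans; [apply Rmax_r | apply Rmax_Cmod]. Qed.

Lemma Cmod_le_sum (z : C) : Cmod z <= Rabs (Re z) + Rabs (Im z).
Proof.
  replace z with (RtoC (Re z) + Ci * RtoC (Im z))%C at 1
    by (apply C_eq; simpl; ring).
  eapply Rle_trans; [apply Cmod_triangle|].
  rewrite Cmod_mult, !Cmod_R, Cmod_Ci. lra.
Qed.

Lemma Cmod_le_eps (a : C) : (forall e, 0 < e -> Cmod a <= e) -> a = 0%C.
Proof.
  intros H. apply Cmod_eq_0. pose proof (Cmod_ge_0 a).
  destruct (Rle_lt_or_eq_dec _ _ H0) as [h|h]; [|auto].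
  specialize (H (Cmod a / 2)). lra.
Qed.

Lemma disk_Rmin p a b z : disk p (Rmin a b) z -> disk p a z /\ disk p b z.
Proof. unfold disk. intros H. pose proof (Rmin_l a b). pose proof (Rmin_r a b). lra. Qed.

Lemma ccont_const (a z : C) : ccont (fun _ => a) z.
Proof. intros e He. exists 1. split; [lra|]. intros. rewrite Cmod_self. auto. Qed.

Lemma ccont_id (z : C) : ccont (fun w => w) z.
Proof. intros e He. exists e. auto. Qed.

Lemma ccont_plus (f g : C -> C) (z : C) : ccont f z -> ccont g z -> ccont (fun w => (f w + g w)%C) z.
Proof.
  intros Hf Hg e He.
  destruct (Hf (e/2)) as [d1 [H1 K1]]; [lra|].
  destruct (Hg (e/2)) as [d2 [H2 K2]]; [lra|].
  exists (Rmin d1 d2). split; [apply Rmin_pos; auto|]. intros w Hw.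
  destruct (disk_Rmin _ _ _ _ Hw) as [h1 h2]. specialize (K1 w h1). specialize (K2 w h2).
  replace (f w + g w - (f z + g z))%C with ((f w - f z) + (g w - g z))%C by ring.
  eapply Rle_lt_trans; [apply Cmod_triangle|]. lra.
Qed.

Lemma ccont_mult (f g : C -> C) (z : C) : ccont f z -> ccont g z -> ccont (fun w => (f w * g w)%C) z.
Proof.
  intros Hf Hg e He.
  set (M := Cmod (f z) + Cmod (g z) + 1).
  assert (HM : 1 <= M) by (unfold M; pose proof (Cmod_ge_0 (f z)); pose proof (Cmod_ge_0 (g z)); lra).
  assert (Hk : 0 < Rmin 1 (e / (2 * M))).
  { apply Rmin_pos; [lra|]. apply Rdiv_lt_0_compat; lra. }
  destruct (Hf _ Hk) as [d1 [H1 K1]]. destruct (Hg _ Hk) as [d2 [H2 K2]].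
  exists (Rmin d1 d2). split; [apply Rmin_pos; auto|]. intros w Hw.
  destruct (disk_Rmin _ _ _ _ Hw) as [h1 h2]. pose proof (K1 w h1) as A. pose proof (K2 w h2) as B.
  set (k := Rmin 1 (e / (2*M))) in *.
  replace (f w * g w - f z * g z)%C with ((f w - f z) * (g w - g z) + ((f w - f z) * g z + f z * (g w - g z)))%C by ring.
  eapply Rle_lt_trans; [apply Cmod_triangle|].
  eapply Rle_lt_trans; [apply Rplus_le_compat_l, Cmod_triangle|].
  rewrite !Cmod_mult.
  assert (k <= 1) by apply Rmin_l. assert (k * (2*M) <= e).
  { unfold k. eapply Rle_trans; [apply Rmult_le_compat_r; [lra|apply Rmin_r]|]. right. field. lra. }
  pose proof (Cmod_ge_0 (f w - f z)). pose proof (Cmod_ge_0 (g w - g z)).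
  pose proof (Cmod_ge_0 (f z)). pose proof (Cmod_ge_0 (g z)).
  unfold M in *. clear -A B H H0 H3 H4 H5 H6 Hk. nra.
Qed.

Lemma ccont_comp (f g : C -> C) (z : C) : ccont f z -> ccont g (f z) -> ccont (fun w => g (f w)) z.
Proof.
  intros Hf Hg e He. destruct (Hg e He) as [d [Hd K]]. destruct (Hf d Hd) as [d' [Hd' K']].
  exists d'. split; auto.
Qed.

Lemma ccont_inv (z : C) : z <> 0%C -> ccont Cinv z.
Proof.
  intros Hz e He. pose proof (proj1 (Cmod_gt_0 z) Hz) as Hp.
  assert (Hk : 0 < e * (Cmod z * Cmod z / 2)).
  { apply Rmult_lt_0_compat; auto. nra. }
  exists (Rmin (Cmod z / 2) (e * (Cmod z * Cmod z / 2))).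
  split; [apply Rmin_pos; auto; lra|]. intros w Hw.
  destruct (disk_Rmin _ _ _ _ Hw) as [A B]. unfold disk in A, B.
  assert (Hw2 : Cmod z / 2 < Cmod w). { pose proof (Cmod_rev_tri z w). rewrite Cmod_sym in H. lra. }
  assert (w <> 0%C). { apply Cmod_gt_0. lra. }
  replace (/ w - / z)%C with ((z - w) / (w * z))%C by (field; auto).
  rewrite Cmod_div by (apply Cmult_neq_0; auto). rewrite Cmod_mult, Cmod_sym.
  apply Rmult_lt_reg_r with (Cmod w * Cmod z); [nra|].
  unfold Rdiv. rewrite Rmult_assoc, Rinv_l by nra. nra.
Qed.

Lemma ccont_local (f g : C -> C) (z : C) (r : R) : 0 < r -> (forall w, Cmod (w - z) < r -> f w = g w) -> ccont f z -> ccont g z.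
Proof.
  intros Hr E H e He. destruct (H e He) as [d [Hd K]].
  exists (Rmin d r). split; [apply Rmin_pos; auto|]. intros w Hw.
  destruct (disk_Rmin _ _ _ _ Hw) as [h1 h2].
  rewrite <- !E; [apply K; auto|rewrite Cmod_self; auto|auto].
Qed.

Lemma cderiv_ccont f z l : cderiv f z l -> ccont f z.
Proof.
  intros [phi [_ [Hc E]]].
  assert (ccont (fun w => (f z + phi w * (w - z))%C) z).
  { apply ccont_plus; [apply ccont_const|]. apply ccont_mult; auto.
    apply ccont_plus; [apply ccont_id|apply ccont_const]. }
  apply (ccont_local _ _ _ 1 Rlt_0_1 (fun w _ => eq_sym (E w)) H).
Qed.

Lemma cderiv_eps f z l : cderiv f z l ->
  forall eps, 0 < eps -> exists del, 0 < del /\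
    forall w, Cmod (w - z) < del -> Cmod (f w - f z - l * (w - z)) <= eps * Cmod (w - z).
Proof.
  intros [phi [E1 [Hc E]]] e He. destruct (Hc e He) as [d [Hd K]].
  exists d. split; auto. intros w Hw. rewrite (E w), <- E1.
  replace (f z + phi w * (w - z) - f z - phi z * (w - z))%C with ((phi w - phi z) * (w - z))%C by ring.
  rewrite Cmod_mult. apply Rmult_le_compat_r; [apply Cmod_ge_0|]. left. auto.
Qed.

Lemma eps_cderiv f z l :
  (forall eps, 0 < eps -> exists del, 0 < del /\
    forall w, Cmod (w - z) < del -> Cmod (f w - f z - l * (w - z)) <= eps * Cmod (w - z)) ->
  cderiv f z l.
Proof.
  intros H.
  exists (fun w : C => if excluded_middle_informative (w = z) then l else ((f w - f z) / (w - z))%C).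
  split; [|split].
  - destruct excluded_middle_informative; [auto|congruence].
  - intros e He. destruct (H (e/2)) as [d [Hd K]]; [lra|]. exists d. split; auto. intros w Hw.
    destruct (excluded_middle_informative (z = z)); [|congruence].
    destruct excluded_middle_informative; [rewrite Cmod_self; auto|].
    assert (w - z <> 0)%C by (intros h; apply n, Ceq_minus; auto).
    replace ((f w - f z) / (w - z) - l)%C with ((f w - f z - l * (w - z)) / (w - z))%C by (field; auto).
    rewrite Cmod_div by auto. specialize (K w Hw). apply Cmod_gt_0 in H0.
    apply Rmult_lt_reg_r with (Cmod (w - z)); auto. unfold Rdiv. rewrite Rmult_assoc, Rinv_l by lra. nra.
  - intros w. destruct excluded_middle_informative; [subst; ring|].
    assert (w - z <> 0)%C by (intros h; apply n, Ceq_minus; auto). field. auto.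
Qed.

Lemma cderiv_local (f g : C -> C) (z l : C) (r : R) : 0 < r -> (forall w, Cmod (w - z) < r -> f w = g w) ->
  cderiv f z l -> cderiv g z l.
Proof.
  intros Hr E H. apply eps_cderiv. intros e He.
  destruct (cderiv_eps _ _ _ H e He) as [d [Hd K]].
  exists (Rmin d r). split; [apply Rmin_pos; auto|]. intros w Hw.
  destruct (disk_Rmin _ _ _ _ Hw) as [h1 h2].
  rewrite <- !E; [apply K; auto|rewrite Cmod_self; auto|auto].
Qed.

Lemma cderiv_eq f z l l' : cderiv f z l -> l = l' -> cderiv f z l'.
Proof. intros; subst; auto. Qed.

Lemma cderiv_const (a z : C) : cderiv (fun _ => a) z 0%C.
Proof. exists (fun _ => 0%C). repeat split; [apply ccont_const|]. intros; ring. Qed.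

Lemma cderiv_id (z : C) : cderiv (fun w => w) z 1%C.
Proof. exists (fun _ => 1%C). repeat split; [apply ccont_const|]. intros; ring. Qed.

Lemma cderiv_plus (f g : C -> C) (z a b : C) : cderiv f z a -> cderiv g z b ->
  cderiv (fun w => (f w + g w)%C) z (a + b)%C.
Proof.
  intros [p [E1 [H1 K1]]] [q [E2 [H2 K2]]]. exists (fun w => (p w + q w)%C).
  repeat split; [subst; auto|apply ccont_plus; auto|]. intros w. rewrite (K1 w), (K2 w). ring.
Qed.

Lemma cderiv_mult (f g : C -> C) (z a b : C) : cderiv f z a -> cderiv g z b ->
  cderiv (fun w => (f w * g w)%C) z (a * g z + f z * b)%C.
Proof.
  intros Hf Hg. pose proof (cderiv_ccont _ _ _ Hg).
  destruct Hf as [p [E1 [H1 K1]]], Hg as [q [E2 [H2 K2]]].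
  exists (fun w => (p w * g w + f z * q w)%C).
  repeat split; [subst; auto|apply ccont_plus; apply ccont_mult; auto; apply ccont_const|].
  intros w. rewrite (K1 w), (K2 w). ring.
Qed.

Lemma cderiv_scal (f : C -> C) (z a k : C) : cderiv f z a -> cderiv (fun w => (k * f w)%C) z (k * a)%C.
Proof.
  intros H. eapply cderiv_eq; [apply (cderiv_mult _ _ _ _ _ (cderiv_const k z) H)|]. ring.
Qed.

Lemma cderiv_opp (f : C -> C) (z a : C) : cderiv f z a -> cderiv (fun w => - f w)%C z (- a)%C.
Proof.
  intros [p [E [H K]]]. exists (fun w => -(1) * p w)%C.
  split; [subst; ring|]. split; [apply ccont_mult; auto; apply ccont_const|].
  intros w. rewrite (K w). ring.
Qed.

Lemma cderiv_minus (f g : C -> C) (z a b : C) : cderiv f z a -> cderiv g z b ->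
  cderiv (fun w => (f w - g w)%C) z (a - b)%C.
Proof. intros Hf Hg. apply (cderiv_plus f (fun w => - g w)%C); auto. apply cderiv_opp; auto. Qed.

(** The slope of the composite is [q (f w) * p w], so the points with [f w = f z] need no separate
    treatment. *)
Lemma cderiv_comp (f g : C -> C) (z a b : C) : cderiv f z a -> cderiv g (f z) b ->
  cderiv (fun w => g (f w)) z (b * a)%C.
Proof.
  intros Hf Hg. pose proof (cderiv_ccont _ _ _ Hf).
  destruct Hf as [p [E1 [H1 K1]]], Hg as [q [E2 [H2 K2]]].
  exists (fun w => (q (f w) * p w)%C).
  repeat split; [subst; auto|apply ccont_mult; auto; apply (ccont_comp f q); auto|].
  intros w. rewrite (K2 (f w)), (K1 w). ring.
Qed.

Lemma cderiv_inv (f : C -> C) (z a : C) : f z <> 0%C -> cderiv f z a ->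
  cderiv (fun w => / f w)%C z (- a / (f z * f z))%C.
Proof.
  intros Hz Hf.
  assert (cderiv Cinv (f z) (- / (f z * f z))%C).
  { pose proof (proj1 (Cmod_gt_0 _) Hz) as Hp.
    (* The Caratheodory identity is required at every [w]. At [w = 0], where the inverse is only a
       default value, the tangent line replaces it; locality then undoes the change. *)
    assert (cderiv (fun w : C => if excluded_middle_informative (w = 0%C) then (/ f z - (w - f z) / (f z * f z))%C else (/ w)%C) (f z) (- / (f z * f z))%C).
    { exists (fun w : C => if excluded_middle_informative (w = 0%C) then (- / (f z * f z))%C else (- / (f z * w))%C).
      repeat split.
      - destruct excluded_middle_informative; congruence.
      - apply (ccont_local (fun w : C => (- / f z * / w)%C) _ _ (Cmod (f z)) Hp).
        + intros w Hw. destruct excluded_middle_informative as [->|n].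
          * rewrite Cmod_sym in Hw. replace (f z - 0)%C with (f z) in Hw by ring. lra.
          * field. auto.
        + apply ccont_mult; [apply ccont_const|apply ccont_inv; auto].
      - intros w. destruct (excluded_middle_informative (f z = 0%C)); [congruence|].
        destruct excluded_middle_informative; field; auto. }
    refine (cderiv_local _ _ _ _ (Cmod (f z)) Hp _ H).
    intros w Hw. destruct excluded_middle_informative as [->|n]; auto.
    rewrite Cmod_sym in Hw. replace (f z - 0)%C with (f z) in Hw by ring. lra. }
  eapply cderiv_eq; [apply (cderiv_comp f Cinv z _ _ Hf H)|]. field. auto.
Qed.

Lemma cderiv_is_derive f z l : cderiv f z l -> @is_derive C_AbsRing C_NormedModule f z l.
Proof.
  intros H. split.
  - apply (is_linear_scal_l (K:=C_AbsRing) (V:=C_NormedModule) l).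
  - intros x Hx. apply (is_filter_lim_locally_unique (K:=C_AbsRing) (V:=AbsRing_NormedModule C_AbsRing)) in Hx. subst x.
    intros eps. destruct (cderiv_eps _ _ _ H eps (cond_pos eps)) as [d [Hd K]].
    exists (mkposreal d Hd). intros w Hw. specialize (K w Hw).
    change (Cmod (f w - f z - (w - z) * l)%C <= eps * Cmod (w - z)%C).
    replace ((w - z) * l)%C with (l * (w - z))%C by ring. exact K.
Qed.

Lemma is_derive_cderiv f z l : @is_derive C_AbsRing C_NormedModule f z l -> cderiv f z l.
Proof.
  intros [_ H]. apply eps_cderiv. intros e He.
  specialize (H z (fun P h => h) (mkposreal e He)).
  destruct H as [d K]. exists d. split; [apply cond_pos|]. intros w Hw. specialize (K w Hw).
  change (Cmod (f w - f z - (w - z) * l)%C <= e * Cmod (w - z)%C) in K.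
  replace ((w - z) * l)%C with (l * (w - z))%C in K by ring. exact K.
Qed.

Lemma ccont_minus (f g : C -> C) (z : C) : ccont f z -> ccont g z -> ccont (fun w => (f w - g w)%C) z.
Proof.
  intros Hf Hg. apply (ccont_local (fun w => f w + -(1) * g w)%C _ _ 1 Rlt_0_1); [intros; ring|].
  apply ccont_plus; auto. apply ccont_mult; auto. apply ccont_const.
Qed.

Lemma exp_mono x y : x <= y -> exp x <= exp y.
Proof. intros [H|H]; [left; apply exp_increasing; auto|right; f_equal; auto]. Qed.

Definition holo (U : C -> Prop) (f : C -> C) := forall z, U z -> exists l, cderiv f z l.

Lemma holo_on_iff U f : holo_on U f <-> holo U f.
Proof.
  split; intros H z Hz; destruct (H z Hz) as [l Hl]; exists l;
    [apply is_derive_cderiv|apply cderiv_is_derive]; auto.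
Qed.

Definition copen (U : C -> Prop) := forall z, U z -> exists r, 0 < r /\ forall w, Cmod (w - z) < r -> U w.
Definition cconvex (U : C -> Prop) := forall a b t, U a -> U b -> 0 <= t <= 1 -> U (a + RtoC t * (b - a))%C.

(** * Goursat's theorem and primitives *)

Definition lerp (a b : C) (t : R) : C := (a + RtoC t * (b - a))%C.

(** The integral of [f] over the oriented segment. The factor [b - a] stands outside, because
    complex multiplication is not a scalar action of the real normed space in which [RInt] lives. *)
Definition seg (f : C -> C) (a b : C) : C :=
  ((b - a) * RInt (V := C_R_CompleteNormedModule) (fun t => f (lerp a b t)) 0 1)%C.

Lemma lerp_diff a b s t : Cmod (lerp a b s - lerp a b t) = Rabs (s - t) * Cmod (b - a).
Proof.
  unfold lerp. replace (a + RtoC s * (b - a) - (a + RtoC t * (b - a)))%C with (RtoC (s - t) * (b - a))%C by (rewrite RtoC_minus; ring).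
  rewrite Cmod_mult, Cmod_R. auto.
Qed.

Lemma lerp_0 a b : lerp a b 0 = a. Proof. unfold lerp. ring. Qed.
Lemma lerp_1 a b : lerp a b 1 = b. Proof. unfold lerp. ring. Qed.

Lemma ccont_lerp (f : C -> C) (a b : C) (t : R) : ccont f (lerp a b t) ->
  continuous (T := R_UniformSpace) (U := C_R_CompleteNormedModule) (fun t => f (lerp a b t)) t.
Proof.
  intros H. apply filterlim_locally. intros eps.
  destruct (H eps (cond_pos eps)) as [d [Hd K]].
  assert (Hk : 0 < d / (Cmod (b - a) + 1)).
  { apply Rdiv_lt_0_compat; auto. pose proof (Cmod_ge_0 (b - a)). lra. }
  exists (mkposreal _ Hk). intros s Hs. apply C_NormedModule_mixin_compat1. apply K.
  rewrite lerp_diff. change (Rabs (s - t) < d / (Cmod (b - a) + 1)) in Hs.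
  pose proof (Cmod_ge_0 (b - a)). pose proof (Rabs_pos (s - t)).
  apply Rle_lt_trans with (Rabs (s - t) * (Cmod (b - a) + 1)); [nra|].
  apply Rmult_lt_reg_r with (/ (Cmod (b - a) + 1)); [apply Rinv_0_lt_compat; lra|].
  rewrite Rmult_assoc, Rinv_r by lra. unfold Rdiv in Hs. lra.
Qed.

Definition seg_ok (f : C -> C) (a b : C) := forall t, 0 <= t <= 1 -> ccont f (lerp a b t).

Lemma seg_ex f a b s t : seg_ok f a b -> 0 <= s <= 1 -> 0 <= t <= 1 ->
  ex_RInt (V := C_R_CompleteNormedModule) (fun t => f (lerp a b t)) s t.
Proof.
  intros H Hs Ht. apply ex_RInt_continuous. intros x Hx. apply ccont_lerp, H.
  unfold Rmin, Rmax in Hx. destruct Rle_dec; lra.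
Qed.

Lemma seg_minus f g a b : seg_ok f a b -> seg_ok g a b ->
  seg (fun z => (f z - g z)%C) a b = (seg f a b - seg g a b)%C.
Proof.
  intros Hf Hg. unfold seg.
  pose proof (RInt_minus (V := C_R_CompleteNormedModule) (fun t => f (lerp a b t)) (fun t => g (lerp a b t)) 0 1
   (seg_ex f a b 0 1 Hf ltac:(lra) ltac:(lra)) (seg_ex g a b 0 1 Hg ltac:(lra) ltac:(lra))) as H.
  etransitivity; [apply f_equal; exact H|].
  change (@minus (CompleteNormedModule.AbelianGroup R_AbsRing C_R_CompleteNormedModule)) with Cminus. ring.
Qed.

Lemma seg_bound f a b M : seg_ok f a b -> (forall t, 0 <= t <= 1 -> Cmod (f (lerp a b t)) <= M) ->
  Cmod (seg f a b) <= M * Cmod (b - a).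
Proof.
  intros H HM. unfold seg. rewrite Cmod_mult, Rmult_comm. apply Rmult_le_compat_r; [apply Cmod_ge_0|].
  rewrite Cmod_norm.
  pose proof (norm_RInt_le_const (V := C_R_CompleteNormedModule) (fun t => f (lerp a b t)) 0 1 _ M ltac:(lra)
   (fun x h => eq_ind _ (fun v => v <= M) (HM x h) _ (Cmod_norm _))
   (RInt_correct _ _ _ (seg_ex f a b 0 1 H ltac:(lra) ltac:(lra)))) as K.
  eapply Rle_trans; [exact K|]. lra.
Qed.

Lemma RtoC_m1 : RtoC (-1) = (- RtoC 1)%C.
Proof. apply C_eq; simpl; ring. Qed.

Lemma seg_rev f a b : seg_ok f a b -> seg f b a = (- seg f a b)%C.
Proof.
  intros H.
  assert (H' : seg_ok f b a).
  { intros t Ht. replace (lerp b a t) with (lerp a b (1 - t)).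
    apply H; lra. unfold lerp. rewrite RtoC_minus. ring. }
  unfold seg.
  pose proof (RInt_correct _ _ _ (seg_ex f a b 0 1 H ltac:(lra) ltac:(lra))) as J.
  set (I := RInt _ 0 1) in J |- * at 2.
  apply is_RInt_swap in J.
  pose proof (is_RInt_comp_lin (V := C_R_CompleteNormedModule) (fun t => f (lerp a b t)) (-1) 1 0 1 (opp I)) as K.
  replace (-1 * 0 + 1) with 1 in K by ring. replace (-1 * 1 + 1) with 0 in K by ring.
  apply K in J. clear K. apply is_RInt_opp in J. rewrite opp_opp in J.
  assert (E : is_RInt (V := C_R_CompleteNormedModule) (fun t => f (lerp b a t)) 0 1 I).
  { eapply is_RInt_ext; [|exact J]. intros x _.
    change (- scal (-1)%R (f (lerp a b (-1 * x + 1))) = f (lerp b a x))%C. rewrite scal_R_Cmult.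
    replace (lerp a b (-1 * x + 1)) with (lerp b a x); [rewrite RtoC_m1; ring|].
    unfold lerp. rewrite RtoC_plus, RtoC_mult, RtoC_m1. ring. }
  rewrite (is_RInt_unique _ _ _ _ E). ring.
Qed.

Lemma seg_mid f a b : seg_ok f a b ->
  seg f a b = (seg f a ((a + b) / 2) + seg f ((a + b) / 2) b)%C.
Proof.
  intros H. unfold seg. set (m := ((a + b) / 2)%C).
  assert (E1 : forall y, lerp a m y = lerp a b (/2 * y + 0)).
  { intros. unfold lerp, m. rewrite RtoC_plus, RtoC_mult, RtoC_inv by lra. field. }
  assert (E2 : forall y, lerp m b y = lerp a b (/2 * y + /2)).
  { intros. unfold lerp, m. rewrite RtoC_plus, RtoC_mult, RtoC_inv by lra. field. }
  assert (h1 : 0 <= 0 <= 1) by lra. assert (h2 : 0 <= /2 <= 1) by lra. assert (h3 : 0 <= 1 <= 1) by lra.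
  pose proof (RInt_correct _ _ _ (seg_ex f a b 0 (/2) H h1 h2)) as J1.
  pose proof (RInt_correct _ _ _ (seg_ex f a b (/2) 1 H h2 h3)) as J2.
  set (I1 := RInt _ 0 (/2)) in J1. set (I2 := RInt _ (/2) 1) in J2.
  pose proof (is_RInt_Chasles _ _ _ _ _ _ J1 J2) as J.
  pose proof (is_RInt_comp_lin (V := C_R_CompleteNormedModule) (fun t => f (lerp a b t)) (/2) 0 0 1 I1) as K1.
  pose proof (is_RInt_comp_lin (V := C_R_CompleteNormedModule) (fun t => f (lerp a b t)) (/2) (/2) 0 1 I2) as K2.
  replace (/2 * 0 + 0) with 0 in K1 by ring. replace (/2 * 1 + 0) with (/2) in K1 by ring.
  replace (/2 * 0 + /2) with (/2) in K2 by ring. replace (/2 * 1 + /2) with 1 in K2 by lra.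
  pose proof (is_RInt_scal _ _ _ 2 _ (K1 J1)) as L1.
  pose proof (is_RInt_scal _ _ _ 2 _ (K2 J2)) as L2.
  assert (G1 : is_RInt (V := C_R_CompleteNormedModule) (fun t => f (lerp a m t)) 0 1 (2 * I1)%C).
  { rewrite <- scal_R_Cmult. eapply is_RInt_ext; [|exact L1]. intros x _. rewrite E1.
    change (scal 2%R (scal (/2)%R (f (lerp a b (/2 * x + 0)))) = f (lerp a b (/2 * x + 0))).
    rewrite !scal_R_Cmult, RtoC_inv by lra. match goal with |- ?u = ?v => change (@eq C u v) end. field. }
  assert (G2 : is_RInt (V := C_R_CompleteNormedModule) (fun t => f (lerp m b t)) 0 1 (2 * I2)%C).
  { rewrite <- scal_R_Cmult. eapply is_RInt_ext; [|exact L2]. intros x _. rewrite E2.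
    change (scal 2%R (scal (/2)%R (f (lerp a b (/2 * x + /2)))) = f (lerp a b (/2 * x + /2))).
    rewrite !scal_R_Cmult, RtoC_inv by lra. match goal with |- ?u = ?v => change (@eq C u v) end. field. }
  rewrite (is_RInt_unique _ _ _ _ J), (is_RInt_unique _ _ _ _ G1), (is_RInt_unique _ _ _ _ G2).
  change (plus I1 I2) with (I1 + I2)%C. unfold m. field.
Qed.

Lemma cderiv_lerp F a b t l : cderiv F (lerp a b t) l ->
  is_derive (K := R_AbsRing) (V := C_R_NormedModule) (fun t => F (lerp a b t)) t (l * (b - a))%C.
Proof.
  intros H. split; [apply (is_linear_scal_l (K:=R_AbsRing) (V:=C_R_NormedModule))|].
  intros x Hx. apply (is_filter_lim_locally_unique (K:=R_AbsRing) (V:=AbsRing_NormedModule R_AbsRing)) in Hx. subst x. intros eps.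
  set (L := Cmod (b - a)). assert (HL : 0 <= L) by apply Cmod_ge_0.
  assert (Hk : 0 < eps / (L + 1)) by (apply Rdiv_lt_0_compat; [apply cond_pos|lra]).
  destruct (cderiv_eps _ _ _ H _ Hk) as [d [Hd K]].
  assert (Hk' : 0 < d / (L + 1)) by (apply Rdiv_lt_0_compat; lra).
  exists (mkposreal _ Hk'). intros s Hs. change (Rabs (s - t) < d / (L + 1)) in Hs.
  pose proof (Rabs_pos (s - t)).
  assert (Rabs (s - t) * (L + 1) < d).
  { apply Rmult_lt_reg_r with (/ (L + 1)); [apply Rinv_0_lt_compat; lra|].
    rewrite Rmult_assoc, Rinv_r by lra. unfold Rdiv in Hs. lra. }
  specialize (K (lerp a b s)). rewrite lerp_diff in K. fold L in K. specialize (K ltac:(nra)).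
  rewrite <- Cmod_norm.
  change (Cmod (F (lerp a b s) - F (lerp a b t) - scal (s - t)%R (l * (b - a))%C)%C <= eps * Rabs (s - t)).
  rewrite scal_R_Cmult.
  replace (RtoC (s - t) * (l * (b - a)))%C with (l * (lerp a b s - lerp a b t))%C
   by (unfold lerp; rewrite RtoC_minus; ring).
  eapply Rle_trans; [exact K|]. apply Rle_trans with (eps / (L + 1) * (L + 1) * Rabs (s - t)).
  - assert (0 <= eps / (L+1) * Rabs (s - t)) by (apply Rmult_le_pos; lra). nra.
  - right. field. lra.
Qed.

Lemma seg_prim F f a b : (forall t, 0 <= t <= 1 -> cderiv F (lerp a b t) (f (lerp a b t))) ->
  seg_ok f a b -> seg f a b = (F b - F a)%C.
Proof.
  intros H Hc. unfold seg.
  pose proof (is_RInt_derive (V := C_R_CompleteNormedModule) (fun t => F (lerp a b t)) (fun t => f (lerp a b t) * (b - a))%C 0 1) as K.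
  assert (K' : is_RInt (V := C_R_CompleteNormedModule) (fun t => f (lerp a b t) * (b - a))%C 0 1 (F b - F a)%C).
  { replace (F b) with (F (lerp a b 1)) by (rewrite lerp_1; auto).
    replace (F a) with (F (lerp a b 0)) by (rewrite lerp_0; auto). apply K.
    - intros x Hx. rewrite Rmin_left, Rmax_right in Hx by lra. apply cderiv_lerp, H. auto.
    - intros x Hx. rewrite Rmin_left, Rmax_right in Hx by lra.
      apply (ccont_lerp (fun z => f z * (b - a))%C). apply ccont_mult; [apply Hc; auto|apply ccont_const]. }
  pose proof (RInt_correct _ _ _ (seg_ex f a b 0 1 Hc ltac:(lra) ltac:(lra))) as J.
  set (I := RInt _ 0 1) in *.
  (* Linearity of the integral covers real scalars only, so the complex factor is handled on real
     and imaginary parts. *)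
  assert (J1 : is_RInt (V := C_R_CompleteNormedModule) (fun t => f (lerp a b t) * (b - a))%C 0 1 ((b - a) * I)%C).
  { 
    pose proof (is_RInt_fct_extend_fst (U := R_NormedModule) (V := R_NormedModule) _ _ _ _ J) as J1.
    pose proof (is_RInt_fct_extend_snd (U := R_NormedModule) (V := R_NormedModule) _ _ _ _ J) as J2.
    destruct (b - a)%C as [u v].
    apply (is_RInt_fct_extend_pair (U := R_NormedModule) (V := R_NormedModule)); simpl.
    - pose proof (is_RInt_minus _ _ _ _ _ _ (is_RInt_scal _ _ _ u _ J1) (is_RInt_scal _ _ _ v _ J2)) as E.
      eapply is_RInt_ext; [|exact E]. intros x _. 
      change (u * fst (f (lerp a b x)) - v * snd (f (lerp a b x)) = fst (f (lerp a b x)) * u - snd (f (lerp a b x)) * v). ring.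
    - pose proof (is_RInt_plus _ _ _ _ _ _ (is_RInt_scal _ _ _ u _ J2) (is_RInt_scal _ _ _ v _ J1)) as E.
      eapply is_RInt_ext; [|exact E]. intros x _. 
      change (u * snd (f (lerp a b x)) + v * fst (f (lerp a b x)) = fst (f (lerp a b x)) * v + snd (f (lerp a b x)) * u). ring. }
  rewrite <- (is_RInt_unique _ _ _ _ J1). apply (is_RInt_unique _ _ _ _ K').
Qed.

(** The sequences [u n - 2K/2^n] and [u n + 2K/2^n] are monotone in opposite directions, and the
    supremum of the first lies between them. This locates the limit of the nested triangles, one
    coordinate at a time. *)
Lemma geometric_cauchy (u : nat -> R) (K : R) :
  (forall n, Rabs (u (S n) - u n) <= K / 2 ^ n) ->
  exists l, forall n, Rabs (u n - l) <= 2 * K / 2 ^ n.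
Proof.
  intros H.
  assert (P : forall n, 0 < 2 ^ n) by (intros; apply pow_lt; lra).
  set (v := fun n => u n - 2 * K / 2 ^ n). set (w := fun n => u n + 2 * K / 2 ^ n).
  assert (E : forall n, 2 * K / 2 ^ S n = K / 2 ^ n).
  { intros. simpl. field. specialize (P n). lra. }
  assert (E' : forall n, 2 * K / 2 ^ n = 2 * (K / 2 ^ n)).
  { intros. field. specialize (P n). lra. }
  assert (Hv : forall n k, v n <= v (n + k)%nat).
  { intros n k. induction k; [rewrite Nat.add_0_r; lra|]. rewrite Nat.add_succ_r.
    apply Rle_trans with (1 := IHk). unfold v. rewrite E, E'.
    specialize (H (n + k)%nat). apply Rabs_le_between in H. lra. }
  assert (Hw : forall n k, w (n + k)%nat <= w n).
  { intros n k. induction k; [rewrite Nat.add_0_r; lra|]. rewrite Nat.add_succ_r.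
    apply Rle_trans with (2 := IHk). unfold w. rewrite E, E'.
    specialize (H (n + k)%nat). apply Rabs_le_between in H. lra. }
  assert (K0 : forall n, 0 <= K / 2 ^ n).
  { intros n. eapply Rle_trans; [apply Rabs_pos|apply (H n)]. }
  assert (Hvw : forall n k, v n <= w k).
  { intros n k. apply Rle_trans with (1 := Hv n k). apply Rle_trans with (w (n + k)%nat).
    - unfold v, w. rewrite E'. specialize (K0 (n + k)%nat). lra.
    - rewrite Nat.add_comm. apply Hw. }
  destruct (completeness (fun x => exists n, x = v n)) as [l [Hl1 Hl2]].
  - exists (w O). intros x [n ->]. apply Hvw.
  - exists (v O), O. auto.
  - exists l. intros n. apply Rabs_le_between.
    assert (v n <= l) by (apply Hl1; exists n; auto).
    assert (l <= w n) by (apply Hl2; intros x [k ->]; apply Hvw).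
    unfold v, w in *. lra.
Qed.

(** * Triangles and their subdivision *)

Definition tri (f : C -> C) (x y z : C) : C := (seg f x y + seg f y z + seg f z x)%C.

(** Subdivision takes place in this closed reference triangle, and [bary] maps it to the given one.
    Its three inequalities pass to the limit, so the limit point stays in [U] although [U] is only
    known to be convex. *)
Definition simplex (s : C) : Prop := 0 <= Re s /\ 0 <= Im s /\ Re s + Im s <= 1.
Definition bary (a b c s : C) : C := (a + RtoC (Re s) * (b - a) + RtoC (Im s) * (c - a))%C.

Lemma bary_lerp a b c x y t : lerp (bary a b c x) (bary a b c y) t = bary a b c (lerp x y t).
Proof.
  unfold lerp, bary. destruct x as [x1 x2], y as [y1 y2].
  replace (Re ((x1, x2) + RtoC t * ((y1, y2) - (x1, x2)))%C) with (x1 + t * (y1 - x1)) by (simpl; ring).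
  replace (Im ((x1, x2) + RtoC t * ((y1, y2) - (x1, x2)))%C) with (x2 + t * (y2 - x2)) by (simpl; ring).
  simpl Re; simpl Im. rewrite !RtoC_plus, !RtoC_mult, !RtoC_minus. ring.
Qed.

Lemma lerp_mid (x y : C) : lerp x y (/2) = ((x + y) / 2)%C.
Proof. unfold lerp. rewrite RtoC_inv by lra. field. Qed.

Lemma bary_mid a b c x y : ((bary a b c x + bary a b c y) / 2)%C = bary a b c ((x + y) / 2)%C.
Proof. rewrite <- !lerp_mid, bary_lerp. auto. Qed.

Lemma simplex_lerp x y t : simplex x -> simplex y -> 0 <= t <= 1 -> simplex (lerp x y t).
Proof.
  unfold simplex, lerp. destruct x as [x1 x2], y as [y1 y2]; simpl. intros. nra.
Qed.

Lemma simplex_mid x y : simplex x -> simplex y -> simplex ((x + y) / 2)%C.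
Proof. rewrite <- lerp_mid. intros. apply simplex_lerp; auto; lra. Qed.

Lemma bary_convex U a b c s : cconvex U -> U a -> U b -> U c -> simplex s -> U (bary a b c s).
Proof.
  intros HU Ha Hb Hc [H1 [H2 H3]]. destruct s as [s t]. unfold bary. simpl in *.
  destruct (Req_dec (s + t) 0) as [h|h].
  - replace s with 0 by lra. replace t with 0 by lra. replace (a + 0 * (b - a) + 0 * (c - a))%C with a by ring. auto.
  - set (q := (b + RtoC (t / (s + t)) * (c - b))%C).
    assert (Hq : U q). { apply HU; auto. split; [apply Rmult_le_pos; [lra|left; apply Rinv_0_lt_compat; lra]|].
      apply Rmult_le_reg_r with (s + t); [lra|]. unfold Rdiv. rewrite Rmult_assoc, Rinv_l by auto. lra. }
    replace (a + RtoC s * (b - a) + RtoC t * (c - a))%C with (a + RtoC (s + t) * (q - a))%C; [apply HU; auto; lra|].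
    assert (RtoC (s + t) <> 0%C) by (intros e; apply h, RtoC_inj, e).
    unfold q. rewrite RtoC_div by auto. rewrite RtoC_plus in *. field. auto.
Qed.

Lemma bary_dist a b c x y : Cmod (bary a b c x - bary a b c y) <= (Cmod (b - a) + Cmod (c - a)) * Cmod (x - y).
Proof.
  replace (bary a b c x - bary a b c y)%C with (RtoC (Re (x - y)) * (b - a) + RtoC (Im (x - y)) * (c - a))%C.
  - eapply Rle_trans; [apply Cmod_triangle|]. rewrite !Cmod_mult, !Cmod_R.
    pose proof (re_le_Cmod (x - y)). pose proof (im_le_Cmod (x - y)).
    pose proof (Cmod_ge_0 (b - a)). pose proof (Cmod_ge_0 (c - a)). nra.
  - unfold bary. destruct x, y. simpl. rewrite !RtoC_plus, !RtoC_opp. ring.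
Qed.

Definition T3 := (C * C * C)%type.
(** The vertices are listed so that all four parts inherit the orientation of [T]; the inner edges
    then cancel in the sum of the integrals. The first vertex serves as reference point in [vtx]. *)
Definition sub4 (T T' : T3) : Prop :=
  let '(x, y, z) := T in
  let p := ((x + y) / 2)%C in let q := ((y + z) / 2)%C in let r := ((z + x) / 2)%C in
  T' = (x, p, r) \/ T' = (p, y, q) \/ T' = (r, q, z) \/ T' = (p, q, r).

Definition perim (T : T3) : R := let '(x, y, z) := T in Cmod (x - y) + Cmod (y - z) + Cmod (z - x).

Lemma Cmod_half z : Cmod (z / 2) = Cmod z / 2.
Proof.
  rewrite Cmod_div by (intros h; apply RtoC_inj in h; lra). rewrite Cmod_R, Rabs_right by lra. auto.
Qed.

Lemma sub4_perim T T' : sub4 T T' -> perim T' = perim T / 2.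
Proof.
  destruct T as [[x y] z]. unfold sub4, perim. intros [-> | [-> | [-> | ->]]].
  - replace (x - (x + y) / 2)%C with ((x - y) / 2)%C by field.
    replace ((x + y) / 2 - (z + x) / 2)%C with ((y - z) / 2)%C by field.
    replace ((z + x) / 2 - x)%C with ((z - x) / 2)%C by field. rewrite !Cmod_half. field.
  - replace ((x + y) / 2 - y)%C with ((x - y) / 2)%C by field.
    replace (y - (y + z) / 2)%C with ((y - z) / 2)%C by field.
    replace ((y + z) / 2 - (x + y) / 2)%C with ((z - x) / 2)%C by field. rewrite !Cmod_half. field.
  - replace ((z + x) / 2 - (y + z) / 2)%C with ((x - y) / 2)%C by field.
    replace ((y + z) / 2 - z)%C with ((y - z) / 2)%C by field.
    replace (z - (z + x) / 2)%C with ((z - x) / 2)%C by field. rewrite !Cmod_half. field.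
  - replace ((x + y) / 2 - (y + z) / 2)%C with ((x - z) / 2)%C by field.
    replace ((y + z) / 2 - (z + x) / 2)%C with ((y - x) / 2)%C by field.
    replace ((z + x) / 2 - (x + y) / 2)%C with ((z - y) / 2)%C by field. rewrite !Cmod_half.
    rewrite (Cmod_sym x z), (Cmod_sym y x), (Cmod_sym z y). field.
Qed.

Definition vtx (T : T3) : C := fst (fst T).

Lemma sub4_vtx T T' : sub4 T T' -> Cmod (vtx T' - vtx T) <= perim T.
Proof.
  destruct T as [[x y] z]. unfold sub4, perim, vtx. simpl.
  pose proof (Cmod_ge_0 (x - y)). pose proof (Cmod_ge_0 (y - z)). pose proof (Cmod_ge_0 (z - x)).
  intros [-> | [-> | [-> | ->]]]; simpl.
  - rewrite Cmod_self. lra.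
  - replace ((x + y) / 2 - x)%C with ((y - x) / 2)%C by field. rewrite Cmod_half, Cmod_sym. lra.
  - replace ((z + x) / 2 - x)%C with ((z - x) / 2)%C by field. rewrite Cmod_half. lra.
  - replace ((x + y) / 2 - x)%C with ((y - x) / 2)%C by field. rewrite Cmod_half, Cmod_sym. lra.
Qed.

Definition inS (T : T3) : Prop := let '(x, y, z) := T in simplex x /\ simplex y /\ simplex z.

Lemma sub4_inS T T' : sub4 T T' -> inS T -> inS T'.
Proof.
  destruct T as [[x y] z]. unfold sub4, inS. intros H [h1 [h2 h3]].
  destruct H as [-> | [-> | [-> | ->]]]; (split; [|split]); auto using simplex_mid.
Qed.

Section Goursat.
Variables (U : C -> Prop) (f : C -> C) (a b c : C).
Hypotheses (HU : cconvex U) (Hf : holo U f) (Ha : U a) (Hb : U b) (Hc : U c).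

Let A := bary a b c.
Let triA (T : T3) := let '(x, y, z) := T in tri f (A x) (A y) (A z).

Let A_U s : simplex s -> U (A s).
Proof. intros; apply bary_convex; auto. Qed.

Let ok x y : simplex x -> simplex y -> seg_ok f (A x) (A y).
Proof.
  intros Hx Hy t Ht. unfold A. rewrite bary_lerp.
  destruct (Hf (bary a b c (lerp x y t))) as [l Hl]; [apply A_U, simplex_lerp; auto|].
  eapply cderiv_ccont; eauto.
Qed.

(** The integral is the sum of four, so one of them has at least a quarter of its modulus.
    Membership in the simplex is a premise inside the conclusion, which makes the chosen successor a
    total function that can be iterated. *)
Let step_ex T : exists T', sub4 T T' /\ (inS T -> Cmod (triA T) <= 4 * Cmod (triA T')).
Proof.
  destruct T as [[x y] z].
  destruct (classic (inS (x, y, z))) as [[h1 [h2 h3]]|n].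
  2:{ eexists; split; [left; reflexivity|tauto]. }
  set (p := ((x + y) / 2)%C). set (q := ((y + z) / 2)%C). set (r := ((z + x) / 2)%C).
  assert (hp : simplex p) by (apply simplex_mid; auto).
  assert (hq : simplex q) by (apply simplex_mid; auto).
  assert (hr : simplex r) by (apply simplex_mid; auto).
  assert (E : triA (x, y, z) = (triA (x, p, r) + triA (p, y, q) + triA (r, q, z) + triA (p, q, r))%C).
  { unfold triA, tri.
    rewrite (seg_mid f (A x) (A y)), (seg_mid f (A y) (A z)), (seg_mid f (A z) (A x)) by auto.
    assert (Am : forall x y, ((A x + A y) / 2)%C = A ((x + y) / 2)%C) by (intros; apply bary_mid).
    rewrite !Am. fold p q r.
    rewrite (seg_rev f (A p) (A r)), (seg_rev f (A q) (A p)), (seg_rev f (A r) (A q)) by auto. ring. }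
  assert (Cmod (triA (x, y, z)) <= Cmod (triA (x, p, r)) + Cmod (triA (p, y, q)) + Cmod (triA (r, q, z)) + Cmod (triA (p, q, r))).
  { rewrite E. eapply Rle_trans; [apply Cmod_triangle|]. apply Rplus_le_compat_r.
    eapply Rle_trans; [apply Cmod_triangle|]. apply Rplus_le_compat_r. apply Cmod_triangle. }
  destruct (Rle_dec (Cmod (triA (x, y, z))) (4 * Cmod (triA (x, p, r)))) as [k1|k1].
  { exists (x, p, r). split; [left; auto|auto]. }
  destruct (Rle_dec (Cmod (triA (x, y, z))) (4 * Cmod (triA (p, y, q)))) as [k2|k2].
  { exists (p, y, q). split; [right; left; auto|auto]. }
  destruct (Rle_dec (Cmod (triA (x, y, z))) (4 * Cmod (triA (r, q, z)))) as [k3|k3].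
  { exists (r, q, z). split; [right; right; left; auto|auto]. }
  exists (p, q, r). split; [right; right; right; auto|]. intros. lra.
Qed.

Theorem goursat : tri f a b c = 0%C.
Proof.
  set (T0 := ((0, 0), (1, 0), (0, 1)) : T3).
  assert (E0 : triA T0 = tri f a b c).
  { unfold triA, T0, A, bary; simpl. f_equal; ring. }
  set (nxt := fun T => proj1_sig (constructive_indefinite_description _ (step_ex T))).
  assert (Hn : forall T, sub4 T (nxt T) /\ (inS T -> Cmod (triA T) <= 4 * Cmod (triA (nxt T)))).
  { intros T. unfold nxt. destruct constructive_indefinite_description. auto. }
  set (Ts := fun n => Nat.iter n nxt T0).
  assert (HS : forall n, inS (Ts n)).
  { induction n; simpl; [unfold simplex; simpl; repeat split; lra|]. eapply sub4_inS; [apply Hn|auto]. }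
  set (d := perim T0).
  assert (Hp : forall n, perim (Ts n) = d / 2 ^ n).
  { induction n; [change (d = d / 1); field|]. change (Ts (S n)) with (nxt (Ts n)). simpl pow. rewrite (sub4_perim (Ts n)) by apply Hn. rewrite IHn. field.
    apply pow_nonzero; lra. }
  assert (Hk : forall n, Cmod (triA T0) <= 4 ^ n * Cmod (triA (Ts n))).
  { induction n; simpl; [lra|]. eapply Rle_trans; [apply IHn|].
    destruct (Hn (Ts n)) as [_ h]. specialize (h (HS n)). fold (Ts n) in *.
    assert (0 < 4 ^ n) by (apply pow_lt; lra). 
    replace (4 * 4 ^ n * Cmod (triA (nxt (Ts n)))) with (4 ^ n * (4 * Cmod (triA (nxt (Ts n))))) by ring.
    apply Rmult_le_compat_l; lra. }
  assert (Hv : forall n, Cmod (vtx (Ts (S n)) - vtx (Ts n)) <= d / 2 ^ n).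
  { intros n. rewrite <- Hp. apply sub4_vtx. apply Hn. }
  destruct (geometric_cauchy (fun n => Re (vtx (Ts n))) d) as [l1 L1].
  { intros n. eapply Rle_trans; [|apply Hv]. eapply Rle_trans; [|apply re_le_Cmod]. right. reflexivity. }
  destruct (geometric_cauchy (fun n => Im (vtx (Ts n))) d) as [l2 L2].
  { intros n. eapply Rle_trans; [|apply Hv]. eapply Rle_trans; [|apply im_le_Cmod]. right. reflexivity. }
  set (s := (l1, l2) : C).
  assert (Ls : forall n, Cmod (vtx (Ts n) - s) <= 4 * (d / 2 ^ n)).
  { intros n. eapply Rle_trans; [apply Cmod_le_sum|]. specialize (L1 n). specialize (L2 n).
    change (Re (vtx (Ts n) - s)) with (Re (vtx (Ts n)) - l1). change (Im (vtx (Ts n) - s)) with (Im (vtx (Ts n)) - l2).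
    unfold Rdiv in *. lra. }
  assert (Hd0 : 0 <= d). { unfold d, perim, T0. repeat apply Rplus_le_le_0_compat; apply Cmod_ge_0. }
  assert (small : forall e, 0 < e -> exists n, d / 2 ^ n < e).
  { intros e He. destruct (pow_lt_1_zero (/2) ltac:(rewrite Rabs_right; lra) (e / (d + 1))) as [N HN].
    { apply Rdiv_lt_0_compat; lra. }
    exists N. specialize (HN N (le_n N)). rewrite Rabs_right in HN by (apply Rle_ge, pow_le; lra).
    rewrite pow_inv in HN. apply Rle_lt_trans with ((d + 1) * / 2 ^ N).
    { unfold Rdiv. apply Rmult_le_compat_r; [left; apply Rinv_0_lt_compat, pow_lt; lra|lra]. }
    apply Rmult_lt_reg_r with (/ (d + 1)); [apply Rinv_0_lt_compat; lra|].
    replace ((d + 1) * / 2 ^ N * / (d + 1)) with (/ 2 ^ N) by (field; split; [lra|apply pow_nonzero; lra]). apply HN. }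
  assert (Ss : simplex s).
  { assert (HR : forall n, simplex (vtx (Ts n))). { intros n. specialize (HS n). destruct (Ts n) as [[? ?] ?]. apply HS. }
    repeat split; apply Rnot_lt_le; intros h.
    - destruct (small (- Re s / 2)) as [n Hn']; [lra|]. destruct (HR n) as [h1 _]. specialize (L1 n).
      apply Rabs_le_between in L1. simpl in h, Hn'. unfold Rdiv in *. lra.
    - destruct (small (- Im s / 2)) as [n Hn']; [lra|]. destruct (HR n) as [_ [h1 _]]. specialize (L2 n).
      apply Rabs_le_between in L2. simpl in h, Hn'. unfold Rdiv in *. lra.
    - destruct (small ((Re s + Im s - 1) / 4)) as [n Hn']; [lra|]. destruct (HR n) as [_ [_ h1]].
      specialize (L1 n). specialize (L2 n).
      apply Rabs_le_between in L1. apply Rabs_le_between in L2. simpl in h, Hn'. unfold Rdiv in *. lra. }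
  destruct (Hf (A s) (A_U s Ss)) as [l Hl].
  set (K := Cmod (b - a) + Cmod (c - a)).
  assert (HK : 0 <= K). { unfold K. apply Rplus_le_le_0_compat; apply Cmod_ge_0. }
  rewrite <- E0. apply Cmod_le_eps. intros e0 He0.
  (* The final estimate is [4^n * e * (5 K d/2^n) * (K d/2^n) = 5 e K^2 d^2], with [K] the Lipschitz
     constant of [bary]; the added 1 keeps the divisor positive. *)
  set (e := e0 / (5 * (K * K) * (d * d) + 1)).
  assert (Hpos : 0 < 5 * (K * K) * (d * d) + 1).
  { assert (0 <= K * K) by nra. assert (0 <= d * d) by nra. nra. }
  assert (He : 0 < e) by (apply Rdiv_lt_0_compat; auto).
  destruct (cderiv_eps _ _ _ Hl e He) as [dl [Hdl Hd]].
  destruct (small (dl / (5 * (K + 1)))) as [n Hsm]; [apply Rdiv_lt_0_compat; lra|].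
  set (dn := d / 2 ^ n) in *.
  assert (Hdn : 0 <= dn). { unfold dn. apply Rmult_le_pos; auto. left. apply Rinv_0_lt_compat, pow_lt; lra. }
  assert (Hdl2 : 5 * (K + 1) * dn < dl).
  { apply Rmult_lt_reg_r with (/ (5 * (K + 1))); [apply Rinv_0_lt_compat; lra|].
    replace (5 * (K + 1) * dn * / (5 * (K + 1))) with dn by (field; lra). apply Hsm. }
  (* The affine approximation at the limit point has an explicit primitive, so it contributes
     nothing around a triangle; only the error terms remain. *)
  set (g := fun z : C => (f (A s) + l * (z - A s))%C).
  assert (edge : forall x y, simplex x -> simplex y -> Cmod (x - y) <= dn -> Cmod (x - vtx (Ts n)) <= dn -> Cmod (y - vtx (Ts n)) <= dn ->
     exists w, (seg f (A x) (A y) = w + seg g (A x) (A y))%C /\ Cmod w <= e * (5 * K * dn) * (K * Cmod (x - y))).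
  { intros x y hx hy hxy hxv hyv.
    assert (gc : forall z, ccont g z).
    { intros z. apply ccont_plus; [apply ccont_const|]. apply ccont_mult; [apply ccont_const|].
      apply ccont_plus; [apply ccont_id|apply ccont_const]. }
    assert (go : seg_ok g (A x) (A y)) by (intros t _; apply gc).
    exists (seg (fun z => (f z - g z)%C) (A x) (A y)). rewrite seg_minus by auto. split; [ring|].
    rewrite <- seg_minus by auto.
    eapply Rle_trans.
    - apply (seg_bound _ _ _ (e * (5 * K * dn))).
      + intros t Ht. apply ccont_minus; [apply ok; auto|apply gc].
      + intros t Ht. unfold A. rewrite bary_lerp. fold A. set (w := lerp x y t).
        (* At most [4 * dn] from the limit point to the reference vertex, by the geometric tail
           [Ls], and [dn] more inside the triangle. *)
        assert (Hw : Cmod (w - s) <= 5 * dn).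
        { eapply Rle_trans; [apply (Cmod_tri3 _ (vtx (Ts n)))|]. specialize (Ls n). fold dn in Ls.
          enough (Cmod (w - vtx (Ts n)) <= dn) by lra. unfold w, lerp.
          replace (x + RtoC t * (y - x) - vtx (Ts n))%C with (RtoC (1 - t) * (x - vtx (Ts n)) + RtoC t * (y - vtx (Ts n)))%C by (rewrite RtoC_minus; ring).
          eapply Rle_trans; [apply Cmod_triangle|]. rewrite !Cmod_mult, !Cmod_R, !Rabs_right by lra. nra. }
        assert (HA : Cmod (A w - A s) <= 5 * K * dn).
        { eapply Rle_trans; [apply bary_dist|]. fold K. nra. }
        unfold g. replace (f (A w) - (f (A s) + l * (A w - A s)))%C with (f (A w) - f (A s) - l * (A w - A s))%C by ring.
        eapply Rle_trans; [apply Hd; nra|]. apply Rmult_le_compat_l; lra.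
    - apply Rmult_le_compat_l; [assert (0 <= K * dn) by nra; nra|]. rewrite (Cmod_sym x y). apply bary_dist. }
  assert (aff : forall x y, seg g x y = ((f (A s) * y + l * (y * y / 2 - A s * y)) - (f (A s) * x + l * (x * x / 2 - A s * x)))%C).
  { intros x y. rewrite (seg_prim (fun y : C => f (A s) * y + l * (y * y / 2 - A s * y))%C g); auto.
    - intros t _. set (z := lerp x y t).
      eapply cderiv_eq.
      + apply cderiv_plus; [apply cderiv_scal, cderiv_id|]. apply cderiv_scal.
        apply cderiv_minus.
        * apply (cderiv_mult (fun z : C => z * z)%C (fun _ => / 2)%C); [apply cderiv_mult; apply cderiv_id|apply cderiv_const].
        * apply cderiv_scal, cderiv_id.
      + unfold g. field.
    - intros t _. apply ccont_plus; [apply ccont_const|]. apply ccont_mult; [apply ccont_const|].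
      apply ccont_plus; [apply ccont_id|apply ccont_const]. }
  assert (Hfin : Cmod (triA (Ts n)) <= e * (5 * K * dn) * (K * dn)).
  { specialize (HS n). specialize (Hp n). fold dn in Hp. revert HS Hp edge. destruct (Ts n) as [[x y] z].
    unfold inS, perim, vtx; simpl fst. intros [h1 [h2 h3]] Hp edge.
    pose proof (Cmod_ge_0 (x - y)). pose proof (Cmod_ge_0 (y - z)). pose proof (Cmod_ge_0 (z - x)).
    destruct (edge x y) as [w1 [e1 b1]]; auto; try (rewrite ?Cmod_self; lra). { rewrite Cmod_sym. lra. }
    destruct (edge y z) as [w2 [e2 b2]]; auto; try (rewrite ?Cmod_self; lra). { rewrite Cmod_sym. lra. }
    destruct (edge z x) as [w3 [e3 b3]]; auto; try (rewrite ?Cmod_self; lra).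
    unfold triA, tri. rewrite e1, e2, e3, !aff.
    match goal with |- Cmod ?v <= _ => replace v with (w1 + w2 + w3)%C by ring end.
    eapply Rle_trans; [apply Cmod_triangle|]. eapply Rle_trans; [apply Rplus_le_compat_r, Cmod_triangle|].
    eapply Rle_trans; [apply Rplus_le_compat; [apply Rplus_le_compat; [apply b1|apply b2]|apply b3]|].
    rewrite <- Hp. right. ring. }
  eapply Rle_trans; [apply (Hk n)|].
  eapply Rle_trans; [apply Rmult_le_compat_l; [apply pow_le; lra|apply Hfin]|].
  replace (4 ^ n * (e * (5 * K * dn) * (K * dn))) with (e * (5 * (K * K) * (d * d))).
  - unfold e. apply Rmult_le_reg_r with (5 * (K * K) * (d * d) + 1); auto.
    replace (e0 / (5 * (K * K) * (d * d) + 1) * (5 * (K * K) * (d * d)) * (5 * (K * K) * (d * d) + 1))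
      with (e0 * (5 * (K * K) * (d * d))) by (field; lra). nra.
  - unfold dn. replace (4 ^ n) with (2 ^ n * 2 ^ n) by (rewrite <- Rpow_mult_distr; f_equal; lra). field. apply pow_nonzero; lra.
Qed.
End Goursat.

Lemma holo_primitive U f : copen U -> cconvex U -> holo U f ->
  exists F, forall z, U z -> cderiv F z (f z).
Proof.
  intros HO HU Hf. destruct (classic (exists p, U p)) as [[p Hp]|n].
  2:{ exists f. intros z Hz. exfalso. eauto. }
  assert (ok : forall x y, U x -> U y -> seg_ok f x y).
  { intros x y Hx Hy t Ht. destruct (Hf (lerp x y t)) as [l Hl]; [apply HU; auto|]. eapply cderiv_ccont; eauto. }
  exists (seg f p). intros z Hz. apply eps_cderiv. intros e He.
  destruct (Hf z Hz) as [l Hl]. destruct (cderiv_ccont _ _ _ Hl e He) as [d [Hd Hc]].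
  destruct (HO z Hz) as [r [Hr HrU]].
  exists (Rmin d r). split; [apply Rmin_pos; auto|]. intros w Hw.
  destruct (disk_Rmin _ _ _ _ Hw) as [Hw1 Hw2]. pose proof (HrU w Hw2) as Uw.
  pose proof (goursat U f p z w HU Hf Hp Hz Uw) as G. unfold tri in G.
  rewrite (seg_rev f p w) in G by auto.
  replace (seg f p w - seg f p z - f z * (w - z))%C with (seg f z w - f z * (w - z))%C.
  2:{ apply Ceq_minus. rewrite <- G. ring. }
  assert (E : seg (fun _ => f z) z w = (f z * (w - z))%C).
  { rewrite (seg_prim (fun y : C => f z * y)%C (fun _ => f z)); [ring| |].
    - intros t _. eapply cderiv_eq; [apply cderiv_scal, cderiv_id|ring].
    - intros t _. apply ccont_const. }
  rewrite <- E, <- seg_minus; auto.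
  2:{ intros t _. apply ccont_const. }
  apply seg_bound.
  - intros t Ht. apply ccont_minus; [apply ok; auto|apply ccont_const].
  - intros t Ht. left. apply Hc.
    replace (lerp z w t - z)%C with (RtoC t * (w - z))%C by (unfold lerp; ring).
    rewrite Cmod_mult, Cmod_R, Rabs_right by lra.
    pose proof (Cmod_ge_0 (w - z)). unfold disk in Hw1. nra.
Qed.

(** A complex function need not have a mean value point. Multiplication by the conjugate of
    [F b - F a] projects on the direction of the increment, the real theorem applies to the real
    part, and one factor [Cmod (F b - F a)] cancels. *)
Lemma mean_value_ineq (F f : C -> C) (a b : C) M :
  (forall t, 0 <= t <= 1 -> cderiv F (lerp a b t) (f (lerp a b t))) ->
  (forall t, 0 <= t <= 1 -> Cmod (f (lerp a b t)) <= M) ->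
  Cmod (F b - F a) <= M * Cmod (b - a).
Proof.
  intros HF HM. set (u := Cconj (F b - F a)).
  set (g := fun t => Re (u * F (lerp a b t))%C).
  assert (Hg : forall t, 0 <= t <= 1 -> is_derive g t (Re (u * (f (lerp a b t) * (b - a))))%C).
  { intros t Ht. pose proof (cderiv_lerp _ _ _ _ _ (cderiv_scal _ _ _ u (HF t Ht))) as H.
    assert (D : is_derive (K := R_AbsRing) (V := R_NormedModule) g t (fst (u * f (lerp a b t) * (b - a))%C)).
    { apply (filterdiff_comp' (U := R_NormedModule) (V := C_R_NormedModule) (W := R_NormedModule) (fun t => u * F (lerp a b t))%C fst t (fun y => scal y (u * f (lerp a b t) * (b - a))%C : C_R_NormedModule) fst H).
      apply (filterdiff_linear (U := C_R_NormedModule) (V := R_NormedModule) fst). apply is_linear_fst. }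
    replace (Re (u * (f (lerp a b t) * (b - a)))%C) with (fst (u * f (lerp a b t) * (b - a))%C); auto.
    unfold Re. f_equal. ring. }
  destruct (MVT_gen g 0 1 (fun t => Re (u * (f (lerp a b t) * (b - a))))%C) as [t [Ht E]].
  - intros x Hx. rewrite Rmin_left, Rmax_right in Hx by lra. apply Hg. lra.
  - intros x Hx. rewrite Rmin_left, Rmax_right in Hx by lra.
    apply continuity_pt_filterlim. apply (ex_derive_continuous g). eexists. apply Hg. auto.
  - rewrite Rmin_left, Rmax_right in Ht by lra.
    unfold g in E. rewrite lerp_0, lerp_1 in E.
    assert (E2 : Cmod (F b - F a) * Cmod (F b - F a) = Re (u * F b) - Re (u * F a)).
    { replace (Re (u * F b) - Re (u * F a)) with (Re ((F b - F a) * u)%C) by (simpl; ring).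
      unfold u. rewrite <- Cmod2_conj. rewrite re_RtoC. ring. }
    rewrite E in E2.
    assert (Hb : Cmod (F b - F a) * Cmod (F b - F a) <= Cmod (F b - F a) * (M * Cmod (b - a))).
    { rewrite E2. eapply Rle_trans; [rewrite Rmult_minus_distr_l; rewrite Rmult_0_r, Rmult_1_r, Rminus_0_r; apply Rle_abs|].
      eapply Rle_trans; [apply re_le_Cmod|]. rewrite !Cmod_mult. unfold u. rewrite Cmod_conj.
      apply Rmult_le_compat_l; [apply Cmod_ge_0|]. apply Rmult_le_compat_r; [apply Cmod_ge_0|]. auto. }
    destruct (Rle_lt_or_eq_dec 0 _ (Cmod_ge_0 (F b - F a))) as [h|h].
    + apply Rmult_le_reg_l with (2 := Hb). auto.
    + rewrite <- h. apply Rmult_le_pos; [|apply Cmod_ge_0]. eapply Rle_trans; [apply Cmod_ge_0|apply (HM 0); lra].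
Qed.

Lemma deriv0_const U F a b : cconvex U -> U a -> U b -> (forall z, U z -> cderiv F z 0%C) -> F a = F b.
Proof.
  intros HU Ha Hb H. symmetry. apply Cmod_sub_eq0.
  eapply Rle_trans; [apply (mean_value_ineq F (fun _ => 0%C) a b 0)|].
  - intros t Ht. apply H, HU; auto.
  - intros. rewrite Cmod_0. lra.
  - lra.
Qed.

(** * Exponential, logarithm and the identity theorem *)

Lemma Cexp_plus a b : Cexp (a + b) = (Cexp a * Cexp b)%C.
Proof.
  unfold Cexp. destruct a as [x y], b as [u v]. simpl. rewrite exp_plus, cos_plus, sin_plus.
  apply C_eq; simpl; ring.
Qed.

Lemma Cexp_0 : Cexp 0 = 1%C.
Proof. unfold Cexp; simpl. rewrite exp_0, cos_0, sin_0. apply C_eq; simpl; ring. Qed.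

Lemma Cmod_Cexp z : Cmod (Cexp z) = exp (Re z).
Proof.
  unfold Cexp, Cmod; simpl fst; simpl snd.
  replace ((exp (Re z) * cos (Im z)) ^ 2 + (exp (Re z) * sin (Im z)) ^ 2) with ((exp (Re z)) ^ 2 * (Rsqr (sin (Im z)) + Rsqr (cos (Im z)))) by (unfold Rsqr; ring).
  rewrite sin2_cos2, Rmult_1_r. apply sqrt_pow2. left. apply exp_pos.
Qed.

Lemma Cexp_neq0 z : Cexp z <> 0%C.
Proof. apply Cmod_gt_0. rewrite Cmod_Cexp. apply exp_pos. Qed.

Lemma Cexp_opp z : Cexp (- z) = (/ Cexp z)%C.
Proof.
  assert (H : (Cexp (- z) * Cexp z)%C = 1%C).
  { rewrite <- Cexp_plus. replace (- z + z)%C with (RtoC 0) by ring. apply Cexp_0. }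
  replace (/ Cexp z)%C with (Cexp (- z) * Cexp z * / Cexp z)%C by (rewrite H; ring).
  field. apply Cexp_neq0.
Qed.

Lemma Cexp_2pi : Cexp twopii = 1%C.
Proof.
  unfold Cexp, twopii; simpl. rewrite exp_0, cos_2PI, sin_2PI. apply C_eq; simpl; ring.
Qed.

Lemma Cexp_per z : Cexp (z + twopii) = Cexp z.
Proof. rewrite Cexp_plus, Cexp_2pi. ring. Qed.

Lemma Cexp_ipi : Cexp (0, PI) = m1.
Proof.
  unfold Cexp, m1; simpl. rewrite exp_0, cos_PI, sin_PI. apply C_eq; simpl; ring.
Qed.

Lemma derivable_eps f l : derivable_pt_lim f 0 l -> forall e, 0 < e -> exists d, 0 < d /\
  forall h, Rabs h < d -> Rabs (f h - f 0 - l * h) <= e * Rabs h.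
Proof.
  intros H e He. destruct (H e He) as [d K]. exists d. split; [apply cond_pos|]. intros h Hh.
  destruct (Req_dec h 0) as [->|n].
  - replace (f 0 - f 0 - l * 0) with 0 by ring. rewrite Rabs_R0. lra.
  - specialize (K h n Hh). rewrite Rplus_0_l in K.
    replace (f h - f 0 - l * h) with (((f h - f 0) / h - l) * h) by (field; auto).
    rewrite Rabs_mult. apply Rmult_le_compat_r; [apply Rabs_pos|lra].
Qed.

Lemma cderiv_Cexp z : cderiv Cexp z (Cexp z).
Proof.
  assert (H0 : cderiv Cexp 0%C 1%C).
  (* The four error terms add up to [6 k |w|], hence [e / 8]. The bounds [k <= 1/2] and [|w| < k/2]
     give [|exp x - 1| <= k] and [exp x <= 2]. *)
  { apply eps_cderiv. intros e He. set (k := Rmin (/2) (e / 8)).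
    assert (Hk : 0 < k) by (apply Rmin_pos; lra).
    assert (k1 : k <= /2) by apply Rmin_l. assert (k2 : k <= e / 8) by apply Rmin_r.
    pose proof (derivable_pt_lim_exp 0) as D1. rewrite exp_0 in D1.
    pose proof (derivable_pt_lim_cos 0) as D2. rewrite sin_0 in D2.
    pose proof (derivable_pt_lim_sin 0) as D3. rewrite cos_0 in D3.
    destruct (derivable_eps _ _ D1 k Hk) as [d1 [p1 K1]].
    destruct (derivable_eps _ _ D2 k Hk) as [d2 [p2 K2]].
    destruct (derivable_eps _ _ D3 k Hk) as [d3 [p3 K3]].
    rewrite exp_0 in K1. rewrite cos_0 in K2. rewrite sin_0 in K3.
    exists (Rmin (Rmin d1 d2) (Rmin d3 (k / 2))). split; [repeat apply Rmin_pos; lra|].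
    intros [x y] Hw. rewrite Cexp_0. replace ((x, y) - 0)%C with ((x, y) : C) in * by (apply C_eq; simpl; ring).
    pose proof (re_le_Cmod (x, y)) as Rx. pose proof (im_le_Cmod (x, y)) as Ry. simpl Re in Rx. simpl Im in Ry.
    pose proof (Rmin_l (Rmin d1 d2) (Rmin d3 (k/2))). pose proof (Rmin_r (Rmin d1 d2) (Rmin d3 (k/2))).
    pose proof (Rmin_l d1 d2). pose proof (Rmin_r d1 d2). pose proof (Rmin_l d3 (k/2)). pose proof (Rmin_r d3 (k/2)).
    assert (Hx : Rabs (exp x - 1 - 1 * x) <= k * Rabs x) by (apply K1; lra).
    assert (Hy : Rabs (cos y - 1 - - 0 * y) <= k * Rabs y) by (apply K2; lra).
    assert (Hz : Rabs (sin y - 0 - 1 * y) <= k * Rabs y) by (apply K3; lra).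
    set (m := Cmod (x, y)) in *. pose proof (Rabs_pos x). pose proof (Rabs_pos y).
    eapply Rle_trans; [apply Cmod_le_sum|].
    replace (Re (Cexp (x, y) - 1 - 1 * (x, y))%C) with ((exp x - 1 - 1 * x) + exp x * (cos y - 1 - - 0 * y)) by (simpl; ring).
    replace (Im (Cexp (x, y) - 1 - 1 * (x, y))%C) with (exp x * (sin y - 0 - 1 * y) + (exp x - 1) * y) by (simpl; ring).
    assert (He1 : Rabs (exp x - 1) <= k).
    { replace (exp x - 1) with ((exp x - 1 - 1 * x) + x) by ring. eapply Rle_trans; [apply Rabs_triang|]. nra. }
    assert (He2 : Rabs (exp x) <= 2). 
    { replace (exp x) with ((exp x - 1) + 1) by ring. eapply Rle_trans; [apply Rabs_triang|]. rewrite (Rabs_right 1) by lra. lra. }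
    pose proof (Rabs_triang (exp x - 1 - 1 * x) (exp x * (cos y - 1 - - 0 * y))) as T1.
    pose proof (Rabs_triang (exp x * (sin y - 0 - 1 * y)) ((exp x - 1) * y)) as T2.
    rewrite Rabs_mult in T1. rewrite Rabs_mult in T2. pose proof (Rabs_pos (exp x)). pose proof (Rabs_pos (exp x - 1)).
    pose proof (Rabs_pos (cos y - 1 - - 0 * y)). pose proof (Rabs_pos (sin y - 0 - 1 * y)).
    assert (Rabs (exp x) * Rabs (cos y - 1 - - 0 * y) <= 2 * (k * m)) by (apply Rmult_le_compat; nra).
    assert (Rabs (exp x) * Rabs (sin y - 0 - 1 * y) <= 2 * (k * m)) by (apply Rmult_le_compat; nra).
    assert (Rabs (exp x - 1) * Rabs y <= k * m) by (apply Rmult_le_compat; lra).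
    assert (Rabs (exp x - 1 - 1 * x) <= k * m) by nra.
    assert (0 <= m) by apply Cmod_ge_0. assert (k * m <= e / 8 * m) by (apply Rmult_le_compat_r; lra). assert (0 <= e * m) by nra. rewrite Rabs_mult in T2. lra. }
  apply (cderiv_local (fun w => Cexp z * Cexp (w - z))%C _ _ _ 1 Rlt_0_1).
  { intros w _. rewrite <- Cexp_plus. f_equal. ring. }
  eapply cderiv_eq.
  - apply cderiv_scal. apply (cderiv_comp (fun w => w - z)%C Cexp).
    + apply cderiv_plus; [apply cderiv_id|apply cderiv_const].
    + replace (z - z)%C with (RtoC 0) by ring. exact H0.
  - ring.
Qed.

Lemma Carg_cos_sin (z : C) : z <> 0%C -> cos (Carg z) = Re z / Cmod z /\ sin (Carg z) = Im z / Cmod z.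
Proof.
  intros Hz. pose proof (proj1 (Cmod_gt_0 z) Hz) as Hp.
  assert (Hr : -1 <= Re z / Cmod z <= 1).
  { pose proof (re_le_Cmod z) as H. apply Rabs_le_between in H.
    split; apply Rmult_le_reg_r with (Cmod z); auto; unfold Rdiv; rewrite Rmult_assoc, Rinv_l; lra. }
  assert (Hs : sqrt (1 - (Re z / Cmod z)²) = Rabs (Im z) / Cmod z).
  { rewrite <- (sqrt_Rsqr (Rabs (Im z) / Cmod z)).
    - f_equal. unfold Rsqr. pose proof (Cmod2_alt z) as E.
      replace (Rabs (Im z) / Cmod z * (Rabs (Im z) / Cmod z)) with ((Rabs (Im z) * Rabs (Im z)) / (Cmod z ^ 2)) by (field; lra).
      rewrite <- Rabs_mult, Rabs_right by (apply Rle_ge, Rle_0_sqr).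
      replace (Im z * Im z) with (Cmod z ^ 2 - Re z ^ 2) by (rewrite E; ring). field. lra.
    - apply Rmult_le_pos; [apply Rabs_pos|left; apply Rinv_0_lt_compat; auto]. }
  unfold Carg. destruct Rle_dec as [h|h].
  - rewrite cos_acos, sin_acos, Hs, Rabs_right by lra. auto.
  - rewrite cos_neg, sin_neg, cos_acos, sin_acos, Hs, Rabs_left by lra. split; auto. field. lra.
Qed.

Lemma Cexp_Clog (z : C) : z <> 0%C -> Cexp (Clog z) = z.
Proof.
  intros Hz. pose proof (proj1 (Cmod_gt_0 z) Hz) as Hp.
  destruct (Carg_cos_sin z Hz) as [h1 h2]. unfold Cexp, Clog; simpl. rewrite exp_ln, h1, h2 by auto.
  apply C_eq; simpl; field; lra.
Qed.

(** The test by which two branches of a logarithm are identified at a point. It holds because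
    [cos t = 1 - 2 sin^2 (t/2)] equals 1 only at [t = 0] when [|t| < 2 pi]. *)
Lemma Cexp_inj a b : Cexp a = Cexp b -> Rabs (Im a - Im b) < 2 * PI -> a = b.
Proof.
  intros H HI.
  assert (E : Re a = Re b).
  { apply exp_inv. rewrite <- !Cmod_Cexp, H. auto. }
  assert (Hc : cos (Im a - Im b) = 1).
  { unfold Cexp in H. injection H as H1 H2. rewrite E in H1, H2. pose proof (exp_pos (Re b)).
    apply Rmult_eq_reg_l in H1; [|lra]. apply Rmult_eq_reg_l in H2; [|lra].
    rewrite cos_minus, H1, H2. pose proof (sin2_cos2 (Im b)) as K. unfold Rsqr in K. lra. }
  apply C_eq; auto. apply Rminus_diag_uniq.
  set (t := Im a - Im b) in *. destruct (Req_dec t 0) as [->|n]; auto. exfalso.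
  assert (Hs : 0 < Rabs t) by (apply Rabs_pos_lt; auto).
  assert (Hc' : cos (Rabs t) = 1). { unfold Rabs. destruct Rcase_abs; [rewrite cos_neg|]; auto. }
  replace (Rabs t) with (2 * (Rabs t / 2)) in Hc' by field. rewrite cos_2a_sin in Hc'.
  assert (0 < sin (Rabs t / 2)) by (apply sin_gt_0; lra). nra.
Qed.

Lemma Carg_bound (z : C) : z <> 0%C -> - PI <= Carg z <= PI.
Proof.
  intros _. pose proof (acos_bound (Re z / Cmod z)). unfold Carg. pose proof PI_RGT_0. destruct Rle_dec; lra.
Qed.

Lemma Im_Clog_sign (z : C) : z <> 0%C -> (0 < Im z -> 0 < Im (Clog z) < PI) /\ (Im z < 0 -> - PI < Im (Clog z) < 0) /\ (0 < Re z -> - PI < Im (Clog z) < PI).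
Proof.
  intros Hz. pose proof (Carg_bound z Hz) as B. destruct (Carg_cos_sin z Hz) as [h1 h2].
  pose proof (proj1 (Cmod_gt_0 z) Hz) as Hp. simpl. pose proof PI_RGT_0.
  all: pose proof (acos_bound (Re z / Cmod z)) as AB. repeat split; try intros Hi.
  - unfold Carg in *. destruct Rle_dec; [|lra].
    assert (acos (Re z / Cmod z) <> 0); [|lra]. intros e. rewrite e, sin_0 in h2.
    assert (Im z / Cmod z > 0) by (apply Rdiv_lt_0_compat; lra). lra.
  - unfold Carg in *. destruct Rle_dec; [|lra].
    assert (acos (Re z / Cmod z) <> PI); [|lra]. intros e. rewrite e, sin_PI in h2.
    assert (Im z / Cmod z > 0) by (apply Rdiv_lt_0_compat; lra). lra.
  - assert (Carg z <> - PI); [|lra]. intros e. rewrite e, sin_neg, sin_PI in h2.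
    assert (- Im z / Cmod z > 0) by (apply Rdiv_lt_0_compat; lra). unfold Rdiv in *. lra.
  - unfold Carg in *. destruct Rle_dec; [lra|].
    assert (acos (Re z / Cmod z) <> 0). { intros e. rewrite e, Ropp_0, sin_0 in h2.
    assert (- Im z / Cmod z > 0) by (apply Rdiv_lt_0_compat; lra). unfold Rdiv in *. lra. }
    pose proof (acos_bound (Re z / Cmod z)). lra.
  - assert (Carg z <> - PI); [|lra]. intros e. rewrite e, cos_neg, cos_PI in h1.
    assert (Re z / Cmod z > 0) by (apply Rdiv_lt_0_compat; lra). lra.
  - assert (Carg z <> PI); [|lra]. intros e. rewrite e, cos_PI in h1.
    assert (Re z / Cmod z > 0) by (apply Rdiv_lt_0_compat; lra). lra.
Qed.

(** * Circle means and the identity theorem *)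

Lemma halfplane_open r : copen (fun w => Re w < r).
Proof.
  intros z Hz. exists (r - Re z). split; [lra|]. intros w Hw.
  pose proof (re_le_Cmod (w - z)) as H. change (Re (w - z)) with (Re w - Re z) in H. apply Rabs_le_between in H. lra.
Qed.

Lemma halfplane_convex r : cconvex (fun w => Re w < r).
Proof.
  intros [a1 a2] [b1 b2] t Ha Hb Ht. simpl in *. destruct (Req_dec t 1) as [->|n]; nra.
Qed.

Lemma Re_lerp_2pi (w : C) t : Re (lerp w (w + twopii) t) = Re w /\ Im (lerp w (w + twopii) t) = Im w + t * (2 * PI).
Proof. unfold lerp, twopii. destruct w; simpl. split; ring. Qed.

Lemma Cmod_2pi : Cmod twopii = 2 * PI.
Proof.
  replace twopii with (Ci * RtoC (2 * PI))%C by (apply C_eq; simpl; ring).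
  rewrite Cmod_mult, Cmod_Ci, Cmod_R, Rabs_right by (pose proof PI_RGT_0; lra). ring.
Qed.

Lemma cderiv_shift F a z l : cderiv F (z + a)%C l -> cderiv (fun w => F (w + a)%C) z l.
Proof.
  intros H. eapply cderiv_eq; [apply (cderiv_comp (fun w => w + a)%C F z 1%C l); auto|ring].
  eapply cderiv_eq; [apply cderiv_plus; [apply cderiv_id|apply cderiv_const]|ring].
Qed.

(* The integral over the circle of radius [exp (Re w)] is [G (w + 2 i pi) - G w]
   for a primitive [G] of [f (z + exp w)]; it does not depend on the radius. *)
Lemma circle_mean_bound f z R0 rho M : holo (disk z R0) f -> 0 < rho < R0 ->
  (forall w, Cmod (w - z) = rho -> Cmod (f w) <= M) -> Cmod (f z) <= M.
Proof.
  intros Hf Hr HM. set (g := fun w => f (z + Cexp w)%C). set (H := fun w : C => Re w < ln R0).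
  assert (Hin : forall w, H w -> disk z R0 (z + Cexp w)%C).
  { intros w Hw. unfold disk. replace (z + Cexp w - z)%C with (Cexp w) by ring. rewrite Cmod_Cexp.
    rewrite <- (exp_ln R0) by lra. apply exp_increasing. auto. }
  destruct (holo_primitive H g) as [G HG].
  { apply halfplane_open. } { apply halfplane_convex. }
  { intros w Hw. destruct (Hf _ (Hin w Hw)) as [l Hl]. eexists.
    apply (cderiv_comp (fun w => z + Cexp w)%C f); [|exact Hl].
    apply cderiv_plus; [apply cderiv_const|apply cderiv_Cexp]. }
  assert (Hsh : forall w, H w -> H (w + twopii)%C) by (intros w; unfold H, twopii, Re; simpl; intros; lra).
  assert (Hg : forall w, g (w + twopii)%C = g w) by (intros; unfold g; rewrite Cexp_per; auto).
  (* The derivative of the period is [g (w + twopii) - g w], which vanishes because [g] depends on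
     [w] through [Cexp w] only. *)
  assert (cst : forall w w', H w -> H w' -> (G (w + twopii) - G w)%C = (G (w' + twopii) - G w')%C).
  { intros w w' h h'. apply (deriv0_const H (fun w => G (w + twopii) - G w)%C); auto; [apply halfplane_convex|].
    intros v hv. eapply cderiv_eq.
    - apply cderiv_minus; [apply cderiv_shift, HG, Hsh|apply HG]; auto.
    - rewrite Hg. ring. }
  assert (Hdz : disk z R0 z) by (unfold disk; rewrite Cmod_self; lra).
  destruct (Hf z Hdz) as [l Hl]. apply cderiv_ccont in Hl.
  apply Rnot_lt_le. intros Hlt. set (e := (Cmod (f z) - M) / 2). assert (He : 0 < e) by (unfold e; lra).
  destruct (Hl e He) as [d [Hd Hc]].
  set (x0 := ln (Rmin d R0 / 2)). set (w0 := (x0, 0) : C).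
  assert (Hm : 0 < Rmin d R0) by (apply Rmin_pos; lra).
  assert (Hx0 : exp x0 = Rmin d R0 / 2) by (apply exp_ln; lra).
  assert (Hw0 : H w0). { unfold H, w0; simpl. apply ln_increasing; [lra|]. pose proof (Rmin_r d R0). lra. }
  set (w1 := (ln rho, 0) : C). assert (Hw1 : H w1) by (unfold H, w1; simpl; apply ln_increasing; lra).
  assert (B1 : Cmod (G (w1 + twopii) - G w1)%C <= M * Cmod (w1 + twopii - w1)).
  { apply (mean_value_ineq G g).
    - intros t Ht. apply HG. unfold H. rewrite (proj1 (Re_lerp_2pi _ _)). auto.
    - intros t Ht. apply HM. replace (z + Cexp (lerp w1 (w1 + twopii) t) - z)%C with (Cexp (lerp w1 (w1 + twopii) t)) by ring.
      rewrite Cmod_Cexp, (proj1 (Re_lerp_2pi _ _)). simpl. apply exp_ln. lra. }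
  (* On the small circle [f] is within [e] of [f z], so the period is within [2 pi e] of
     [twopii * f z]; on the circle of radius [rho] it is at most [2 pi M]. *)
  assert (B0 : Cmod ((G (w0 + twopii) - f z * (w0 + twopii)) - (G w0 - f z * w0))%C <= e * Cmod (w0 + twopii - w0)).
  { apply (mean_value_ineq (fun w => G w - f z * w)%C (fun w => g w - f z)%C).
    - intros t Ht. eapply cderiv_eq.
      + apply cderiv_minus; [apply HG; unfold H; rewrite (proj1 (Re_lerp_2pi _ _)); auto|apply cderiv_scal, cderiv_id].
      + ring.
    - intros t Ht. left. apply Hc. replace (z + Cexp (lerp w0 (w0 + twopii) t) - z)%C with (Cexp (lerp w0 (w0 + twopii) t)) by ring.
      rewrite Cmod_Cexp, (proj1 (Re_lerp_2pi _ _)). simpl Re. rewrite Hx0. pose proof (Rmin_l d R0). lra. }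
  replace (w1 + twopii - w1)%C with twopii in B1 by ring. replace (w0 + twopii - w0)%C with twopii in B0 by ring.
  rewrite (cst w1 w0 Hw1 Hw0) in B1. rewrite Cmod_2pi in *.
  assert (B2 : Cmod (f z * twopii) <= M * (2 * PI) + e * (2 * PI)).
  { replace (f z * twopii)%C with ((G (w0 + twopii) - G w0) + - ((G (w0 + twopii) - f z * (w0 + twopii)) - (G w0 - f z * w0)))%C by ring.
    eapply Rle_trans; [apply Cmod_triangle|]. rewrite Cmod_opp. lra. }
  rewrite Cmod_mult, Cmod_2pi in B2. pose proof PI_RGT_0.
  assert (Cmod (f z) <= M + e) by (apply Rmult_le_reg_r with (2 * PI); lra). unfold e in *. lra.
Qed.

Lemma holo_circle_bounded f z R0 s : holo (disk z R0) f -> 0 < s < R0 ->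
  exists M, forall w, Cmod (w - z) = s -> Cmod (f w) <= M.
Proof.
  intros Hf Hs. set (p := fun t : R => (z + Cexp (ln s, t))%C).
  assert (Hp : forall t, Cmod (p t - z) = s).
  { intros t. unfold p. replace (z + Cexp (ln s, t) - z)%C with (Cexp (ln s, t)) by ring.
    rewrite Cmod_Cexp. simpl. apply exp_ln. lra. }
  destruct (continuity_ab_maj (fun t => Cmod (f (p t))) (- PI) PI) as [Mx [H1 H2]].
  - pose proof PI_RGT_0. lra.
  - intros t _. intros e He.
    assert (Hc : ccont (fun w => f (z + Cexp w)%C) (ln s, t)).
    { apply (ccont_comp (fun w => z + Cexp w)%C f).
      - apply ccont_plus; [apply ccont_const|]. eapply cderiv_ccont, cderiv_Cexp.
      - destruct (Hf (p t)) as [l Hl]; [unfold disk; rewrite Hp; lra|]. eapply cderiv_ccont, Hl. }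
    destruct (Hc e He) as [d [Hd K]]. exists d. split; auto. intros u [_ Hu].
    simpl in *. unfold R_dist in *. assert (Hk : Cmod ((ln s, u) - (ln s, t)) < d).
    { replace ((ln s, u) - (ln s, t))%C with (Ci * RtoC (u - t))%C by (apply C_eq; simpl; ring).
      rewrite Cmod_mult, Cmod_Ci, Cmod_R. lra. }
    specialize (K _ Hk). eapply Rle_lt_trans; [|exact K]. fold (p u) (p t).
    pose proof (Cmod_rev_tri (f (p u)) (f (p t))). pose proof (Cmod_rev_tri (f (p t)) (f (p u))).
    rewrite (Cmod_sym (f (p t))) in H0. apply Rabs_le. lra.
  - exists (Cmod (f (p Mx))). intros w Hw.
    assert (n : (w - z)%C <> 0%C). { apply Cmod_gt_0. lra. }
    replace w with (p (Carg (w - z))%C); [apply H1, Carg_bound; auto|].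
    unfold p. rewrite <- Hw. change (ln (Cmod (w - z)), Carg (w - z)) with (Clog (w - z)).
    rewrite Cexp_Clog by auto. ring.
Qed.

(* On the unit circle, [Re (u^2 - 2 u) = 2 x^2 - 2 x - 1 <= -3/8] as soon as
   [x = Re u >= -1/4], while [u^2 - 2 u] vanishes at the centre: multiplying by
   [exp (n (u^2 - 2 u))] kills the rest of the circle. *)
Lemma arc_uniqueness f z R0 s : holo (disk z R0) f -> 0 < s < R0 ->
  (forall w, Cmod (w - z) = s -> Re (w - z) < - s / 4 -> f w = 0%C) -> f z = 0%C.
Proof.
  intros Hf Hs H0. destruct (holo_circle_bounded f z R0 s Hf Hs) as [M HM].
  set (phi := fun w : C => (((w - z) / s) * ((w - z) / s) - 2 * ((w - z) / s))%C).
  assert (Hs0 : RtoC s <> 0%C) by (intros e; apply RtoC_inj in e; lra).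
  assert (Hphi : forall w, exists l, cderiv phi w l).
  { intros w. eexists. unfold phi.
    assert (D : cderiv (fun w : C => (w - z) / s)%C w (1 / s)%C).
    { eapply cderiv_eq; [apply (cderiv_mult (fun w => w - z)%C (fun _ => / s)%C); [apply cderiv_plus; [apply cderiv_id|apply cderiv_const]|apply cderiv_const]|]. field; auto. }
    apply cderiv_minus; [apply (cderiv_mult _ _ _ _ _ D D)|apply cderiv_scal, D]. }
  assert (HB : forall n : nat, Cmod (f z) <= Rmax M 0 * exp (- (3/8) * INR n)).
  { intros n.
    assert (E : (f z * Cexp (RtoC (INR n) * phi z))%C = f z).
    { unfold phi. replace (RtoC (INR n) * ((z - z) / s * ((z - z) / s) - 2 * ((z - z) / s)))%C with (RtoC 0) by (field; auto).
      rewrite Cexp_0. ring. }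
    rewrite <- E.
    apply (circle_mean_bound (fun w => f w * Cexp (RtoC (INR n) * phi w))%C z R0 s); auto.
    - intros w Hw. destruct (Hf w Hw) as [l Hl]. destruct (Hphi w) as [l' Hl']. eexists.
      apply cderiv_mult; [exact Hl|]. apply (cderiv_comp (fun w => RtoC (INR n) * phi w)%C Cexp); [|apply cderiv_Cexp].
      apply cderiv_scal. exact Hl'.
    - intros w Hw. destruct (Rlt_dec (Re (w - z)) (- s / 4)) as [h|h].
      + rewrite (H0 w Hw h). rewrite Cmult_0_l, Cmod_0. apply Rmult_le_pos; [apply Rmax_r|left; apply exp_pos].
      + rewrite Cmod_mult. apply Rmult_le_compat; try apply Cmod_ge_0.
        { eapply Rle_trans; [apply HM; auto|apply Rmax_l]. }
        rewrite Cmod_Cexp. rewrite re_scal_l.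
        set (v := (w - z)%C) in *. assert (Ev : Re (phi w) = (Re v ^ 2 - Im v ^ 2) / s ^ 2 - 2 * Re v / s).
        { unfold phi. fold v. destruct v as [x y]. unfold Cdiv. rewrite <- RtoC_inv by lra. simpl. field. lra. }
        pose proof (Cmod2_alt v) as Em. rewrite Hw in Em.
        assert (Hx : Re v <= s). { pose proof (re_le_Cmod v) as Hx. rewrite Hw in Hx. apply Rabs_le_between in Hx. lra. }
        assert (Hphiw : Re (phi w) <= - (3/8)).
        { rewrite Ev. replace (Im v ^ 2) with (s ^ 2 - Re v ^ 2) by lra.
          set (x := Re v) in *. apply Rmult_le_reg_r with (s ^ 2); [nra|].
          replace (((x ^ 2 - (s ^ 2 - x ^ 2)) / s ^ 2 - 2 * x / s) * s ^ 2) with (2 * x ^ 2 - s ^ 2 - 2 * x * s) by (field; lra).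
          assert (- s / 4 <= x) by lra. assert (0 <= (x + s / 4) * (s - x)) by (apply Rmult_le_pos; lra). nra. }
        pose proof (pos_INR n). assert (L : INR n * Re (phi w) <= - (3/8) * INR n) by nra.
        apply exp_mono, L. }
  apply Cmod_le_eps. intros e He.
  assert (HR : 0 <= Rmax M 0) by apply Rmax_r.
  destruct (INR_unbounded (Rmax M 0 / (3/8 * e))) as [n Hn].
  eapply Rle_trans; [apply (HB n)|].
  assert (Hn2 : Rmax M 0 < 3/8 * INR n * e).
  { apply Rmult_lt_reg_r with (/ (3/8 * e)); [apply Rinv_0_lt_compat; lra|].
    replace (3/8 * INR n * e * / (3/8 * e)) with (INR n) by (field; lra). apply Hn. }
  pose proof (pos_INR n).
  pose proof (exp_ineq1_le (3/8 * INR n)).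
  replace (- (3/8) * INR n) with (- (3/8 * INR n)) by ring. rewrite exp_Ropp.
  pose proof (exp_pos (3/8 * INR n)).
  apply Rmult_le_reg_r with (exp (3/8 * INR n)); auto. rewrite Rmult_assoc, Rinv_l by lra. nra.
Qed.

(** In the coordinate [w = log (z - z0)] the wedge is a horizontal strip. Since [f] vanishes there,
    it may be replaced by zero everywhere below the height 1/4 without losing differentiability,
    periodicity being given up. The new function vanishes on a large region, from which
    [arc_uniqueness] reaches up through a full turn of the argument. *)
Lemma wedge_uniqueness f z0 r : 0 < r -> holo (disk z0 r) f ->
  (forall w, Re w < ln r -> 0 < Im w < / 2 -> f (z0 + Cexp w)%C = 0%C) ->
  exists e, 0 < e /\ forall z, disk z0 e z -> f z = 0%C.
Proof.
  intros Hr Hf H0.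
  set (h := fun w : C => if Rlt_dec (Im w) (/4) then RtoC 0 else f (z0 + Cexp w)%C).
  assert (Hg : forall w, Re w < ln r -> exists l, cderiv (fun w => f (z0 + Cexp w)%C) w l).
  { intros w Hw. destruct (Hf (z0 + Cexp w)%C) as [l Hl].
    - unfold disk. replace (z0 + Cexp w - z0)%C with (Cexp w) by ring. rewrite Cmod_Cexp.
      rewrite <- (exp_ln r) by lra. apply exp_increasing. auto.
    - eexists. apply (cderiv_comp (fun w => z0 + Cexp w)%C f); [|exact Hl].
      apply cderiv_plus; [apply cderiv_const|apply cderiv_Cexp]. }
  assert (Him : forall w v : C, Rabs (Im w - Im v) <= Cmod (w - v)).
  { intros w v. pose proof (im_le_Cmod (w - v)) as H. exact H. }
  assert (Hre : forall w v : C, Rabs (Re w - Re v) <= Cmod (w - v)).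
  { intros w v. pose proof (re_le_Cmod (w - v)) as H. exact H. }
  assert (Hh : forall w, Re w < ln r -> exists l, cderiv h w l).
  { intros w Hw. destruct (Rlt_dec (Im w) (1/2)) as [c|c].
    - exists 0%C. set (d := Rmin (1/2 - Im w) (ln r - Re w)). assert (Hd : 0 < d) by (apply Rmin_pos; lra).
      apply (cderiv_local (fun _ => 0%C) _ _ _ d Hd); [|apply cderiv_const].
      intros v Hv. pose proof (Rmin_l (1/2 - Im w) (ln r - Re w)). pose proof (Rmin_r (1/2 - Im w) (ln r - Re w)). fold d in H, H1.
      specialize (Him v w). specialize (Hre v w). apply Rabs_le_between in Him. apply Rabs_le_between in Hre.
      unfold h. destruct Rlt_dec; auto. symmetry. apply H0; lra.
    - destruct (Hg w Hw) as [l Hl]. exists l. apply (cderiv_local (fun w => f (z0 + Cexp w)%C) _ _ _ (/4) ltac:(lra)); auto.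
      intros v Hv. specialize (Him v w). apply Rabs_le_between in Him. unfold h. destruct Rlt_dec; auto. lra. }
  (* The circle of radius 36 about [w] is turned by [Ci], so that [Re x] becomes a height. Where
     [Re x < -9], the height is below [1/4 + 2 pi - 9 < 1/4] since [PI <= 4], and [h] is zero.
     Staying 37 to the left of [ln r] keeps the whole disk in the domain. *)
  assert (key : forall w, Re w < ln r - 37 -> /4 <= Im w <= /4 + 2 * PI -> f (z0 + Cexp w)%C = 0%C).
  { intros w Hw HI.
    assert (E : h w = 0%C).
    { replace w with (w + Ci * 0)%C by ring.
      apply (arc_uniqueness (fun x => h (w + Ci * x)%C) 0%C 37 36); [|lra|].
      - intros x Hx. unfold disk in Hx. replace (x - 0)%C with x in Hx by ring.
        assert (HRe : Re (w + Ci * x)%C < ln r).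
        { pose proof (im_le_Cmod x) as B. apply Rabs_le_between in B.
          replace (Re (w + Ci * x)%C) with (Re w - Im x) by (unfold Re, Im; simpl; ring). lra. }
        destruct (Hh _ HRe) as [l Hl]. eexists. apply (cderiv_comp (fun x => w + Ci * x)%C h); [|exact Hl].
        apply cderiv_plus; [apply cderiv_const|apply cderiv_scal, cderiv_id].
      - intros x _ Hx. replace (x - 0)%C with x in Hx by ring. unfold h. destruct Rlt_dec as [c|c]; auto. exfalso. apply c.
        replace (Im (w + Ci * x)%C) with (Im w + Re x) by (unfold Re, Im; simpl; ring). pose proof PI_4. lra. }
    unfold h in E. destruct Rlt_dec; [lra|auto]. }
  set (e := exp (ln r - 37)). assert (He : 0 < e) by apply exp_pos.
  assert (Hz : forall z, disk z0 e z -> z <> z0 -> f z = 0%C).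
  { intros z Hz n. assert (n' : (z - z0)%C <> 0%C) by (intros q; apply n, Ceq_minus; auto).
    pose proof (Carg_bound _ n') as B. pose proof PI_RGT_0. pose proof PI2_1.
    assert (HR : Re (Clog (z - z0)) < ln r - 37).
    { simpl. apply exp_lt_inv. rewrite exp_ln by (apply Cmod_gt_0; auto). exact Hz. }
    (* Arguments below 1/4 are raised by one turn to fall into the window [[1/4, 1/4 + 2 pi]] of
       [key]. *)
    destruct (Rlt_dec (Im (Clog (z - z0))) (/4)) as [c|c].
    - replace z with (z0 + Cexp (Clog (z - z0) + twopii))%C by (rewrite Cexp_per, Cexp_Clog by auto; ring).
      apply key; unfold twopii; simpl in *; lra.
    - replace z with (z0 + Cexp (Clog (z - z0)))%C by (rewrite Cexp_Clog by auto; ring).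
      apply key; simpl in *; lra. }
  exists e. split; auto. intros z Dz. destruct (classic (z = z0)) as [->|n]; [|auto].
  destruct (Hf z0) as [l Hl]; [unfold disk; rewrite Cmod_self; auto|]. apply cderiv_ccont in Hl.
  apply Cmod_le_eps. intros eps Heps. destruct (Hl eps Heps) as [d [Hd K]].
  set (x := Rmin d e / 2). assert (Hx : 0 < Rmin d e) by (apply Rmin_pos; auto).
  assert (Ex : Cmod (z0 + RtoC x - z0) = x).
  { replace (z0 + RtoC x - z0)%C with (RtoC x) by ring. rewrite Cmod_R, Rabs_right; unfold x; lra. }
  assert (Z : f (z0 + RtoC x)%C = 0%C).
  { apply Hz; [unfold disk; rewrite Ex; unfold x; pose proof (Rmin_r d e); lra|].
    intros q. rewrite q, Cmod_self in Ex. unfold x in Ex. lra. }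
  specialize (K (z0 + RtoC x)%C). rewrite Ex, Z in K.
  replace (0 - f z0)%C with (- f z0)%C in K by ring. rewrite Cmod_opp in K. left. apply K.
  unfold x. pose proof (Rmin_l d e). lra.
Qed.

(** * The differential system and transport along paths *)

Lemma disk_open p r : copen (disk p r).
Proof.
  intros z Hz. exists (r - Cmod (z - p)). unfold disk in *. split; [lra|]. intros w Hw.
  pose proof (Cmod_tri3 w z p). lra.
Qed.

Lemma disk_convex p r : cconvex (disk p r).
Proof.
  intros a b t Ha Hb Ht. unfold disk in *.
  replace (a + RtoC t * (b - a) - p)%C with (RtoC (1 - t) * (a - p) + RtoC t * (b - p))%C by (rewrite RtoC_minus; ring).
  eapply Rle_lt_trans; [apply Cmod_triangle|]. rewrite !Cmod_mult, !Cmod_R, !Rabs_right by lra.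
  destruct (Req_dec t 0) as [->|n]; [|nra]. lra.
Qed.

Lemma inter_open U V : copen U -> copen V -> copen (fun z => U z /\ V z).
Proof.
  intros HU HV z [h1 h2]. destruct (HU z h1) as [r1 [p1 k1]], (HV z h2) as [r2 [p2 k2]].
  exists (Rmin r1 r2). split; [apply Rmin_pos; auto|]. intros w Hw.
  destruct (disk_Rmin _ _ _ _ Hw). auto.
Qed.

Lemma inter_convex U V : cconvex U -> cconvex V -> cconvex (fun z => U z /\ V z).
Proof. intros HU HV a b t [] [] Ht. split; auto. Qed.

Lemma disk_center p r : 0 < r -> disk p r p.
Proof. intros. unfold disk. rewrite Cmod_self. auto. Qed.

(** Once the factor [z^(1-c)] is removed, the system is a chain of primitives. It is used with
    [mu = 1/z] on convex domains of the plane, and with [mu = dlam] in the logarithmic coordinate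
    near 1. *)
Lemma iter_prim U f0 mu p (v : nat -> C) : copen U -> cconvex U -> holo U f0 -> holo U mu ->
  exists X : nat -> C -> C, (forall z, U z -> cderiv (X O) z (f0 z)) /\
    (forall j z, U z -> cderiv (X (S j)) z (mu z * X j z)%C) /\ forall j, X j p = v j.
Proof.
  intros HO HC H0 Hmu.
  assert (prim : forall f a, exists F, holo U f -> (forall z, U z -> cderiv F z (f z)) /\ F p = a).
  { intros f a. destruct (classic (holo U f)) as [h|n]; [|exists f; tauto].
    destruct (holo_primitive U f HO HC h) as [F HF]. exists (fun z => F z + (a - F p))%C. intros _. split; [|ring].
    intros z Hz. eapply cderiv_eq; [apply cderiv_plus; [apply HF; auto|apply cderiv_const]|ring]. }
  set (P := fun f a => proj1_sig (constructive_indefinite_description _ (prim f a))).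
  assert (HP : forall f a, holo U f -> (forall z, U z -> cderiv (P f a) z (f z)) /\ P f a p = a).
  { intros f a. unfold P. destruct constructive_indefinite_description. auto. }
  set (X := fix X j := match j with O => P f0 (v O) | S j' => P (fun z => mu z * X j' z)%C (v (S j')) end).
  assert (HX : forall j, holo U (X j) /\ holo U (fun z => mu z * X j z)%C).
  { assert (K : forall j, holo U (X j) -> holo U (fun z => mu z * X j z)%C).
    { intros j h z Hz. destruct (h z Hz) as [l Hl]. destruct (Hmu z Hz) as [l' Hl']. eexists. apply cderiv_mult; eauto. }
    induction j; (split; [|apply K]); intros z Hz; simpl; eexists; apply HP; auto; apply IHj. }
  exists X. split; [|split].
  - apply HP; auto.
  - intros j. apply HP, HX.
  - intros [|j]; apply HP; auto. apply HX.
Qed.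

Section System.
Variable c : C.

Definition bcoef (k : nat) (z : C) : C :=
  match k with O => (/ (1 - z))%C | S _ => (/ z)%C end.

(* For [u_k = Li_{k,c}], the relation [(z d/dz + c - 1) u_{k+1} = u_k]; the
   component of index 0 is the constant [alpha] standing for [alpha z / (1 - z)],
   which explains the special coefficient [bcoef 0]. *)
Definition sol (U : C -> Prop) (Y : nat -> C -> C) : Prop :=
  forall z, U z -> punctured z /\ cderiv (Y O) z 0%C /\
    forall k, cderiv (Y (S k)) z ((1 - c) / z * Y (S k) z + bcoef k z * Y k z)%C.

Lemma sol_mono (U V : C -> Prop) Y : (forall z, V z -> U z) -> sol U Y -> sol V Y.
Proof. intros H HY z Hz. apply HY; auto. Qed.

Lemma one_minus_neq0 (z : C) : z <> 1%C -> (1 - z)%C <> 0%C.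
Proof. intros H E. apply H. symmetry. apply Ceq_minus. auto. Qed.

Lemma holo_bcoef k z : punctured z -> exists l, cderiv (bcoef k) z l.
Proof.
  intros [h0 h1]. destruct k; simpl; eexists.
  - apply (cderiv_inv (fun z => 1 - z)%C); [apply one_minus_neq0; auto|].
    apply cderiv_minus; [apply cderiv_const|apply cderiv_id].
  - apply (cderiv_inv (fun z => z)); [auto|apply cderiv_id].
Qed.

Lemma local_log U : copen U -> cconvex U -> (forall z, U z -> punctured z) ->
  exists L, forall z, U z -> cderiv L z (/ z)%C.
Proof.
  intros HO HC HP. apply holo_primitive; auto. intros z Hz.
  apply (holo_bcoef 1 z). auto.
Qed.

Lemma cderiv_exp_scal L a z l : cderiv L z l ->
  cderiv (fun w => Cexp (a * L w))%C z (a * l * Cexp (a * L z))%C.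
Proof.
  intros H. eapply cderiv_eq; [apply (cderiv_comp (fun w => a * L w)%C Cexp _ _ _ (cderiv_scal _ _ _ a H) (cderiv_Cexp _))|ring].
Qed.

Lemma sol_lin U Y Z a b : sol U Y -> sol U Z -> sol U (fun k z => (a * Y k z + b * Z k z)%C).
Proof.
  intros HY HZ z Hz. destruct (HY z Hz) as [hp [y0 yk]], (HZ z Hz) as [_ [z0 zk]].
  split; [auto|]. split.
  - eapply cderiv_eq; [apply cderiv_plus; apply cderiv_scal; eauto|ring].
  - intros k. eapply cderiv_eq; [apply cderiv_plus; apply cderiv_scal; [apply yk|apply zk]|ring].
Qed.

Lemma sol_zero U Y p : copen U -> cconvex U -> sol U Y -> U p -> (forall k, Y k p = 0%C) ->
  forall k z, U z -> Y k z = 0%C.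
Proof.
  intros HO HC HY Hp H0.
  destruct (local_log U HO HC) as [L HL]; [intros z Hz; apply HY; auto|].
  induction k; intros z Hz.
  - rewrite <- (H0 O). apply (deriv0_const U); auto. intros w Hw. apply HY; auto.
  (* Integrating factor [z^(c-1)] for a local branch of the logarithm: the previous component being
     zero, the product has derivative zero. *)
  - set (e := fun w => Cexp ((c - 1) * L w)).
    assert (E : (e z * Y (S k) z)%C = (e p * Y (S k) p)%C).
    { apply (deriv0_const U (fun w => e w * Y (S k) w)%C); auto. intros w Hw.
      destruct (HY w Hw) as [[n0 _] [_ hk]]. eapply cderiv_eq.
      - apply cderiv_mult; [apply (cderiv_exp_scal L (c - 1) w _ (HL w Hw))|apply hk].
      - rewrite (IHk w Hw). unfold e. field. auto. }
    rewrite H0, Cmult_0_r in E.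
    apply (f_equal (fun x => / e z * x)%C) in E. rewrite Cmult_assoc, Cinv_l, Cmult_1_l in E by apply Cexp_neq0.
    rewrite E. ring.
Qed.

Lemma sol_unique U Y Z p : copen U -> cconvex U -> sol U Y -> sol U Z -> U p ->
  (forall k, Y k p = Z k p) -> forall k z, U z -> Y k z = Z k z.
Proof.
  intros HO HC HY HZ Hp H k z Hz.
  pose proof (sol_zero U _ p HO HC (sol_lin U Y Z 1 (-(1)) HY HZ) Hp) as K.
  assert (E : (1 * Y k z + - (1) * Z k z)%C = 0%C).
  { apply K; auto. intros j. rewrite H. ring. }
  apply Ceq_minus. rewrite <- E. ring.
Qed.

Lemma sol_exists U p v : copen U -> cconvex U -> (forall z, U z -> punctured z) ->
  exists Y, sol U Y /\ forall k, Y k p = v k.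
Proof.
  intros HO HC HP. destruct (local_log U HO HC HP) as [L HL].
  assert (EE : forall z, (Cexp ((1 - c) * L z) * Cexp ((c - 1) * L z))%C = 1%C).
  { intros z. rewrite <- Cexp_plus. replace ((1 - c) * L z + (c - 1) * L z)%C with (RtoC 0) by ring. apply Cexp_0. }
  (* Variation of constants: with [Y (S j) = z^(1-c) X j] the equations become [X (S j)' = X j / z],
     and [X 0' = z^(c-1) v 0 / (1 - z)]. The index is shifted because component 0 of [Y] is the
     constant [v 0]. *)
  destruct (iter_prim U (fun z => Cexp ((c - 1) * L z) * (bcoef 0 z * v O))%C Cinv p (fun j => Cexp ((c - 1) * L p) * v (S j))%C HO HC) as [X [X0 [XS Xp]]].
  { intros z Hz. destruct (holo_bcoef 0 z (HP z Hz)) as [l Hl]. eexists.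
    apply cderiv_mult; [apply cderiv_exp_scal, HL; auto|]. apply cderiv_mult; [exact Hl|apply cderiv_const]. }
  { intros z Hz. apply (holo_bcoef 1); auto. }
  exists (fun k => match k with O => fun _ => v O | S j => fun z => (Cexp ((1 - c) * L z) * X j z)%C end). split.
  - intros z Hz. split; [auto|]. split; [apply cderiv_const|]. intros [|k].
    + eapply cderiv_eq; [apply cderiv_mult; [apply cderiv_exp_scal, HL|apply X0]; auto|].
      transitivity ((1 - c) / z * (Cexp ((1 - c) * L z) * X O z) + (Cexp ((1 - c) * L z) * Cexp ((c - 1) * L z)) * (bcoef 0 z * v O))%C.
      { cbv beta. field. apply HP; auto. }
      rewrite EE. ring.
    + eapply cderiv_eq; [apply cderiv_mult; [apply cderiv_exp_scal, HL|apply XS]; auto|].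
      simpl bcoef. cbv beta. field. apply HP; auto.
  - intros [|k]; auto. rewrite Xp.
    transitivity ((Cexp ((1 - c) * L p) * Cexp ((c - 1) * L p)) * v (S k))%C; [ring|]. rewrite EE. ring.
Qed.

(** * Transport of values, lifts along paths and homotopy invariance *)

Definition rad (p : C) : R := Rmin (Cmod p) (Cmod (p - 1)).

Lemma rad_pos p : punctured p -> 0 < rad p.
Proof.
  intros [h0 h1]. apply Rmin_pos; apply Cmod_gt_0; auto. intros e. apply h1, Ceq_minus, e.
Qed.

(** The distance to the points 0 and 1 is 1-Lipschitz; this makes the disks around neighbouring
    points comparable in [uniform_grid]. *)
Lemma rad_lip p q : rad p - Cmod (p - q) <= rad q.
Proof.
  unfold rad. apply Rmin_glb.
  - pose proof (Rmin_l (Cmod p) (Cmod (p - 1))). pose proof (Cmod_rev_tri p q). lra.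
  - pose proof (Rmin_r (Cmod p) (Cmod (p - 1))). pose proof (Cmod_tri3 p q 1). lra.
Qed.

Lemma rad_disk p z : disk p (rad p) z -> punctured z.
Proof.
  unfold disk, rad. intros H. split; intros ->.
  - pose proof (Rmin_l (Cmod p) (Cmod (p - 1))). rewrite Cmod_sym in H.
    replace (p - 0)%C with p in H by ring. lra.
  - pose proof (Rmin_r (Cmod p) (Cmod (p - 1))). rewrite Cmod_sym in H. lra.
Qed.

(** The condition on [p] stands under the quantifier so that [Esol], and with it [transp], are total
    functions of points. *)
Lemma transport_ex p v : exists Y, punctured p -> sol (disk p (rad p)) Y /\ forall k, Y k p = v k.
Proof.
  destruct (classic (punctured p)) as [h|n]; [|exists (fun _ _ => 0%C); tauto].
  destruct (sol_exists (disk p (rad p)) p v) as [Y HY]; eauto using disk_open, disk_convex, rad_disk.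
Qed.

Definition Esol p v := proj1_sig (constructive_indefinite_description _ (transport_ex p v)).
Definition transp (p q : C) (v : nat -> C) : nat -> C := fun k => Esol p v k q.

Lemma Esol_spec p v : punctured p -> sol (disk p (rad p)) (Esol p v) /\ forall k, Esol p v k p = v k.
Proof. unfold Esol. destruct constructive_indefinite_description. auto. Qed.

Lemma transp_id p v : punctured p -> transp p p v = v.
Proof. intros H. apply functional_extensionality. intros k. apply Esol_spec; auto. Qed.

(** Flatness: transport around a small triangle is trivial. Homotopy invariance reduces to this. *)
Lemma transp_comp p q z v : punctured p -> Cmod (q - p) < rad p -> Cmod (z - p) < rad p -> Cmod (z - q) < rad q ->
  transp q z (transp p q v) = transp p z v.
Proof.
  intros Hp h1 h2 h3. apply functional_extensionality. intros k.
  assert (Hq : punctured q) by (apply (rad_disk p); auto).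
  destruct (Esol_spec p v Hp) as [S1 I1]. destruct (Esol_spec q (transp p q v) Hq) as [S2 I2].
  change (Esol q (transp p q v) k z = Esol p v k z).
  apply (sol_unique (fun z => disk p (rad p) z /\ disk q (rad q) z) _ _ q).
  - apply inter_open; apply disk_open.
  - apply inter_convex; apply disk_convex.
  - eapply sol_mono; [|apply S2]. tauto.
  - eapply sol_mono; [|apply S1]. tauto.
  - split; auto. apply disk_center, rad_pos; auto.
  - apply I2.
  - split; auto.
Qed.

(** A horizontal section over the path [g] for the flat connection given by the system: values that
    are locally the values of one solution. Working with values rather than germs makes
    concatenation and restriction easy. *)
Definition hor (g : R -> C) (a b : R) (v : R -> nat -> C) : Prop :=
  forall t, a <= t <= b -> exists e Y d, 0 < e /\ 0 < d /\ sol (disk (g t) e) Y /\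
    forall s, a <= s <= b -> Rabs (s - t) < d -> disk (g t) e (g s) /\ forall k, v s k = Y k (g s).

Definition lift (g : R -> C) (a b : R) (x y : nat -> C) : Prop :=
  exists v, hor g a b v /\ v a = x /\ v b = y.

Definition pathc (g : R -> C) (a b : R) : Prop :=
  forall t, a <= t <= b -> forall e, 0 < e -> exists d, 0 < d /\
    forall s, a <= s <= b -> Rabs (s - t) < d -> Cmod (g s - g t) < e.

Lemma pathc_sub g a b a' b' : a <= a' -> b' <= b -> pathc g a b -> pathc g a' b'.
Proof.
  intros h1 h2 H t Ht e He. destruct (H t ltac:(lra) e He) as [d [Hd K]]. exists d. split; auto.
  intros s Hs. apply K. lra.
Qed.

Lemma lift_sol g a b U Y : a <= b -> pathc g a b -> sol U Y -> copen U -> (forall t, a <= t <= b -> U (g t)) ->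
  lift g a b (fun k => Y k (g a)) (fun k => Y k (g b)).
Proof.
  intros Hab Hg HY HO HU. exists (fun t k => Y k (g t)). split; [|auto]. intros t Ht.
  destruct (HO _ (HU t Ht)) as [e [He K]]. destruct (Hg t Ht e He) as [d [Hd K']].
  exists e, Y, d. split; [auto|]. split; [auto|]. split.
  - intros z Hz. apply HY. apply K, Hz.
  - intros s Hs Hsd. split; [apply K'; auto|auto].
Qed.

Lemma disk_sol_agree p e e' Y Y' : sol (disk p e) Y -> sol (disk p e') Y' -> 0 < e -> 0 < e' ->
  (forall k, Y k p = Y' k p) -> forall z, disk p e z -> disk p e' z -> forall k, Y k z = Y' k z.
Proof.
  intros HY HY' He He' HE z Hz Hz' k.
  apply (sol_unique (fun z => disk p e z /\ disk p e' z) _ _ p); auto.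
  - apply inter_open; apply disk_open.
  - apply inter_convex; apply disk_convex.
  - eapply sol_mono; [|apply HY]. tauto.
  - eapply sol_mono; [|apply HY']. tauto.
  - split; apply disk_center; auto.
Qed.

Lemma lift_concat g a b c' x y z : a <= b <= c' -> pathc g a c' -> lift g a b x y -> lift g b c' y z -> lift g a c' x z.
Proof.
  intros Hab Hg [v [Hv [v1 v2]]] [w [Hw [w1 w2]]].
  exists (fun t => if Rle_dec t b then v t else w t). split; [|split].
  2:{ destruct Rle_dec; [auto|lra]. }
  2:{ destruct Rle_dec; [|auto]. assert (c' = b) by lra. subst c'. congruence. }
  intros t Ht. destruct (Rtotal_order t b) as [h|[h|h]].
  - destruct (Hv t ltac:(lra)) as [e [Y [d [He [Hd [HY K]]]]]].
    exists e, Y, (Rmin d (b - t)). split; [auto|]. split; [apply Rmin_pos; lra|]. split; [auto|].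
    intros s Hs Hsd. pose proof (Rmin_l d (b - t)). pose proof (Rmin_r d (b - t)).
    assert (Hb : Rabs (s - t) < b - t) by lra. apply Rabs_lt_between in Hb.
    destruct Rle_dec; [|lra]. apply K; lra.
  (* At the junction the two local solutions take the same values at [g b], hence agree on the
     smaller disk, and the left one serves on both sides. *)
  - subst t. destruct (Hv b ltac:(lra)) as [e [Y [d [He [Hd [HY K]]]]]].
    destruct (Hw b ltac:(lra)) as [e' [Y' [d' [He' [Hd' [HY' K']]]]]].
    destruct (Hg b ltac:(lra) e He) as [d0 [Hd0 K0]].
    assert (Z0 : Rabs (b - b) < d) by (rewrite Rminus_diag, Rabs_R0; auto).
    assert (Z0' : Rabs (b - b) < d') by (rewrite Rminus_diag, Rabs_R0; auto).
    assert (EY : forall k, Y k (g b) = Y' k (g b)).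
    { intros k. rewrite <- (proj2 (K b ltac:(lra) Z0)), <- (proj2 (K' b ltac:(lra) Z0')). congruence. }
    exists e, Y, (Rmin d0 (Rmin d d')). split; [auto|]. split; [repeat apply Rmin_pos; auto|]. split; [auto|].
    intros s Hs Hsd. pose proof (Rmin_l d0 (Rmin d d')). pose proof (Rmin_r d0 (Rmin d d')).
    pose proof (Rmin_l d d'). pose proof (Rmin_r d d').
    assert (D0 : disk (g b) e (g s)) by (apply K0; lra). split; [auto|]. intros k.
    destruct Rle_dec; [apply K; lra|]. destruct (K' s ltac:(lra) ltac:(lra)) as [D1 ->].
    symmetry. apply (disk_sol_agree (g b) e e'); auto.
  - destruct (Hw t ltac:(lra)) as [e [Y [d [He [Hd [HY K]]]]]].
    exists e, Y, (Rmin d (t - b)). split; [auto|]. split; [apply Rmin_pos; lra|]. split; [auto|].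
    intros s Hs Hsd. pose proof (Rmin_l d (t - b)). pose proof (Rmin_r d (t - b)).
    assert (Hb : Rabs (s - t) < t - b) by lra. apply Rabs_lt_between in Hb.
    destruct Rle_dec; [lra|]. apply K; lra.
Qed.

(** Connectedness of an interval, for a locally constant property. In [hor_unique] the property is
    that the section at [t] has the values of the given solution. *)
Lemma real_connected (P : R -> Prop) a b : a <= b -> P a ->
  (forall t, a <= t <= b -> exists d, 0 < d /\ forall s, a <= s <= b -> Rabs (s - t) < d -> (P s <-> P t)) -> P b.
Proof.
  intros Hab Ha Hloc.
  destruct (completeness (fun x => a <= x <= b /\ forall s, a <= s <= x -> P s)) as [l [L1 L2]].
  { exists b. intros x [h _]. lra. }
  { exists a. split; [lra|]. intros s Hs. replace s with a by lra. auto. }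
  assert (Hl : a <= l <= b).
  { split; [apply L1; split; [lra|intros s Hs; replace s with a by lra; auto]|]. apply L2. intros x [h _]. lra. }
  destruct (Hloc l Hl) as [d [Hd K]].
  assert (Hx : exists x, (a <= x <= b /\ forall s, a <= s <= x -> P s) /\ l - d < x).
  { apply NNPP. intros n. assert (l <= l - d); [|lra]. apply L2. intros x hx. apply Rnot_lt_le. intros hl. apply n. eauto. }
  destruct Hx as [x [[hx1 hx2] hx3]]. assert (x <= l) by (apply L1; auto).
  assert (Pl : P l). { apply (K x); [lra| |apply hx2; lra]. apply Rabs_lt_between. lra. }
  set (y := Rmin b (l + d / 2)).
  assert (y <= b) by apply Rmin_l. assert (y <= l + d / 2) by apply Rmin_r.
  assert (l <= y). { apply Rmin_glb; lra. }
  assert (Py : forall s, a <= s <= y -> P s).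
  { intros s Hs. destruct (Rle_dec s x) as [q|q]; [apply hx2; lra|].
    apply K; auto; [lra|]. apply Rabs_lt_between. lra. }
  assert (y <= l) by (apply L1; split; auto; lra).
  destruct (Rle_lt_dec b (l + d / 2)) as [q|q].
  - unfold y in *. rewrite Rmin_left in * by auto. apply Py. lra.
  - unfold y in *. rewrite Rmin_right in * by lra. lra.
Qed.

Lemma hor_unique g a b v U Y : a <= b -> hor g a b v -> copen U -> cconvex U -> sol U Y ->
  (forall t, a <= t <= b -> U (g t)) -> (forall k, v a k = Y k (g a)) -> forall k, v b k = Y k (g b).
Proof.
  intros Hab Hv HO HC HY HU Ha.
  apply (real_connected (fun t => forall k, v t k = Y k (g t)) a b Hab Ha).
  intros t Ht. destruct (Hv t Ht) as [e [Z [d [He [Hd [HZ K]]]]]].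
  exists d. split; auto. intros s Hs Hsd. destruct (K s Hs Hsd) as [D Ks].
  destruct (K t Ht) as [_ Kt]. { rewrite Rminus_diag, Rabs_R0; auto. }
  assert (un : forall p q, disk (g t) e p /\ U p -> disk (g t) e q /\ U q ->
    (forall k, Z k p = Y k p) -> (forall k, Z k q = Y k q)).
  { intros p q hp hq E k. apply (sol_unique (fun z => disk (g t) e z /\ U z) _ _ p); auto.
    - apply inter_open; auto. apply disk_open.
    - apply inter_convex; auto. apply disk_convex.
    - eapply sol_mono; [|apply HZ]. tauto.
    - eapply sol_mono; [|apply HY]. tauto. }
  pose proof (disk_center (g t) e He).
  split; intros E k.
  - rewrite Kt. apply (un (g s) (g t)); auto. intros j. rewrite <- Ks. auto.
  - rewrite Ks. apply (un (g t) (g s)); auto. intros j. rewrite <- Kt. auto.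
Qed.

Definition Hcont (H : R -> R -> C) : Prop := forall s t, I01 s -> I01 t -> forall e, 0 < e ->
  exists d, 0 < d /\ forall s' t', I01 s' -> I01 t' -> Rabs (s' - s) < d -> Rabs (t' - t) < d -> Cmod (H s' t' - H s t) < e.

(** A Lebesgue number for the square: with this mesh, each point sees its grid neighbours inside its
    own disk of transport. *)
Lemma uniform_grid H : Hcont H -> (forall s t, I01 s -> I01 t -> punctured (H s t)) ->
  exists N : nat, (0 < N)%nat /\ forall s t s' t', I01 s -> I01 t -> I01 s' -> I01 t' ->
    Rabs (s' - s) <= / INR N -> Rabs (t' - t) <= / INR N -> Cmod (H s' t' - H s t) < rad (H s t).
Proof.
  intros Hc HP.
  assert (loc : forall u v, exists d, 0 < d /\ (I01 u -> I01 v -> forall s t s' t', I01 s -> I01 t -> I01 s' -> I01 t' ->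
     Rabs (s - u) < d -> Rabs (t - v) < d -> Rabs (s' - u) < d -> Rabs (t' - v) < d -> Cmod (H s' t' - H s t) < rad (H s t))).
  { intros u v. destruct (classic (I01 u /\ I01 v)) as [[hu hv]|n]; [|exists 1; split; [lra|tauto]].
    pose proof (rad_pos _ (HP u v hu hv)) as Hr.
    (* Two images within a quarter of the radius of the centre are less than half of it apart, while
       the radius at either of them is still at least three quarters. *)
    destruct (Hc u v hu hv (rad (H u v) / 4) ltac:(lra)) as [d [Hd K]]. exists d. split; auto.
    intros _ _ s t s' t' hs ht hs' ht' a1 a2 a3 a4.
    pose proof (K s t hs ht a1 a2). pose proof (K s' t' hs' ht' a3 a4).
    pose proof (Cmod_tri3 (H s' t') (H u v) (H s t)). pose proof (rad_lip (H u v) (H s t)).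
    rewrite (Cmod_sym (H u v) (H s t)) in *. lra. }
  set (dl := fun u v => proj1_sig (constructive_indefinite_description _ (loc u v))).
  assert (Hdl : forall u v, 0 < dl u v / 2).
  { intros. unfold dl. destruct constructive_indefinite_description as [d [Hd ?]]. simpl. lra. }
  destruct (compactness_value_2d 0 1 0 1 (fun u v => mkposreal _ (Hdl u v))) as [d0 Hd0].
  destruct (INR_unbounded (/ d0)) as [n Hn].
  pose proof (cond_pos d0) as Hp. pose proof (Rinv_0_lt_compat _ Hp) as Hq.
  assert (HN : (0 < n)%nat). { apply INR_lt. simpl. lra. }
  assert (Hi : / INR n < d0). { rewrite <- (Rinv_inv d0). apply Rinv_lt_contravar; auto. apply Rmult_lt_0_compat; lra. }
  exists n. split; auto. intros s t s' t' hs ht hs' ht' h1 h2.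
  specialize (Hd0 s t hs ht). apply NNPP. intros nn. apply Hd0. intros [u [v [hu [hv [k1 [k2 k3]]]]]]. apply nn. clear nn Hd0.
  simpl in *. unfold dl in *. destruct constructive_indefinite_description as [d [Hd K]]. simpl in *.
  pose proof (Rabs_triang (s' - s) (s - u)). pose proof (Rabs_triang (t' - t) (t - v)).
  replace (s' - s + (s - u)) with (s' - u) in * by ring. replace (t' - t + (t - v)) with (t' - v) in * by ring.
  apply K; auto; lra.
Qed.

Lemma homotopy_lift H x y : Hcont H -> (forall s t, I01 s -> I01 t -> punctured (H s t)) ->
  (forall s, I01 s -> H s 0 = m1 /\ H s 1 = m1) -> lift (H 1) 0 1 x y -> lift (H 0) 0 1 x y.
Proof.
  intros Hc HP Hends [w [Hw [w0 w1]]].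
  assert (HendL : forall s, I01 s -> H s 0 = m1) by (intros; apply Hends; auto).
  assert (HendR : forall s, I01 s -> H s 1 = m1) by (intros; apply Hends; auto).
  destruct (uniform_grid H Hc HP) as [N [HN Hg]].
  assert (HN0 : 0 < INR N) by (apply lt_0_INR; auto).
  set (q := fun i : nat => INR i / INR N).
  assert (Hq : forall i, (i <= N)%nat -> I01 (q i)).
  { intros i Hi. unfold q, I01. apply le_INR in Hi. pose proof (pos_INR i). split.
    - apply Rmult_le_pos; auto. left. apply Rinv_0_lt_compat; auto.
    - apply Rmult_le_reg_r with (INR N); auto. unfold Rdiv. rewrite Rmult_assoc, Rinv_l by lra. lra. }
  assert (Hqs : forall i, q (S i) - q i = / INR N). { intros. unfold q. rewrite S_INR. field. lra. }
  assert (Hinv : 0 < / INR N) by (apply Rinv_0_lt_compat; auto).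
  assert (st : forall i, Rabs (q (S i) - q i) <= / INR N). { intros. rewrite Hqs, Rabs_right; lra. }
  assert (st' : forall i, Rabs (q i - q (S i)) <= / INR N). { intros. rewrite Rabs_minus_sym. auto. }
  assert (z0 : forall i, Rabs (q i - q i) <= / INR N). { intros. rewrite Rminus_diag, Rabs_R0. lra. }
  assert (q0 : q O = 0) by (unfold q; simpl; field; lra). assert (qN : q N = 1) by (unfold q; field; lra).
  (* The result of carrying [x] along row [i] of the grid up to column [j]. *)
  set (V := fun i => fix V j := match j with O => x | S j' => transp (H (q i) (q j')) (H (q i) (q (S j'))) (V j') end).
  (* Both ways around a grid square equal the transport along its diagonal, by [transp_comp] on the
     two triangles. *)
  assert (adj : forall i, (S i <= N)%nat -> forall j, (j <= N)%nat -> V (S i) j = transp (H (q i) (q j)) (H (q (S i)) (q j)) (V i j)).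
  { intros i Hi. assert (I1 : I01 (q i)) by (apply Hq; lia). assert (I2 : I01 (q (S i))) by (apply Hq; lia).
    induction j; intros Hj.
    - simpl V. rewrite q0, !HendL by auto. rewrite transp_id; auto.
      rewrite <- (proj1 (Hends _ I1)). apply HP; auto. unfold I01; lra.
    - assert (J1 : I01 (q j)) by (apply Hq; lia). assert (J2 : I01 (q (S j))) by (apply Hq; lia).
      change (V (S i) (S j)) with (transp (H (q (S i)) (q j)) (H (q (S i)) (q (S j))) (V (S i) j)).
      change (V i (S j)) with (transp (H (q i) (q j)) (H (q i) (q (S j))) (V i j)).
      rewrite IHj by lia. rewrite !transp_comp; auto; apply Hg; auto. }
  (* On the right edge the homotopy stays at [m1], so the vertical transport is the identity
     there. *)
  assert (cst : forall i, (i <= N)%nat -> V i N = V O N).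
  { induction i; intros Hi; auto. rewrite adj, qN, !HendR by (auto; apply Hq; lia).
    rewrite transp_id; [apply IHi; lia|].
    assert (I1 : I01 (q i)) by (apply Hq; lia). rewrite <- (proj1 (Hends _ I1)). apply HP; auto. unfold I01; lra. }
  assert (path1 : pathc (H 1) 0 1 /\ pathc (H 0) 0 1).
  { assert (A0 : I01 0) by (unfold I01; lra). assert (A1 : I01 1) by (unfold I01; lra).
    split; intros t Ht e He; [destruct (Hc 1 t A1 Ht e He) as [d [Hd K]]|destruct (Hc 0 t A0 Ht e He) as [d [Hd K]]];
    exists d; (split; [auto|]); intros s Hs Hsd; apply K; auto; rewrite Rminus_diag, Rabs_R0; auto. }
  assert (step : forall i j t, (i <= N)%nat -> (S j <= N)%nat -> q j <= t <= q (S j) -> 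
     disk (H (q i) (q j)) (rad (H (q i) (q j))) (H (q i) t)).
  { intros i j t Hi Hj Ht. assert (J1 : I01 (q j)) by (apply Hq; lia). assert (J2 : I01 (q (S j))) by (apply Hq; lia).
    apply Hg; auto. { unfold I01 in *. lra. } specialize (Hqs j). rewrite Rabs_right; lra. }
  (* Row [N] is the path [H 1]. Cell by cell, uniqueness of horizontal sections identifies the given
     lift with the discrete transport. *)
  assert (fin : y = V O N).
  { rewrite <- (cst N) by auto. rewrite <- w1, <- qN.
    enough (G : forall j, (j <= N)%nat -> w (q j) = V N j) by (apply G; auto).
    induction j; intros Hj; [rewrite q0; auto|].
    assert (J1 : I01 (q j)) by (apply Hq; lia). assert (J2 : I01 (q (S j))) by (apply Hq; lia).
    assert (P1 : punctured (H 1 (q j))) by (apply HP; auto; unfold I01; lra).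
    apply functional_extensionality. intros k. simpl V. rewrite qN. unfold transp.
    destruct (Esol_spec (H 1 (q j)) (V N j) P1) as [S1 S2].
    apply (hor_unique (H 1) (q j) (q (S j)) w (disk (H 1 (q j)) (rad (H 1 (q j))))); auto using disk_open, disk_convex.
    - specialize (Hqs j). lra.
    - intros t Ht. destruct (Hw t) as [e [Y [d [h1 [h2 [h3 h4]]]]]]; [unfold I01 in *; lra|].
      exists e, Y, d. split; [auto|]. split; [auto|]. split; [auto|]. intros s Hs. apply h4. unfold I01 in *. lra.
    - intros t Ht. rewrite <- qN. apply step; auto.
    - intros k'. rewrite S2, IHj by lia. auto. }
  (* Conversely, the discrete transport along row 0 is turned into a lift by concatenation, by
     induction on the initial part of the row. *)
  rewrite fin. rewrite <- qN. generalize (le_n N). generalize N at 1 3 4 as j. 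
  induction j; intros Hj.
  - rewrite q0. exists (fun _ => x). split; [|auto]. intros t Ht. assert (t = 0) by lra. subst t.
    assert (P1 : punctured (H 0 0)) by (apply HP; unfold I01; lra).
    destruct (Esol_spec (H 0 0) x P1) as [S1 S2].
    exists (rad (H 0 0)), (Esol (H 0 0) x), 1. split; [apply rad_pos; auto|]. split; [lra|]. split; [auto|].
    intros s Hs _. replace s with 0 by lra. split; [apply disk_center, rad_pos; auto|]. intros k. rewrite S2. auto.
  - assert (J1 : I01 (q j)) by (apply Hq; lia). assert (J2 : I01 (q (S j))) by (apply Hq; lia).
    specialize (Hqs j). unfold I01 in J1, J2.
    apply lift_concat with (q j) (V O j); [lra| |apply IHj; lia|].
    + apply (pathc_sub _ 0 1); tauto || lra.
    + assert (P1 : punctured (H 0 (q j))) by (apply HP; unfold I01; lra).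
      destruct (Esol_spec (H 0 (q j)) (V O j) P1) as [S1 S2].
      replace (V O j) with (fun k => Esol (H 0 (q j)) (V O j) k (H 0 (q j))) by (apply functional_extensionality; auto).
      simpl V. rewrite q0. apply (lift_sol _ _ _ (disk (H 0 (q j)) (rad (H 0 (q j))))); auto using disk_open.
      * lra.
      * apply (pathc_sub _ 0 1); tauto || lra.
      * intros t Ht. rewrite <- q0. apply step; auto. lia.
Qed.

(** Only component [k] is continued, yet agreement near [g s] of the functions attached to [s] and
    [t] comes from the equality of all components at the single point [g s], through uniqueness for
    the system. *)
Lemma continues_of_lift g x y k Y0 Y1 r : 0 < r -> lift g 0 1 x y ->
  sol (disk (g 0) r) Y0 -> sol (disk (g 1) r) Y1 ->
  (forall k, x k = Y0 k (g 0)) -> (forall k, y k = Y1 k (g 1)) -> continues_along (Y0 k) g (Y1 k).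
Proof.
  intros Hr [v [Hv [v0 v1]]] H0 H1 E0 E1.
  assert (ch : forall t, exists p : R * (nat -> C -> C), I01 t -> 0 < fst p /\ sol (disk (g t) (fst p)) (snd p) /\
     exists d, 0 < d /\ forall s, I01 s -> Rabs (s - t) < d -> disk (g t) (fst p) (g s) /\ forall k, v s k = snd p k (g s)).
  { intros t. destruct (classic (I01 t)) as [h|n]; [|exists (1, fun _ _ => RtoC 0); tauto].
    destruct (Hv t h) as [e [Y [d [h1 [h2 [h3 h4]]]]]]. exists (e, Y). intros _. simpl. split; [auto|]. split; [auto|].
    exists d. auto. }
  set (p := fun t => proj1_sig (constructive_indefinite_description _ (ch t))).
  assert (Hp : forall t, I01 t -> 0 < fst (p t) /\ sol (disk (g t) (fst (p t))) (snd (p t)) /\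
     exists d, 0 < d /\ forall s, I01 s -> Rabs (s - t) < d -> disk (g t) (fst (p t)) (g s) /\ forall k, v s k = snd (p t) k (g s)).
  { intros t. unfold p. destruct constructive_indefinite_description. auto. }
  assert (self : forall t, I01 t -> forall k, v t k = snd (p t) k (g t)).
  { intros t ht. destruct (Hp t ht) as [_ [_ [d [Hd K]]]]. apply K; auto. rewrite Rminus_diag, Rabs_R0; auto. }
  assert (A0 : I01 0) by (unfold I01; lra). assert (A1 : I01 1) by (unfold I01; lra).
  assert (endpt : forall t Y, I01 t -> sol (disk (g t) r) Y -> (forall k, v t k = Y k (g t)) ->
     exists e, 0 < e /\ forall z, disk (g t) e z -> snd (p t) k z = Y k z).
  { intros t Y ht HY HE. destruct (Hp t ht) as [He [HS _]]. exists (Rmin (fst (p t)) r). split; [apply Rmin_pos; auto|].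
    intros z Hz. destruct (disk_Rmin _ _ _ _ Hz). apply (disk_sol_agree (g t) (fst (p t)) r); auto.
    intros j. rewrite <- self, <- HE; auto. }
  exists (fun t => snd (p t) k), (fun t => fst (p t)). split; [|split; [|split]].
  - intros t ht. destruct (Hp t ht) as [He [HS _]]. split; auto. apply holo_on_iff. intros z Hz.
    destruct (HS z Hz) as [_ [h0 hk]]. destruct k; eauto.
  - intros t ht. destruct (Hp t ht) as [He [HS [d [Hd K]]]]. exists d. split; auto. intros s hs hsd.
    destruct (K s hs hsd) as [D Es]. split; auto.
    destruct (Hp s hs) as [He' [HS' _]].
    set (e := Rmin (fst (p s)) (fst (p t) - Cmod (g s - g t))).
    assert (Hpos : 0 < e). { unfold disk in D. apply Rmin_pos; lra. }
    exists e. split; auto. intros z Hz.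
    assert (L1 : e <= fst (p s)) by apply Rmin_l. assert (L2 : e <= fst (p t) - Cmod (g s - g t)) by apply Rmin_r.
    apply (disk_sol_agree (g s) e e); auto.
    + eapply sol_mono; [|exact HS']. intros u Hu. unfold disk in *. lra.
    + eapply sol_mono; [|exact HS]. intros u Hu. unfold disk in *. pose proof (Cmod_tri3 u (g s) (g t)). lra.
    + intros j. rewrite <- self, <- Es; auto.
  - apply endpt; auto. intros j. rewrite v0. auto.
  - apply endpt; auto. intros j. rewrite v1. auto.
Qed.

End System.

(** * The polylogarithm series *)

Definition slit (z : C) : Prop := 0 < Re z \/ Im z <> 0.

Lemma slit_neq0 z : slit z -> z <> 0%C.
Proof. intros H ->. destruct H as [H|H]; simpl in H; lra. Qed.

Lemma slit_Clog z : slit z -> - PI < Im (Clog z) < PI.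
Proof.
  intros H. pose proof (slit_neq0 z H) as n. destruct (Im_Clog_sign z n) as [h1 [h2 h3]].
  destruct H as [H|H]; [auto|]. pose proof PI_RGT_0.
  destruct (Rtotal_order (Im z) 0) as [q|[q|q]]; [specialize (h2 q)|tauto|specialize (h1 q)]; lra.
Qed.

Lemma slit_open : copen slit.
Proof.
  intros z [H|H].
  - exists (Re z). split; auto. intros w Hw. left.
    pose proof (re_le_Cmod (w - z)) as K. change (Re (w - z)) with (Re w - Re z) in K. apply Rabs_le_between in K. lra.
  - exists (Rabs (Im z)). split; [apply Rabs_pos_lt; auto|]. intros w Hw. right. intros E.
    pose proof (im_le_Cmod (w - z)) as K. change (Im (w - z)) with (Im w - Im z) in K. rewrite E in K.
    rewrite Rminus_0_l, Rabs_Ropp in K. lra.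
Qed.

(** Continuity of the principal argument is not proved directly. A local primitive of [1/z] with the
    right value at [z] is a logarithm by differentiation of [w * exp (- L w)], and near [z] it must
    be the principal one by [Cexp_inj]. *)
Lemma cderiv_Clog z : slit z -> cderiv Clog z (/ z)%C.
Proof.
  intros Hs. pose proof (slit_neq0 z Hs) as Hz. pose proof (slit_Clog z Hs) as HI.
  pose proof (proj1 (Cmod_gt_0 z) Hz) as Hp.
  assert (D0 : forall w, disk z (Cmod z) w -> w <> 0%C).
  { intros w Hw ->. unfold disk in Hw. rewrite Cmod_sym in Hw. replace (z - 0)%C with z in Hw by ring. lra. }
  destruct (holo_primitive (disk z (Cmod z)) Cinv) as [L0 HL0].
  { apply disk_open. } { apply disk_convex. }
  { intros w Hw. eexists. apply (cderiv_inv (fun w => w)); [apply D0; auto|apply cderiv_id]. }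
  set (L := fun w => (L0 w + (Clog z - L0 z))%C).
  assert (HL : forall w, disk z (Cmod z) w -> cderiv L w (/ w)%C).
  { intros w Hw. eapply cderiv_eq; [apply cderiv_plus; [apply HL0; auto|apply cderiv_const]|ring]. }
  assert (Lz : L z = Clog z) by (unfold L; ring).
  assert (Dz : disk z (Cmod z) z) by (apply disk_center; auto).
  assert (EL : forall w, disk z (Cmod z) w -> Cexp (L w) = w).
  { intros w Hw.
    assert (E : (Cexp (-(1) * L w) * w)%C = (Cexp (-(1) * L z) * z)%C).
    { apply (deriv0_const (disk z (Cmod z)) (fun w => Cexp (-(1) * L w) * w)%C); auto using disk_convex.
      intros u Hu. eapply cderiv_eq; [apply cderiv_mult; [apply cderiv_exp_scal, HL; auto|apply cderiv_id]|].
      cbv beta. field. auto. }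
    replace (-(1) * L z)%C with (- L z)%C in E by ring. replace (-(1) * L w)%C with (- L w)%C in E by ring.
    rewrite !Cexp_opp, Lz, Cexp_Clog, Cinv_l in E by auto.
    apply (f_equal (fun x => Cexp (L w) * x)%C) in E. rewrite Cmult_assoc, Cinv_r in E by apply Cexp_neq0.
    rewrite Cmult_1_l, Cmult_1_r in E. auto. }
  (* This margin keeps [Im (L w)] strictly between [- PI] and [PI]; with [|Im (Clog w)| <= PI] the
     two differ by less than [2 pi]. *)
  set (e := Rmin (PI - Im (Clog z)) (PI + Im (Clog z))).
  assert (He : 0 < e) by (apply Rmin_pos; lra).
  assert (e <= PI - Im (Clog z)) by apply Rmin_l. assert (e <= PI + Im (Clog z)) by apply Rmin_r.
  destruct (cderiv_ccont _ _ _ (HL z Dz) e He) as [d [Hd K]].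
  assert (Hm : 0 < Rmin d (Cmod z)) by (apply Rmin_pos; auto).
  apply (cderiv_local L _ _ _ _ Hm); [|apply HL; auto].
  intros w Hw. destruct (disk_Rmin _ _ _ _ Hw) as [w1 w2].
  apply Cexp_inj.
  - rewrite EL, Cexp_Clog; auto.
  - specialize (K w w1). rewrite Lz in K. pose proof (im_le_Cmod (L w - Clog z)) as B.
    change (Im (L w - Clog z)) with (Im (L w) - Im (Clog z)) in B. apply Rabs_le_between in B.
    pose proof (Carg_bound w (D0 w w2)). change (Carg w) with (Im (Clog w)) in H1. apply Rabs_lt_between. lra.
Qed.

(** Component [k] is [b_(k-i)] for the branch [ell] of the logarithm. Thus component [m] is the
    entry of index [i >= 1] of the basis column, and the components below [i] vanish. *)
Definition bsol (c : C) (i : nat) (ell : C -> C) (k : nat) (z : C) : C :=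
  if Nat.ltb k i then RtoC 0
  else (/ RtoC (INR (fact (k - i))) * Cexp ((1 - c) * ell z) * Cpow (ell z) (k - i))%C.

Lemma RtoC_INR_neq0 n : (0 < n)%nat -> RtoC (INR n) <> 0%C.
Proof. intros H E. apply RtoC_inj in E. apply lt_0_INR in H. lra. Qed.

Lemma cderiv_divpow (ell : C -> C) z l n : cderiv ell z l ->
  cderiv (fun z => / RtoC (INR (fact (S n))) * Cpow (ell z) (S n))%C z (l * (/ RtoC (INR (fact n)) * Cpow (ell z) n))%C.
Proof.
  intros H.
  assert (D : forall m, cderiv (fun z => Cpow (ell z) (S m)) z (RtoC (INR (S m)) * l * Cpow (ell z) m)%C).
  { induction m.
    - apply (cderiv_local ell _ _ _ 1 Rlt_0_1); [intros; simpl; ring|]. eapply cderiv_eq; [exact H|simpl; ring].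
    - apply (cderiv_local (fun z => ell z * Cpow (ell z) (S m))%C _ _ _ 1 Rlt_0_1); [intros; rewrite (Cpow_S (ell w) (S m)); ring|].
      eapply cderiv_eq; [apply cderiv_mult; eauto|]. rewrite (S_INR (S m)), RtoC_plus, !Cpow_S. ring. }
  eapply cderiv_eq; [apply cderiv_scal, D|].
  change (fact (S n)) with (S n * fact n)%nat. rewrite mult_INR, RtoC_mult.
  assert (RtoC (INR (S n)) <> 0%C) by (apply RtoC_INR_neq0; lia).
  assert (RtoC (INR (fact n)) <> 0%C) by (apply RtoC_INR_neq0, lt_O_fact). field; auto.
Qed.

Lemma bsol_sol c i ell U : (0 < i)%nat -> (forall z, U z -> punctured z /\ cderiv ell z (/ z)%C) ->
  sol c U (bsol c i ell).
Proof.
  intros Hi HU z Hz. destruct (HU z Hz) as [Hp Hl]. split; [auto|]. split.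
  - unfold bsol. destruct (Nat.ltb_spec 0 i); [|lia]. apply cderiv_const.
  - intros k. destruct (lt_eq_lt_dec (S k) i) as [[h|h]|h].
    + unfold bsol. destruct (Nat.ltb_spec (S k) i); [|lia]. destruct (Nat.ltb_spec k i); [|lia].
      eapply cderiv_eq; [apply cderiv_const|ring].
    + subst i. unfold bsol. rewrite Nat.ltb_irrefl, Nat.sub_diag. destruct (Nat.ltb_spec k (S k)); [|lia].
      eapply cderiv_eq.
      * apply cderiv_mult; [apply cderiv_scal, cderiv_exp_scal, Hl|apply (cderiv_const 1%C z)].
      * simpl. field. apply Hp.
    + unfold bsol. destruct (Nat.ltb_spec (S k) i); [lia|]. destruct (Nat.ltb_spec k i); [lia|].
      replace (S k - i)%nat with (S (k - i)) by lia. set (n := (k - i)%nat).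
      apply (cderiv_local (fun z => Cexp ((1 - c) * ell z) * (/ RtoC (INR (fact (S n))) * Cpow (ell z) (S n)))%C _ _ _ 1 Rlt_0_1); [intros; ring|].
      eapply cderiv_eq; [apply cderiv_mult; [apply cderiv_exp_scal, Hl|apply cderiv_divpow, Hl]|].
      destruct k; [lia|]. simpl bcoef.
      assert (RtoC (INR (fact (S n))) <> 0%C) by (apply RtoC_INR_neq0, lt_O_fact).
      assert (RtoC (INR (fact n)) <> 0%C) by (apply RtoC_INR_neq0, lt_O_fact).
      field. repeat split; auto. apply Hp.
Qed.

(** * Power series with bounded coefficients *)

Definition cser (a : nat -> C) (l : C) := @is_series C_AbsRing C_NormedModule a l.

Lemma cser_unique a l l' : cser a l -> cser a l' -> l = l'.
Proof. intros H H'. apply (filterlim_locally_unique _ _ _ H H'). Qed.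

Lemma cser_plus a b l l' : cser a l -> cser b l' -> cser (fun n => a n + b n)%C (l + l')%C.
Proof. intros H H'. apply (is_series_plus (V := C_NormedModule) _ _ _ _ H H'). Qed.

Lemma cser_scal a l k : cser a l -> cser (fun n => k * a n)%C (k * l)%C.
Proof. intros H. apply (is_series_scal (K := C_AbsRing) (V := C_NormedModule) k _ _ H). Qed.

Lemma cser_ext a b l : (forall n, a n = b n) -> cser a l -> cser b l.
Proof. intros H. apply is_series_ext. auto. Qed.

Lemma cser_ex a (b : nat -> R) : (forall n, Cmod (a n) <= b n) -> ex_series b -> exists l, cser a l.
Proof. intros H Hb. apply (ex_series_le (K := C_AbsRing) (V := C_CompleteNormedModule) a b); auto. Qed.

Lemma cser_bound a (b : nat -> R) l L : (forall n, Cmod (a n) <= b n) -> cser a l -> is_series b L -> Cmod l <= L.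
Proof.
  intros H Ha Hb.
  assert (Hn : filterlim (fun n => Cmod (sum_n (G := C_NormedModule) a n)) eventually (locally (Cmod l))).
  { apply (filterlim_comp _ _ _ _ Cmod _ (locally (T := C_NormedModule) l)); [exact Ha|].
    apply (filterlim_norm (K := C_AbsRing) (V := C_NormedModule)). }
  apply (filterlim_le (F := eventually) (fun n => Cmod (sum_n (G := C_NormedModule) a n)) (sum_n b) (Finite (Cmod l)) (Finite L)).
  - exists O. intros n _. eapply Rle_trans.
    + apply (norm_sum_n_m (K := C_AbsRing) (V := C_NormedModule) a 0 n).
    + apply sum_n_m_le. auto.
  - exact Hn.
  - exact Hb.
Qed.

Lemma pow_le_inv_linear t n : 0 < t < 1 -> INR n * t ^ n <= / (/ t - 1).
Proof.
  intros Ht. set (d := / t - 1).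
  assert (Hd : 0 < d). { unfold d. pose proof (Rinv_lt_contravar t 1 ltac:(lra) ltac:(lra)). rewrite Rinv_1 in H. lra. }
  pose proof (poly n d Hd) as P. replace (1 + d) with (/ t) in P by (unfold d; ring).
  rewrite pow_inv in P. pose proof (pow_lt t n ltac:(lra)) as Hp.
  apply Rmult_le_reg_r with d; auto. rewrite Rinv_l by lra.
  apply Rmult_le_reg_r with (/ t ^ n); [apply Rinv_0_lt_compat; auto|].
  replace (INR n * t ^ n * d * / t ^ n) with (INR n * d) by (field; lra). lra.
Qed.

Lemma ex_series_sqr_geom r : 0 < r < 1 -> ex_series (fun n => (INR n) ^ 2 * r ^ n).
Proof.
  (* With [t^4 = r], the term is [(n t^n)^2 * t^(2n)]: the square is bounded by Bernoulli's
     inequality, and the rest is geometric of ratio [sqrt r]. *)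
  intros Hr. set (t := sqrt (sqrt r)).
  assert (Hs : 0 < sqrt r < 1). { split; [apply sqrt_lt_R0; lra|]. rewrite <- sqrt_1. apply sqrt_lt_1; lra. }
  assert (Ht : 0 < t < 1). { unfold t. split; [apply sqrt_lt_R0; lra|]. rewrite <- sqrt_1. apply sqrt_lt_1; lra. }
  assert (E2 : t ^ 2 = sqrt r) by (apply pow2_sqrt; lra).
  assert (E4 : r = t ^ 2 * t ^ 2). { rewrite E2. symmetry. apply sqrt_sqrt. lra. }
  set (K := / (/ t - 1)).
  apply (ex_series_le (V := R_CompleteNormedModule) _ (fun n => K ^ 2 * (sqrt r) ^ n)).
  - intros n. change (Rabs (INR n ^ 2 * r ^ n) <= K ^ 2 * sqrt r ^ n).
    pose proof (pow_le_inv_linear t n Ht) as P. fold K in P.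
    assert (0 <= INR n * t ^ n) by (apply Rmult_le_pos; [apply pos_INR|apply pow_le; lra]).
    rewrite Rabs_right by (apply Rle_ge, Rmult_le_pos; apply pow_le; [apply pos_INR|lra]).
    replace (r ^ n) with ((t ^ 2 * t ^ 2) ^ n) by (rewrite <- E4; auto). rewrite <- E2. rewrite Rpow_mult_distr, <- !pow_mult, (Nat.mul_comm 2 n), !pow_mult.
    replace (INR n ^ 2 * ((t ^ n) ^ 2 * (t ^ n) ^ 2)) with ((INR n * t ^ n) ^ 2 * (t ^ n) ^ 2) by ring.
    apply Rmult_le_compat_r; [apply pow2_ge_0|]. apply pow_incr. auto.
  - apply (ex_series_scal (K := R_AbsRing) (V := R_NormedModule)). apply ex_series_geom. rewrite Rabs_right; lra.
Qed.

(** The remainders satisfy [q_(n+1) = w q_n + n z^(n-1) (w - z)^2]. Both sides carry the factor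
    [r^2] so that no exponent [n - 2] occurs. *)
Lemma pow_remainder (w z : C) r n : 0 < r -> Cmod w <= r -> Cmod z <= r ->
  r ^ 2 * Cmod (Cpow w n - Cpow z n - RtoC (INR n) * Cpow z (pred n) * (w - z)) <= (INR n) ^ 2 * r ^ n * Cmod (w - z) ^ 2.
Proof.
  intros Hr Hw Hz. induction n.
  - simpl. replace (1 - 1 - 0 * 1 * (w - z))%C with (RtoC 0) by ring. rewrite Cmod_0. lra.
  - set (q := (Cpow w n - Cpow z n - RtoC (INR n) * Cpow z (pred n) * (w - z))%C) in *.
    assert (E : (Cpow w (S n) - Cpow z (S n) - RtoC (INR (S n)) * Cpow z (pred (S n)) * (w - z))%C
       = (w * q + RtoC (INR n) * Cpow z (pred n) * ((w - z) * (w - z)))%C).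
    { unfold q. rewrite !Cpow_S, S_INR, RtoC_plus. simpl pred. destruct n; [simpl; ring|]. simpl pred. rewrite !(Cpow_S z). ring. }
    rewrite E. set (h := Cmod (w - z)) in *.
    assert (T : Cmod (w * q + RtoC (INR n) * Cpow z (pred n) * ((w - z) * (w - z))) <= r * Cmod q + INR n * Cmod (Cpow z (pred n)) * h ^ 2).
    { eapply Rle_trans; [apply Cmod_triangle|]. rewrite !Cmod_mult, Cmod_R, (Rabs_right (INR n)) by (apply Rle_ge, pos_INR).
      fold h. pose proof (Cmod_ge_0 q). nra. }
    assert (Z : r ^ 2 * (INR n * Cmod (Cpow z (pred n))) <= INR n * r ^ S n).
    { destruct n; [simpl; lra|]. simpl pred. rewrite Cmod_pow.
      replace (r ^ S (S n)) with (r ^ 2 * r ^ n) by (simpl; ring).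
      pose proof (pow_incr _ _ n (conj (Cmod_ge_0 z) Hz)). pose proof (pos_INR (S n)).
      assert (0 <= r ^ 2) by (apply pow_le; lra).
      replace (r ^ 2 * (INR (S n) * Cmod z ^ n)) with ((r ^ 2 * INR (S n)) * Cmod z ^ n) by ring.
      replace (INR (S n) * (r ^ 2 * r ^ n)) with ((r ^ 2 * INR (S n)) * r ^ n) by ring.
      apply Rmult_le_compat_l; [apply Rmult_le_pos|]; auto. }
    apply Rle_trans with (r ^ 2 * (r * Cmod q + INR n * Cmod (Cpow z (pred n)) * h ^ 2)).
    { apply Rmult_le_compat_l; [apply pow_le; lra|auto]. }
    replace (r ^ 2 * (r * Cmod q + INR n * Cmod (Cpow z (pred n)) * h ^ 2)) with (r * (r ^ 2 * Cmod q) + r ^ 2 * (INR n * Cmod (Cpow z (pred n))) * h ^ 2) by ring.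
    assert (0 <= h ^ 2) by apply pow2_ge_0.
    apply Rle_trans with (r * (INR n ^ 2 * r ^ n * h ^ 2) + INR n * r ^ S n * h ^ 2).
    { apply Rplus_le_compat; [apply Rmult_le_compat_l; lra|apply Rmult_le_compat_r; auto]. }
    rewrite S_INR. simpl (r ^ S n). pose proof (pos_INR n).
    assert (0 <= r * r ^ n * h ^ 2). { apply Rmult_le_pos; [apply Rmult_le_pos; [lra|apply pow_le; lra]|auto]. }
    replace (r * (INR n ^ 2 * r ^ n * h ^ 2) + INR n * (r * r ^ n) * h ^ 2) with ((INR n ^ 2 + INR n) * (r * r ^ n * h ^ 2)) by ring.
    replace ((INR n + 1) ^ 2 * (r * r ^ n) * h ^ 2) with ((INR n ^ 2 + 2 * INR n + 1) * (r * r ^ n * h ^ 2)) by ring.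
    apply Rmult_le_compat_r; auto. lra.
Qed.

(** Summing the quadratic remainders bounds the error by [K |w - z|^2] at once, which replaces
    uniform convergence of the derived series. *)
Lemma power_series_cderiv (a : nat -> C) A (f g : C -> C) : (forall n, Cmod (a n) <= A) ->
  (forall z, Cmod z < 1 -> cser (fun n => a n * Cpow z n)%C (f z)) ->
  (forall z, Cmod z < 1 -> cser (fun n => a n * (RtoC (INR n) * Cpow z (pred n)))%C (g z)) ->
  forall z, Cmod z < 1 -> cderiv f z (g z).
Proof.
  intros HA Hf Hg z Hz. set (r := (1 + Cmod z) / 2). pose proof (Cmod_ge_0 z).
  assert (Hr : 0 < r < 1) by (unfold r; lra).
  destruct (ex_series_sqr_geom r Hr) as [S HS].
  assert (A0 : 0 <= A). { eapply Rle_trans; [apply Cmod_ge_0|apply (HA O)]. }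
  assert (S0 : 0 <= S).
  { apply (is_lim_seq_le (fun _ => 0) (sum_n (fun n => INR n ^ 2 * r ^ n)) (Finite 0) (Finite S)); [|apply is_lim_seq_const|exact HS].
    intros n. rewrite sum_n_Reals. apply cond_pos_sum. intros k.
    apply Rmult_le_pos; apply pow_le; [apply pos_INR|lra]. }
  set (K := A * S / r ^ 2).
  assert (K0 : 0 <= K). { unfold K. apply Rmult_le_pos; [apply Rmult_le_pos; auto|]. left. apply Rinv_0_lt_compat, pow_lt; lra. }
  apply eps_cderiv. intros e He. exists (Rmin (r - Cmod z) (e / (K + 1))).
  split; [apply Rmin_pos; [unfold r; lra|apply Rdiv_lt_0_compat; lra]|]. intros w Hw.
  destruct (disk_Rmin _ _ _ _ Hw) as [h1 h2]. unfold disk in h1, h2.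
  set (h := Cmod (w - z)) in *. assert (Hh : 0 <= h) by apply Cmod_ge_0.
  assert (Hwr : Cmod w <= r). { pose proof (Cmod_rev_tri w z). fold h in H0. lra. }
  assert (Hzr : Cmod z <= r) by (unfold r; lra).
  assert (Q : cser (fun n => a n * (Cpow w n - Cpow z n - RtoC (INR n) * Cpow z (pred n) * (w - z)))%C (f w - f z - g z * (w - z))%C).
  { pose proof (cser_plus _ _ _ _ (Hf w ltac:(lra)) (cser_plus _ _ _ _ (cser_scal _ _ (-(1))%C (Hf z Hz)) (cser_scal _ _ (- (w - z))%C (Hg z Hz)))) as P.
    replace (f w - f z - g z * (w - z))%C with (f w + (- (1) * f z + - (w - z) * g z))%C by ring.
    eapply cser_ext; [|exact P]. intros n. cbv beta. ring. }
  assert (B : Cmod (f w - f z - g z * (w - z))%C <= K * h ^ 2).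
  { apply (cser_bound _ (fun n => (A / r ^ 2 * h ^ 2) * (INR n ^ 2 * r ^ n)) _ _) with (2 := Q).
    - intros n. rewrite Cmod_mult. pose proof (pow_remainder w z r n ltac:(lra) Hwr Hzr) as P. fold h in P.
      set (q := Cmod _) in P |- * at 2.
      assert (r2 : 0 < r ^ 2) by (apply pow_lt; lra).
      apply Rle_trans with (A * q); [apply Rmult_le_compat_r; [apply Cmod_ge_0|auto]|].
      replace (A / r ^ 2 * h ^ 2 * (INR n ^ 2 * r ^ n)) with (A * ((INR n ^ 2 * r ^ n * h ^ 2) / r ^ 2)) by (field; lra).
      apply Rmult_le_compat_l; auto. apply Rmult_le_reg_l with (r ^ 2); auto.
      replace (r ^ 2 * (INR n ^ 2 * r ^ n * h ^ 2 / r ^ 2)) with (INR n ^ 2 * r ^ n * h ^ 2) by (field; lra). auto.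
    - replace (K * h ^ 2) with (scal (A / r ^ 2 * h ^ 2) S) by (unfold scal; simpl; unfold mult; simpl; unfold K; field; lra).
      apply (is_series_scal (K := R_AbsRing) (V := R_NormedModule)). exact HS. }
  eapply Rle_trans; [exact B|]. replace (K * h ^ 2) with (K * h * h) by ring.
  apply Rmult_le_compat_r; auto.
  assert (h * (K + 1) < e). { apply Rmult_lt_reg_r with (/ (K + 1)); [apply Rinv_0_lt_compat; lra|].
    rewrite Rmult_assoc, Rinv_r by lra. unfold Rdiv in h2. lra. }
  nra.
Qed.

Lemma bounded_cser (a : nat -> C) A z : (forall n, Cmod (a n) <= A) -> Cmod z < 1 ->
  (exists l, cser (fun n => a n * Cpow z n)%C l) /\ (exists l, cser (fun n => a n * (RtoC (INR n) * Cpow z (pred n)))%C l).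
Proof.
  intros HA Hz. pose proof (Cmod_ge_0 z). set (r := (1 + Cmod z) / 2). assert (Hr : 0 < r < 1) by (unfold r; lra).
  assert (A0 : 0 <= A). { eapply Rle_trans; [apply Cmod_ge_0|apply (HA O)]. }
  split.
  - apply (cser_ex _ (fun n => A * Cmod z ^ n)).
    + intros n. rewrite Cmod_mult, Cmod_pow. apply Rmult_le_compat_r; [apply pow_le; auto|auto].
    + apply (ex_series_scal (K := R_AbsRing) (V := R_NormedModule)). apply ex_series_geom. rewrite Rabs_right; lra.
  - apply (cser_ex _ (fun n => A / r * (INR n ^ 2 * r ^ n))).
    + intros n. rewrite !Cmod_mult, Cmod_pow, Cmod_R, Rabs_right by (apply Rle_ge, pos_INR).
      replace (A / r * (INR n ^ 2 * r ^ n)) with (A * (INR n ^ 2 * r ^ n / r)) by (field; lra).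
      apply Rmult_le_compat; auto; [apply Cmod_ge_0|apply Rmult_le_pos; [apply pos_INR|apply pow_le; auto]|].
      destruct n; [simpl; lra|]. simpl pred.
      replace (INR (S n) ^ 2 * r ^ S n / r) with (INR (S n) ^ 2 * r ^ n) by (simpl; field; lra).
      pose proof (pow_incr (Cmod z) r n ltac:(unfold r; lra)). pose proof (pow_le (Cmod z) n H).
      assert (1 <= INR (S n)). { rewrite S_INR. pose proof (pos_INR n). lra. }
      apply Rmult_le_compat; auto; try nra.
    + apply (ex_series_scal (K := R_AbsRing) (V := R_NormedModule)). apply ex_series_sqr_geom; auto.
Qed.

Lemma geometric_cser z l : Cmod z < 1 -> cser (fun n => 1 * Cpow z n)%C l -> l = (/ (1 - z))%C.
Proof.
  intros Hz H.
  assert (n1 : (1 - z)%C <> 0%C). { apply one_minus_neq0. intros ->. rewrite Cmod_1 in Hz. lra. }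
  assert (E : forall n, sum_n (G := C_NormedModule) (fun n => 1 * Cpow z n)%C n = ((1 - Cpow z (S n)) / (1 - z))%C).
  { induction n.
    - rewrite sum_O. match goal with |- ?u = ?v => change (@eq C u v) end. simpl. field. auto.
    - rewrite sum_Sn, IHn.
      change ((1 - Cpow z (S n)) / (1 - z) + 1 * Cpow z (S n) = (1 - Cpow z (S (S n))) / (1 - z))%C.
      rewrite !Cpow_S. field. auto. }
  apply Ceq_minus, Cmod_le_eps. intros e He.
  assert (Hc := proj1 (filterlim_locally (F := eventually) (U := C_UniformSpace) _ _) H).
  (* The balls of the uniform structure on [C] are squares; passing to the modulus costs the factor
     [sqrt 2]. *)
  destruct (Hc (mkposreal (e / 2 / sqrt 2) ltac:(apply Rdiv_lt_0_compat; [lra|apply sqrt_lt_R0; lra]))) as [N1 K1].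
  set (M := Cmod (1 - z)). assert (HM : 0 < M) by (apply Cmod_gt_0; auto).
  destruct (pow_lt_1_zero (Cmod z) ltac:(rewrite Rabs_right; [lra|apply Rle_ge, Cmod_ge_0]) (e / 2 * M)) as [N2 K2].
  { apply Rmult_lt_0_compat; lra. }
  set (N := max N1 N2). specialize (K1 N ltac:(lia)). specialize (K2 (S N) ltac:(lia)).
  apply (C_NormedModule_mixin_compat2) in K1. rewrite E in K1. simpl in K1.
  replace (sqrt 2 * (e / 2 / sqrt 2)) with (e / 2) in K1 by (field; apply Rgt_not_eq, sqrt_lt_R0; lra).
  change (Cmod (((1 - Cpow z (S N)) / (1 - z)) - l) < e / 2) in K1.
  rewrite <- Cmod_pow, Rabs_right in K2 by (apply Rle_ge, Cmod_ge_0).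
  replace (l - / (1 - z))%C with (- (((1 - Cpow z (S N)) / (1 - z)) - l) + - (Cpow z (S N) / (1 - z)))%C by (field; auto).
  eapply Rle_trans; [apply Cmod_triangle|]. rewrite !Cmod_opp. rewrite (Cmod_div _ (1 - z)) by auto. fold M.
  assert (Cmod (Cpow z (S N)) / M < e / 2).
  { apply Rmult_lt_reg_r with M; auto. unfold Rdiv at 1. rewrite Rmult_assoc, Rinv_l by lra. lra. }
  lra.
Qed.

(** * The polylogarithm series as a solution of the system *)

Section LiSeries.
Variable c : C.
Hypothesis Hc : forall k : nat, c <> RtoC (- INR k).

Lemma shift_neq0 n : (RtoC (INR n) + c)%C <> 0%C.
Proof.
  intros E. apply (Hc n). rewrite RtoC_opp. replace c with ((RtoC (INR n) + c) - RtoC (INR n))%C by ring. rewrite E. ring.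
Qed.

(** Beyond [n > |c| + 1] the modulus exceeds 1; the finitely many earlier values are nonzero because
    [c] is not a nonpositive integer. *)
Lemma shift_lower : exists d, 0 < d /\ forall n, d <= Cmod (RtoC (INR n) + c).
Proof.
  assert (F : forall N, exists d, 0 < d /\ forall n, (n < N)%nat -> d <= Cmod (RtoC (INR n) + c)).
  { induction N as [|N [d [Hd K]]]; [exists 1; split; [lra|lia]|].
    pose proof (proj1 (Cmod_gt_0 _) (shift_neq0 N)) as P.
    exists (Rmin d (Cmod (RtoC (INR N) + c))). split; [apply Rmin_pos; auto|]. intros n Hn.
    destruct (Nat.eq_dec n N) as [->|ne]; [apply Rmin_r|]. eapply Rle_trans; [apply Rmin_l|]. apply K. lia. }
  destruct (INR_unbounded (Cmod c + 1)) as [N HN]. destruct (F N) as [d [Hd K]].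
  exists (Rmin d 1). split; [apply Rmin_pos; lra|]. intros n.
  destruct (lt_dec n N) as [h|h]; [eapply Rle_trans; [apply Rmin_l|auto]|].
  eapply Rle_trans; [apply Rmin_r|].
  pose proof (Cmod_rev_tri (RtoC (INR n)) (- c)) as T. rewrite Cmod_opp in T.
  replace (RtoC (INR n) - - c)%C with (RtoC (INR n) + c)%C in T by ring.
  rewrite Cmod_R, Rabs_right in T by (apply Rle_ge, pos_INR).
  assert (INR N <= INR n) by (apply le_INR; lia). lra.
Qed.

Definition licoef (k n : nat) : C := (/ Cpow (RtoC (INR n) + c) k)%C.

Lemma licoef_bound k : exists A, forall n, Cmod (licoef k n) <= A.
Proof.
  destruct shift_lower as [d [Hd K]]. exists (/ d ^ k). intros n. unfold licoef.
  rewrite Cmod_inv by (apply Cpow_nz, shift_neq0). rewrite Cmod_pow.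
  apply Rinv_le_contravar; [apply pow_lt; auto|]. apply pow_incr. split; [lra|auto].
Qed.

Lemma Fser_ex k z : exists p : C * C, Cmod z < 1 -> cser (fun n => licoef k n * Cpow z n)%C (fst p) /\
   cser (fun n => licoef k n * (RtoC (INR n) * Cpow z (pred n)))%C (snd p).
Proof.
  destruct (classic (Cmod z < 1)) as [h|h]; [|exists (RtoC 0, RtoC 0); tauto].
  destruct (licoef_bound k) as [A HA]. destruct (bounded_cser _ A z HA h) as [[l Hl] [l' Hl']].
  exists (l, l'). auto.
Qed.

Definition Fser k z : C * C := proj1_sig (constructive_indefinite_description _ (Fser_ex k z)).

Lemma Fser_spec k z : Cmod z < 1 -> cser (fun n => licoef k n * Cpow z n)%C (fst (Fser k z)) /\
   cser (fun n => licoef k n * (RtoC (INR n) * Cpow z (pred n)))%C (snd (Fser k z)).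
Proof. unfold Fser. destruct constructive_indefinite_description. auto. Qed.

Lemma cderiv_Fser k z : Cmod z < 1 -> cderiv (fun z => fst (Fser k z)) z (snd (Fser k z)).
Proof.
  intros Hz. destruct (licoef_bound k) as [A HA].
  apply (power_series_cderiv (licoef k) A _ (fun z => snd (Fser k z))); auto; intros w Hw; apply Fser_spec; auto.
Qed.

(** The operator [z d/dz + c] multiplies the coefficient of [z^n] by [n + c]. The shift is [c]
    rather than [c - 1] because a factor [z] has been taken out of the series. *)
Lemma Fser_rec k z : Cmod z < 1 ->
  (z * snd (Fser (S k) z) + c * fst (Fser (S k) z))%C = fst (Fser k z).
Proof.
  intros Hz. destruct (Fser_spec (S k) z Hz) as [h1 h2]. destruct (Fser_spec k z Hz) as [h3 _].
  apply (cser_unique (fun n => licoef k n * Cpow z n)%C); auto.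
  eapply cser_ext; [|apply (cser_plus _ _ _ _ (cser_scal _ _ z h2) (cser_scal _ _ c h1))].
  intros n. cbv beta. unfold licoef. rewrite Cpow_S. pose proof (shift_neq0 n) as n0.
  replace (z * (/ ((RtoC (INR n) + c) * Cpow (RtoC (INR n) + c) k) * (RtoC (INR n) * Cpow z (Nat.pred n))))%C
    with (/ ((RtoC (INR n) + c) * Cpow (RtoC (INR n) + c) k) * (RtoC (INR n) * Cpow z n))%C.
  - field. split; [apply Cpow_nz|]; auto.
  - destruct n; [simpl; ring|]. simpl Nat.pred. rewrite Cpow_S. ring.
Qed.

(** Component 0 is the normalisation [alpha = 1] of [sol]; the series of order 0 itself is
    [z / (1 - z)]. *)
Definition LiS (k : nat) (z : C) : C := match k with O => RtoC 1 | S _ => (z * fst (Fser k z))%C end.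

Lemma LiS_sol : sol c (fun z => Cmod z < 1 /\ z <> 0%C) LiS.
Proof.
  intros z [Hz n0].
  assert (n1 : z <> 1%C). { intros ->. rewrite Cmod_1 in Hz. lra. }
  split; [split; auto|]. split; [apply cderiv_const|]. intros k.
  eapply cderiv_eq; [apply cderiv_mult; [apply cderiv_id|apply cderiv_Fser; auto]|].
  transitivity ((1 - c) * fst (Fser (S k) z) + (z * snd (Fser (S k) z) + c * fst (Fser (S k) z)))%C; [ring|].
  rewrite (Fser_rec k z Hz). unfold LiS. destruct k.
  - rewrite (geometric_cser z (fst (Fser 0 z)) Hz); [simpl bcoef; field; split; auto using one_minus_neq0|].
    eapply cser_ext; [|apply Fser_spec; auto]. intros n. unfold licoef. simpl. field.
  - simpl bcoef. field. auto.
Qed.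

Lemma LiS_series m z l : (1 <= m)%nat -> Cmod z < 1 ->
  cser (fun n => Cpow z (S n) / Cpow (RtoC (INR n) + c) m)%C l -> l = LiS m z.
Proof.
  intros Hm Hz H. destruct m; [lia|]. simpl LiS.
  apply (cser_unique _ _ _ H). destruct (Fser_spec (S m) z Hz) as [h _].
  eapply cser_ext; [|apply (cser_scal _ _ z h)]. intros n. cbv beta. unfold licoef, Cdiv. rewrite (Cpow_S z). ring.
Qed.

End LiSeries.

(** * Local monodromy at 1 *)

Lemma Clog_pos x : 0 < x -> Clog (RtoC x) = RtoC (ln x).
Proof.
  intros Hx. unfold Clog, Carg. rewrite Cmod_R, Rabs_right by lra.
  simpl. destruct Rle_dec; [|lra]. replace (x / x) with 1 by (field; lra). rewrite acos_1. auto.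
Qed.

Lemma Clog_1 : Clog 1 = 0%C.
Proof. rewrite Clog_pos by lra. rewrite ln_1. auto. Qed.

(** The function [log z] in the coordinate [w = log (1 - z)]. For [Re w < 0] the point [z] stays in
    the right half-plane, so the principal branch is holomorphic there and has period [twopii] in
    [w]. *)
Definition lam (w : C) : C := Clog (1 - Cexp w).

Lemma one_minus_exp_Re (w : C) : Re w < 0 -> 0 < Re (1 - Cexp w)%C.
Proof.
  intros H. change (Re (1 - Cexp w)%C) with (1 - Re (Cexp w)).
  pose proof (re_le_Cmod (Cexp w)) as B. rewrite Cmod_Cexp in B. apply Rabs_le_between in B.
  pose proof (exp_increasing _ _ H). rewrite exp_0 in H0. lra.
Qed.

Definition dlam (w : C) : C := (- Cexp w / (1 - Cexp w))%C.

Lemma one_minus_exp_neq0 (w : C) : Re w < 0 -> (1 - Cexp w)%C <> 0%C.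
Proof. intros H. apply slit_neq0. left. apply one_minus_exp_Re. auto. Qed.

Lemma cderiv_one_minus_exp w : cderiv (fun w => 1 - Cexp w)%C w (- Cexp w)%C.
Proof.
  eapply cderiv_eq; [apply cderiv_minus; [apply cderiv_const|apply cderiv_Cexp]|ring].
Qed.

Lemma cderiv_lam (w : C) : Re w < 0 -> cderiv lam w (dlam w).
Proof.
  intros H. eapply cderiv_eq.
  - apply (cderiv_comp (fun w => 1 - Cexp w)%C Clog); [apply cderiv_one_minus_exp|].
    apply cderiv_Clog. left. apply one_minus_exp_Re; auto.
  - unfold dlam. field. apply one_minus_exp_neq0; auto.
Qed.

Lemma lam_per w : lam (w + twopii) = lam w.
Proof. unfold lam. rewrite Cexp_per. auto. Qed.

Lemma dlam_per w : dlam (w + twopii) = dlam w.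
Proof. unfold dlam. rewrite Cexp_per. auto. Qed.

Lemma holo_dlam (w : C) : Re w < 0 -> exists l, cderiv dlam w l.
Proof.
  intros H. eexists. unfold dlam.
  apply (cderiv_mult (fun w => - Cexp w)%C (fun w => / (1 - Cexp w))%C).
  - apply cderiv_opp, cderiv_Cexp.
  - apply (cderiv_inv (fun w => 1 - Cexp w)%C); [apply one_minus_exp_neq0; auto|apply cderiv_one_minus_exp].
Qed.

Lemma lam_small e : 0 < e -> exists x, x <= -1 /\ forall w : C, Re w <= x -> Cmod (lam w) < e.
Proof.
  intros He. assert (S1 : slit 1%C) by (left; simpl; lra).
  destruct (cderiv_ccont _ _ _ (cderiv_Clog _ S1) e He) as [d [Hd K]].
  exists (Rmin (-1) (ln (d / 2))). split; [apply Rmin_l|]. intros w Hw.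
  specialize (K (1 - Cexp w)%C). rewrite Clog_1 in K. replace (Clog (1 - Cexp w) - 0)%C with (lam w) in K by (unfold lam; ring).
  apply K. replace (1 - Cexp w - 1)%C with (- Cexp w)%C by ring. rewrite Cmod_opp, Cmod_Cexp.
  pose proof (Rmin_r (-1) (ln (d / 2))).
  apply Rle_lt_trans with (d / 2); [|lra]. rewrite <- (exp_ln (d / 2)) by lra.
  destruct (Rle_lt_or_eq_dec _ _ (Rle_trans _ _ _ Hw H)) as [q|q]; [left; apply exp_increasing; auto|rewrite q; lra].
Qed.

Lemma dlam_bound (w : C) : Re w <= -1 -> Cmod (dlam w) <= 2 * exp (Re w).
Proof.
  intros H. unfold dlam. rewrite Cmod_div by (apply one_minus_exp_neq0; lra). rewrite Cmod_opp, Cmod_Cexp.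
  assert (E : exp (Re w) <= / 2).
  { apply Rle_trans with (exp (-1)); [destruct H as [H|H]; [left; apply exp_increasing; auto|rewrite H; lra]|].
    replace (-1) with (- (1)) by ring. rewrite exp_Ropp. apply Rinv_le_contravar; [lra|].
    pose proof (exp_ineq1_le 1). lra. }
  assert (D : /2 <= Cmod (1 - Cexp w)).
  { pose proof (Cmod_rev_tri 1 (Cexp w)) as T. rewrite Cmod_1, Cmod_Cexp in T. lra. }
  pose proof (exp_pos (Re w)). apply Rmult_le_reg_r with (Cmod (1 - Cexp w)); [lra|].
  unfold Rdiv. rewrite Rmult_assoc, Rinv_l by lra. nra.
Qed.

(** Both follow from [1 + v <= exp v], at [v = u] and, squared, at [v = u/2]. The first bounds a
    product of exponential decay and linear growth; the second makes it tend to zero. *)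
Lemma exp_linear_bound u : 0 <= u -> exp (- u) * (1 + u) <= 1 /\ exp (- u) * (1 + u) * (1 + u / 2) <= 2.
Proof.
  intros Hu. rewrite exp_Ropp. pose proof (exp_pos u). pose proof (exp_ineq1_le u). pose proof (exp_ineq1_le (u / 2)).
  assert (E : exp u = exp (u / 2) * exp (u / 2)) by (rewrite <- exp_plus; f_equal; field).
  assert ((1 + u / 2) * (1 + u / 2) <= exp u) by (rewrite E; apply Rmult_le_compat; lra).
  split; apply Rmult_le_reg_l with (exp u); auto.
  - rewrite <- Rmult_assoc, Rinv_r; lra.
  - rewrite !Rmult_assoc, <- (Rmult_assoc (exp u)), Rinv_r by lra. nra.
Qed.

Section Monodromy1.
Variable c : C.
(** [X j] stands for [z^(c-1) u_(j+1)] with [z = 1 - exp w]. Since [dz / (1 - z) = - dw], the pole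
    at 1 disappears and the equations below hold on the whole half-plane. *)
Variable X : nat -> C -> C.
Let H := fun w : C => Re w < 0.
Hypothesis X0 : forall w, H w -> cderiv (X O) w (- Cexp ((c - 1) * lam w))%C.
Hypothesis XS : forall j w, H w -> cderiv (X (S j)) w (dlam w * X j w)%C.

Let strip (x1 : R) := fun w : C => Re w <= x1 /\ 0 <= Im w <= 2 * PI.

Let strip_lerp x1 w v t : strip x1 w -> strip x1 v -> 0 <= t <= 1 -> strip x1 (lerp w v t).
Proof.
  unfold strip, lerp. destruct w as [w1 w2], v as [v1 v2]; simpl. intros [h1 h2] [k1 k2] Ht.
  split; [nra|]. split; [nra|]. nra.
Qed.

Let strip_dist x1 w : strip x1 w -> Cmod (w - (x1, 0)) <= (x1 - Re w) + 2 * PI.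
Proof.
  intros [h1 h2]. eapply Rle_trans; [apply Cmod_le_sum|].
  change (Re (w - (x1, 0))%C) with (Re w - x1). change (Im (w - (x1, 0))%C) with (Im w - 0).
  rewrite Rabs_left1, Rabs_right; lra.
Qed.

(** On one period strip each [X j] grows at most linearly, because its derivative is bounded: for
    [j = 0] as [lam] is bounded, and afterwards since the exponential decay of [dlam] absorbs the
    linear growth of the preceding component. *)
Let growth x1 : x1 <= -1 -> (forall w : C, Re w <= x1 -> Cmod (lam w) < 1) -> forall j, exists K, 0 <= K /\
  forall w, strip x1 w -> Cmod (X j w) <= K * (1 + Cmod (w - (x1, 0))).
Proof.
  intros Hx1 Hl. pose proof PI_RGT_0 as Hpi.
  assert (Hin : forall w, strip x1 w -> H w) by (intros w [h _]; unfold H; lra).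
  assert (S1 : strip x1 (x1, 0)) by (unfold strip; simpl; lra).
  assert (G : forall F f M, (forall w, strip x1 w -> cderiv F w (f w)) -> 0 <= M -> (forall w, strip x1 w -> Cmod (f w) <= M) ->
    exists K, 0 <= K /\ forall w, strip x1 w -> Cmod (F w) <= K * (1 + Cmod (w - (x1, 0)))).
  { intros F f M HF HM Hf. exists (Cmod (F (x1, 0)) + M). pose proof (Cmod_ge_0 (F (x1, 0))). split; [lra|]. intros w Hw.
    pose proof (mean_value_ineq F f (x1, 0) w M) as V.
    assert (Cmod (F w - F (x1, 0))%C <= M * Cmod (w - (x1, 0))).
    { apply V; intros t Ht; [apply HF|apply Hf]; apply strip_lerp; auto. }
    pose proof (Cmod_rev_tri (F w) (F (x1, 0))). pose proof (Cmod_ge_0 (w - (x1, 0))). nra. }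
  induction j as [|j [K [HK IH]]].
  - apply (G _ (fun w => - Cexp ((c - 1) * lam w))%C (exp (Cmod (c - 1)))).
    + intros w Hw. apply X0; auto.
    + left; apply exp_pos.
    + intros w Hw. rewrite Cmod_opp, Cmod_Cexp.
      assert (L : Re ((c - 1) * lam w)%C <= Cmod (c - 1)).
      { pose proof (re_le_Cmod ((c - 1) * lam w)%C) as B. apply Rabs_le_between in B. rewrite Cmod_mult in B.
        pose proof (Hl w (proj1 Hw)). pose proof (Cmod_ge_0 (c - 1)). nra. }
      apply exp_mono, L.
  - apply (G _ (fun w => dlam w * X j w)%C (2 * K * (1 + 2 * PI))).
    + intros w Hw. apply XS; auto.
    + apply Rmult_le_pos; lra.
    + intros w Hw. rewrite Cmod_mult.
      eapply Rle_trans; [apply Rmult_le_compat; [apply Cmod_ge_0|apply Cmod_ge_0|apply dlam_bound; destruct Hw; lra|apply IH; auto]|].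
      pose proof (strip_dist x1 w Hw) as D. set (u := x1 - Re w) in *. assert (Hu : 0 <= u) by (unfold u; destruct Hw; lra).
      assert (E : exp (Re w) <= exp (- u)).
      { assert (L : Re w <= - u) by (unfold u; lra). apply exp_mono, L. }
      pose proof (proj1 (exp_linear_bound u Hu)). pose proof (exp_pos (Re w)).
      assert (Q : exp (Re w) * (1 + Cmod (w - (x1, 0))) <= 1 + 2 * PI).
      { apply Rle_trans with (exp (- u) * ((1 + u) * (1 + 2 * PI))).
        - pose proof (Cmod_ge_0 (w - (x1, 0))). apply Rmult_le_compat; try lra. nra.
        - rewrite <- Rmult_assoc. nra. }
      replace (2 * exp (Re w) * (K * (1 + Cmod (w - (x1, 0))))) with (2 * K * (exp (Re w) * (1 + Cmod (w - (x1, 0))))) by ring.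
      apply Rmult_le_compat_l; lra.
Qed.

Let D j w : C := (X j (w + twopii) - X j w)%C.

Let H_shift w : H w -> H (w + twopii)%C.
Proof. unfold H, twopii, Re. simpl. intros. lra. Qed.

Let D_deriv j w f : H w -> (forall w, H w -> cderiv (X j) w (f w)) -> cderiv (D j) w (f (w + twopii)%C - f w)%C.
Proof.
  intros Hw Hf. unfold D. eapply cderiv_eq.
  - apply cderiv_minus; [apply cderiv_shift, Hf, H_shift|apply Hf]; auto.
  - reflexivity.
Qed.

Let D_bound j f x M : (forall w, H w -> cderiv (X j) w (f w)) -> x < 0 ->
  (forall w, Re w = x -> 0 <= Im w <= 2 * PI -> Cmod (f w) <= M) -> Cmod (D j (x, 0)) <= M * (2 * PI).
Proof.
  intros Hf Hx HM. unfold D. rewrite <- Cmod_2pi. replace twopii with ((x, 0) + twopii - (x, 0))%C at 2 by ring.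
  apply (mean_value_ineq (X j) f); intros t Ht; destruct (Re_lerp_2pi (x, 0) t) as [e1 e2]; change (Re (x, 0)) with x in e1; change (Im (x, 0)) with 0 in e2.
  - apply Hf. unfold H. rewrite e1. auto.
  - apply HM; auto. rewrite e2. pose proof PI_RGT_0. nra.
Qed.

(** The increments over one period satisfy the same recursion as [(log z)^j / j!]; only the
    constants of integration remain, and they are found far to the left. The constant [- twopii]
    arises at [j = 0], where the derivative of [X 0] tends to -1 and the segment has length
    [2 pi]. *)
Lemma monodromy_at_1 j w : H w ->
  X j (w + twopii)%C = (X j w + - twopii * (/ RtoC (INR (fact j)) * Cpow (lam w) j))%C.
Proof.
  intros Hw.
  enough (Z : forall w, H w -> (D j w + twopii * (/ RtoC (INR (fact j)) * Cpow (lam w) j))%C = 0%C).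
  { specialize (Z w Hw). unfold D in Z.
    replace (X j (w + twopii)%C) with ((X j (w + twopii) - X j w + twopii * (/ RtoC (INR (fact j)) * Cpow (lam w) j)) + (X j w + - twopii * (/ RtoC (INR (fact j)) * Cpow (lam w) j)))%C by ring.
    rewrite Z. ring. }
  clear w Hw. pose proof PI_RGT_0 as Hpi. induction j as [|j IH]; intros w Hw.
  - simpl Cpow. change (INR (fact 0)) with 1. replace (twopii * (/ 1 * 1))%C with twopii by field.
    apply Cmod_le_eps. intros e He.
    assert (cst : forall v, H v -> D 0 w = D 0 v).
    { intros v Hv. apply (deriv0_const H); auto; [apply halfplane_convex|]. intros u Hu.
      eapply cderiv_eq; [apply (D_deriv 0 u _ Hu X0)|]. cbv beta. rewrite lam_per. ring. }
    assert (C0 : ccont (fun z => Cexp ((c - 1) * z) - 1)%C 0%C).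
    { apply ccont_plus; [|apply ccont_const]. apply (ccont_comp (fun z => (c - 1) * z)%C Cexp).
      - apply ccont_mult; [apply ccont_const|apply ccont_id].
      - eapply cderiv_ccont, cderiv_Cexp. }
    destruct (C0 (e / (2 * PI))) as [d [Hd K]]; [apply Rdiv_lt_0_compat; lra|].
    destruct (lam_small d Hd) as [x [Hx Hl]].
    rewrite (cst (x, 0)) by (unfold H; simpl; lra).
    assert (E : (D 0 (x, 0) + twopii)%C = ((X O ((x, 0) + twopii) + ((x, 0) + twopii)) - (X O (x, 0) + (x, 0)))%C) by (unfold D; ring).
    rewrite E. replace e with (e / (2 * PI) * Cmod ((x, 0) + twopii - (x, 0))).
    2:{ replace ((x, 0) + twopii - (x, 0))%C with twopii by ring. rewrite Cmod_2pi. field. lra. }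
    apply (mean_value_ineq (fun w => X O w + w)%C (fun w => - Cexp ((c - 1) * lam w) + 1)%C); intros t Ht;
      destruct (Re_lerp_2pi (x, 0) t) as [e1 e2]; change (Re (x, 0)) with x in e1; change (Im (x, 0)) with 0 in e2.
    + apply cderiv_plus; [apply X0; unfold H; rewrite e1; lra|apply cderiv_id].
    + set (v := lerp _ _ _) in *. specialize (K (lam v)). replace (lam v - 0)%C with (lam v) in K by ring.
      specialize (K (Hl v ltac:(rewrite e1; lra))). left. eapply Rle_lt_trans; [|exact K]. right.
      rewrite <- Cmod_opp. f_equal. rewrite Cmult_0_r, Cexp_0. ring.
  (* By the induction hypothesis [P] is constant. Both of its terms tend to zero as [Re w] tends to
     minus infinity: the increment because [dlam] decays faster than [X j] grows, the power because
     [lam] does. *)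
  - set (P := fun w => (D (S j) w + twopii * (/ RtoC (INR (fact (S j))) * Cpow (lam w) (S j)))%C).
    assert (cst : forall v, H v -> P w = P v).
    { intros v Hv. apply (deriv0_const H); auto; [apply halfplane_convex|]. intros u Hu. unfold P. eapply cderiv_eq.
      - apply cderiv_plus; [apply (D_deriv (S j) u _ Hu (XS j))|apply cderiv_scal, cderiv_divpow, cderiv_lam; auto].
      - cbv beta. rewrite dlam_per. transitivity (dlam u * (D j u + twopii * (/ RtoC (INR (fact j)) * Cpow (lam u) j)))%C; [unfold D; ring|].
        rewrite IH by auto. ring. }
    apply Cmod_le_eps. intros e He. change (Cmod (P w) <= e).
    destruct (lam_small 1 Rlt_0_1) as [x1 [Hx1 Hl1]].
    destruct (growth x1 Hx1 Hl1 j) as [K [HK HG]].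
    destruct (lam_small (Rmin 1 (e / (4 * PI)))) as [x2 [Hx2 Hl2]].
    { apply Rmin_pos; [lra|apply Rdiv_lt_0_compat; lra]. }
    (* Chosen so that [8 pi K (1 + 2 pi) / (1 + u/2) <= e/2] for [u >= u0]. *)
    set (u0 := 32 * PI * K * (1 + 2 * PI) / e).
    assert (Hu0 : 0 <= u0). { unfold u0. apply Rmult_le_pos; [|left; apply Rinv_0_lt_compat; auto]. assert (0 <= PI * K) by (apply Rmult_le_pos; lra). replace (32 * PI * K * (1 + 2 * PI)) with (32 * (PI * K) * (1 + 2 * PI)) by ring. apply Rmult_le_pos; lra. }
    set (x := Rmin x2 (x1 - u0)). assert (xa : x <= x2) by apply Rmin_l. assert (xb : x <= x1 - u0) by apply Rmin_r.
    rewrite (cst (x, 0)) by (unfold H; simpl; lra). unfold P.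
    set (u := x1 - x). assert (Hu : u0 <= u) by (unfold u; lra).
    assert (B1 : Cmod (D (S j) (x, 0)) <= (2 * K * (1 + 2 * PI) * (2 / (1 + u / 2))) * (2 * PI)).
    { apply (D_bound (S j) _ x _ (XS j)); [lra|]. intros v Hv1 Hv2.
      assert (Sv : strip x1 v) by (unfold strip; rewrite Hv1; lra).
      rewrite Cmod_mult.
      eapply Rle_trans; [apply Rmult_le_compat; [apply Cmod_ge_0|apply Cmod_ge_0|apply dlam_bound; lra|apply HG; auto]|].
      pose proof (strip_dist x1 v Sv) as Dv. rewrite Hv1 in *. fold u in Dv.
      assert (E : exp x <= exp (- u)).
      { assert (L : x <= - u) by (unfold u; lra). apply exp_mono, L. }
      pose proof (proj2 (exp_linear_bound u ltac:(lra))) as Q. pose proof (exp_pos x). pose proof (Cmod_ge_0 (v - (x1, 0))).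
      assert (Q2 : exp (- u) * (1 + u) <= 2 / (1 + u / 2)).
      { apply Rmult_le_reg_r with (1 + u / 2); [lra|]. replace (2 / (1 + u / 2) * (1 + u / 2)) with 2 by (field; lra). lra. }
      assert (Q1 : exp x * (1 + Cmod (v - (x1, 0))) <= (1 + 2 * PI) * (2 / (1 + u / 2))).
      { apply Rle_trans with (exp (- u) * ((1 + u) * (1 + 2 * PI))).
        - apply Rmult_le_compat; try lra. nra.
        - rewrite <- Rmult_assoc, Rmult_comm. apply Rmult_le_compat_l; lra. }
      replace (2 * exp x * (K * (1 + Cmod (v - (x1, 0))))) with (2 * K * (exp x * (1 + Cmod (v - (x1, 0))))) by ring.
      rewrite (Rmult_assoc (2 * K)). apply Rmult_le_compat_l; lra. }
    assert (B1' : (2 * K * (1 + 2 * PI) * (2 / (1 + u / 2))) * (2 * PI) <= e / 2).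
    { apply Rmult_le_reg_r with (1 + u / 2); [lra|].
      replace (2 * K * (1 + 2 * PI) * (2 / (1 + u / 2)) * (2 * PI) * (1 + u / 2)) with (8 * PI * K * (1 + 2 * PI)) by (field; lra).
      assert (u0 * e = 32 * PI * K * (1 + 2 * PI)) by (unfold u0; field; lra). nra. }
    assert (B2 : Cmod (twopii * (/ RtoC (INR (fact (S j))) * Cpow (lam (x, 0)) (S j))) <= e / 2).
    { specialize (Hl2 (x, 0) xa). set (l := Cmod (lam (x, 0))) in *.
      pose proof (Rmin_l 1 (e / (4 * PI))). pose proof (Rmin_r 1 (e / (4 * PI))).
      assert (F : 1 <= INR (fact (S j))) by (apply (le_INR 1), lt_O_fact).
      assert (fn : RtoC (INR (fact (S j))) <> 0%C) by (apply RtoC_INR_neq0, lt_O_fact).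
      rewrite !Cmod_mult, Cmod_2pi, Cmod_inv, Cmod_R, Rabs_right, Cmod_pow by (auto; lra). fold l.
      assert (L0 : 0 <= l) by apply Cmod_ge_0.
      assert (pw : l ^ S j <= l). { simpl. pose proof (pow_incr l 1 j ltac:(lra)). rewrite pow1 in H2. pose proof (pow_le l j L0). nra. }
      assert (iv : 0 < / INR (fact (S j)) <= 1). { split; [apply Rinv_0_lt_compat; lra|]. rewrite <- Rinv_1. apply Rinv_le_contravar; lra. }
      pose proof (pow_le l (S j) L0).
      apply Rle_trans with (2 * PI * (e / (4 * PI))); [|right; field; lra]. apply Rmult_le_compat_l; [lra|]. nra. }
    eapply Rle_trans; [apply Cmod_triangle|]. lra.
Qed.

(* [ell] is any branch of [log (1 - z)]; the solution only depends on it
   through its value. *)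
Definition sol1 (ell : C -> C) (k : nat) (z : C) : C :=
  match k with O => RtoC 1 | S j => (Cexp ((1 - c) * Clog z) * X j (ell z))%C end.

Lemma sol1_sol ell U : (forall z, U z -> punctured z /\ Re (ell z) < 0 /\ Cexp (ell z) = (1 - z)%C /\
   cderiv ell z (- / (1 - z))%C) -> sol c U (sol1 ell).
Proof.
  intros HU z Hz. destruct (HU z Hz) as [Hp [Hr [He Hd]]].
  assert (Ez : (1 - Cexp (ell z))%C = z) by (rewrite He; ring).
  assert (Sz : slit z). { left. rewrite <- Ez. apply one_minus_exp_Re; auto. }
  assert (Lz : lam (ell z) = Clog z) by (unfold lam; rewrite Ez; auto).
  assert (n1 : (1 - z)%C <> 0%C) by (apply one_minus_neq0, Hp).
  split; [auto|]. split; [apply cderiv_const|]. intros k. simpl sol1.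
  assert (DE := cderiv_exp_scal Clog (1 - c) z _ (cderiv_Clog z Sz)).
  destruct k as [|j].
  - eapply cderiv_eq; [apply cderiv_mult; [exact DE|apply (cderiv_comp ell (X O)); [exact Hd|apply X0; auto]]|].
    cbv beta. rewrite Lz. simpl bcoef.
    replace ((c - 1) * Clog z)%C with (- ((1 - c) * Clog z))%C by ring. rewrite Cexp_opp.
    pose proof (Cexp_neq0 ((1 - c) * Clog z)). unfold sol1. field. repeat split; auto. apply Hp.
  - eapply cderiv_eq; [apply cderiv_mult; [exact DE|apply (cderiv_comp ell (X (S j))); [exact Hd|apply XS; auto]]|].
    cbv beta. unfold dlam. rewrite Ez, He. simpl. field. split; auto. apply Hp.
Qed.

End Monodromy1.

(** * Transport along the two loops *)

Lemma open_preimage (f : C -> C) V : (forall z, ccont f z) -> copen V -> copen (fun z => V (f z)).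
Proof.
  intros Hf HV z Hz. destruct (HV _ Hz) as [r [Hr K]]. destruct (Hf z r Hr) as [d [Hd K']].
  exists d. split; auto.
Qed.

Lemma ccont_affine a b z : ccont (fun z => a + b * z)%C z.
Proof. apply ccont_plus; [apply ccont_const|]. apply ccont_mult; [apply ccont_const|apply ccont_id]. Qed.

Lemma slit_affine_open a b : copen (fun z => slit (a + b * z)%C).
Proof. apply (open_preimage _ slit); [apply ccont_affine|apply slit_open]. Qed.

Lemma cderiv_Clog_affine a b k z : slit (a + b * z)%C ->
  cderiv (fun z => Clog (a + b * z) + k)%C z (b / (a + b * z))%C.
Proof.
  intros H. eapply cderiv_eq.
  - apply cderiv_plus; [|apply cderiv_const].
    apply (cderiv_comp (fun z => a + b * z)%C Clog); [|apply cderiv_Clog; auto].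
    apply cderiv_plus; [apply cderiv_const|apply cderiv_scal, cderiv_id].
  - field. apply slit_neq0; auto.
Qed.

Lemma bsol_ext c i ell ell' k z : ell z = ell' z -> bsol c i ell k z = bsol c i ell' k z.
Proof. intros E. unfold bsol. rewrite E. auto. Qed.

Lemma lift_eq c g a b x y x' y' : lift c g a b x y -> (forall k, x k = x' k) -> (forall k, y k = y' k) -> lift c g a b x' y'.
Proof.
  intros H h1 h2. apply functional_extensionality in h1. apply functional_extensionality in h2. subst. auto.
Qed.

Definition half_i_pi : C := (0, PI / 2).
Definition i_pi : C := (0, PI).

Lemma Cexp_half : Cexp half_i_pi = Ci.
Proof. unfold Cexp, half_i_pi; simpl. rewrite exp_0, cos_PI2, sin_PI2. apply C_eq; simpl; ring. Qed.

(* The branches of the logarithm cut along the negative imaginary axis, resp.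
   along the positive real axis; both equal [i pi] at [-1]. *)
Definition log_up (z : C) : C := (Clog (0 + - Ci * z) + half_i_pi)%C.
Definition log_left (z : C) : C := (Clog (0 + -(1) * z) + i_pi)%C.
Definition up_slit (z : C) : Prop := slit (0 + - Ci * z)%C.

Lemma cderiv_log_up z : up_slit z -> cderiv log_up z (/ z)%C.
Proof.
  intros H. eapply cderiv_eq; [apply cderiv_Clog_affine; exact H|].
  assert (z <> 0%C). { intros ->. apply slit_neq0 in H. apply H. ring. }
  field. split; auto. apply Ci_nz.
Qed.

Lemma Cexp_log_up z : up_slit z -> Cexp (log_up z) = z.
Proof.
  intros H. unfold log_up. rewrite Cexp_plus, Cexp_half, Cexp_Clog by (apply slit_neq0; exact H).
  transitivity (- (Ci * Ci) * z)%C; [ring|]. replace (Ci * Ci)%C with (-(1))%C by (apply C_eq; simpl; ring). ring.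
Qed.

Lemma log_up_Im z : up_slit z -> - PI / 2 < Im (log_up z) < 3 * PI / 2.
Proof.
  intros H. pose proof (slit_Clog _ H) as B. unfold log_up.
  change (Im (Clog (0 + - Ci * z) + half_i_pi)%C) with (Im (Clog (0 + - Ci * z)) + PI / 2). lra.
Qed.

Lemma log_up_upper z : 0 < Im z -> log_up z = Clog z.
Proof.
  intros H. assert (U : up_slit z). { left. destruct z; simpl in *. lra. }
  assert (Hz : z <> 0%C). { intros ->. simpl in H. lra. }
  apply Cexp_inj; [rewrite Cexp_log_up, Cexp_Clog; auto|].
  pose proof (log_up_Im z U). pose proof (proj1 (Im_Clog_sign z Hz) H). pose proof PI_RGT_0.
  apply Rabs_lt_between. lra.
Qed.

Lemma log_up_half : log_up (RtoC (/2)) = Clog (RtoC (/2)).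
Proof.
  assert (U : up_slit (RtoC (/2))). { right. simpl. lra. }
  assert (Hz : RtoC (/2) <> 0%C) by (intros E; apply RtoC_inj in E; lra).
  apply Cexp_inj; [rewrite Cexp_log_up, Cexp_Clog; auto|].
  pose proof (log_up_Im _ U). rewrite Clog_pos by lra. change (Im (RtoC (ln (/2)))) with 0.
  pose proof PI_RGT_0. apply Rabs_lt_between. lra.
Qed.

Lemma log_left_spec z : slit (0 + -(1) * z)%C -> Cexp (log_left z) = z /\ 0 < Im (log_left z) < 2 * PI /\ cderiv log_left z (/ z)%C.
Proof.
  intros H. unfold log_left. split; [|split].
  - rewrite Cexp_plus, Cexp_Clog by (apply slit_neq0; auto). unfold i_pi. rewrite Cexp_ipi. unfold m1. rewrite RtoC_m1. ring.
  - pose proof (slit_Clog _ H) as B.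
    change (Im (Clog (0 + - (1) * z) + i_pi)%C) with (Im (Clog (0 + - (1) * z)) + PI). lra.
  - eapply cderiv_eq; [apply cderiv_Clog_affine; exact H|].
    assert (z <> 0%C). { intros ->. apply slit_neq0 in H. apply H. ring. }
    field. auto.
Qed.

Lemma log_up_m1 : log_up m1 = log_left m1.
Proof.
  assert (U : up_slit m1). { right. simpl. lra. }
  assert (V : slit (0 + -(1) * m1)%C). { left. simpl. lra. }
  destruct (log_left_spec _ V) as [e [_ _]].
  apply Cexp_inj; [rewrite Cexp_log_up; auto|].
  replace (log_left m1) with i_pi.
  - pose proof (log_up_Im _ U). change (Im i_pi) with PI. pose proof PI_RGT_0. apply Rabs_lt_between. lra.
  - unfold log_left. replace (0 + -(1) * m1)%C with (RtoC 1) by (apply C_eq; simpl; ring). rewrite Clog_1. ring.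
Qed.

(** In the upper half-plane the principal branch is [log_left]; in the lower one it becomes so after
    adding [twopii]. These two relations glue the branches at the junctions of the arcs of both
    loops. *)
Lemma Clog_opp_upper z : 0 < Im z -> Clog z = (Clog (- z) + i_pi)%C.
Proof.
  intros H. assert (n : z <> 0%C) by (intros ->; simpl in H; lra).
  assert (n' : (- z)%C <> 0%C) by (intros E; apply n; replace z with (- - z)%C by ring; rewrite E; ring).
  apply Cexp_inj.
  - unfold i_pi. rewrite Cexp_plus, Cexp_ipi, !Cexp_Clog by auto. unfold m1. rewrite RtoC_m1. ring.
  - pose proof (proj1 (Im_Clog_sign z n) H).
    pose proof (proj1 (proj2 (Im_Clog_sign _ n')) ltac:(change (- Im z < 0); lra)).
    change (Im (Clog (- z) + i_pi)%C) with (Im (Clog (- z)%C) + PI). apply Rabs_lt_between. lra.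
Qed.

Lemma Clog_opp_lower z : Im z < 0 -> (Clog z + twopii)%C = (Clog (- z) + i_pi)%C.
Proof.
  intros H. rewrite (Clog_opp_upper (- z)) by (change (0 < - Im z); lra).
  replace (- - z)%C with z by ring.
  replace twopii with (i_pi + i_pi)%C by (apply C_eq; simpl; ring). ring.
Qed.

Section Loops.
Variable c : C.
Hypothesis Hc : forall k : nat, c <> RtoC (- INR k).

Definition big_circle (z : C) : Prop := exists C S, C * C + S * S = 1 /\ z = (-/4 + 3/4 * C, 3/4 * S).

Definition li_dom (z : C) : Prop := disk m1 1 z \/ (Cmod z < 1 /\ z <> 0%C).

Lemma li_dom_open : copen li_dom.
Proof.
  intros z [h|[h1 h2]].
  - destruct (disk_open m1 1 z h) as [r [Hr K]]. exists r. split; auto. intros; left; auto.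
  - apply Cmod_gt_0 in h2. exists (Rmin (Cmod z) (1 - Cmod z)). split; [apply Rmin_pos; lra|]. intros w Hw.
    destruct (disk_Rmin _ _ _ _ Hw). unfold disk in *.
    pose proof (Cmod_rev_tri w z). pose proof (Cmod_rev_tri z w). rewrite (Cmod_sym z w) in *.
    right. split; [lra|]. apply Cmod_gt_0. lra.
Qed.

(** Here [|z|^2 = (10 - 6 C) / 16]: the circle touches the unit circle from inside at -1 only, and
    avoids 0. *)
Lemma big_circle_li_dom z : big_circle z -> li_dom z.
Proof.
  intros [C [S [E ->]]].
  assert (M : Cmod (-/4 + 3/4 * C, 3/4 * S) ^ 2 = 10/16 - 6/16 * C).
  { rewrite Cmod2_alt. simpl. nra. }
  pose proof (Cmod_ge_0 (-/4 + 3/4 * C, 3/4 * S)) as P.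
  destruct (Req_dec C (-1)) as [->|n].
  - left. assert (S = 0) by nra. subst S.
    replace ((-/4 + 3/4 * -1, 3/4 * 0) : C) with m1 by (apply C_eq; simpl; field). apply disk_center. lra.
  - right. assert (-1 < C). { assert (-1 <= C) by nra. lra. } assert (C <= 1) by nra. split; [nra|].
    apply Cmod_gt_0. destruct P as [P|P]; auto. rewrite <- P in M. lra.
Qed.

Lemma m1_disk_punctured z : disk m1 1 z -> punctured z.
Proof.
  unfold disk, m1. intros H. split; intros ->.
  - replace (0 - RtoC (-1))%C with (RtoC 1) in H by (rewrite RtoC_m1; ring). rewrite Cmod_1 in H. lra.
  - replace (1 - RtoC (-1))%C with (RtoC 2) in H by (apply C_eq; simpl; ring). rewrite Cmod_R, Rabs_right in H; lra.
Qed.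

(** A solution on the disk of radius 1 about -1 is normalised at -1/2 to agree with the series; the
    overlap with the unit disk is convex and omits 0, so they agree on all of it. The glued solution
    is one-valued on a domain that winds around 0, which is why [Li] does not change along the first
    loop. *)
Lemma li_global : exists Y, sol c li_dom Y /\ forall k z, Cmod z < 1 -> Y k z = LiS c Hc k z.
Proof.
  destruct (sol_exists c (disk m1 1) (RtoC (-/2)) (fun k => LiS c Hc k (RtoC (-/2)))) as [Y [HY HE]].
  { apply disk_open. } { apply disk_convex. } { apply m1_disk_punctured. }
  set (V := fun z => disk m1 1 z /\ disk 0%C 1 z).
  assert (V0 : forall z, disk 0%C 1 z <-> Cmod z < 1).
  { intros z. unfold disk. replace (z - 0)%C with z by ring. tauto. }
  assert (agree : forall k z, V z -> Y k z = LiS c Hc k z).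
  { apply (sol_unique c V Y _ (RtoC (-/2))).
    - apply inter_open; apply disk_open.
    - apply inter_convex; apply disk_convex.
    - eapply sol_mono; [|apply HY]. unfold V; tauto.
    - eapply sol_mono; [|apply LiS_sol]. intros z [h1 h2]. split; [apply V0; auto|]. apply m1_disk_punctured; auto.
    - split; [|apply V0; rewrite Cmod_R, Rabs_left; lra].
      unfold disk, m1. rewrite <- RtoC_minus, Cmod_R, Rabs_right; lra.
    - auto. }
  exists (fun k z => if Rlt_dec (Cmod z) 1 then LiS c Hc k z else Y k z). split.
  2:{ intros k z Hz. destruct Rlt_dec; [auto|lra]. }
  intros z Hz.
  assert (loc : exists (Z : nat -> C -> C) (r : R), 0 < r /\ sol c (disk z r) Z /\
     forall k w, Cmod (w - z) < r -> Z k w = if Rlt_dec (Cmod w) 1 then LiS c Hc k w else Y k w).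
  { destruct (Rlt_dec (Cmod z) 1) as [h|h].
    - assert (n0 : z <> 0%C). { destruct Hz as [Hz|Hz]; [apply m1_disk_punctured in Hz; apply Hz|apply Hz]. }
      apply Cmod_gt_0 in n0.
      exists (LiS c Hc), (Rmin (Cmod z) (1 - Cmod z)). split; [apply Rmin_pos; lra|].
      assert (B : forall w, Cmod (w - z) < Rmin (Cmod z) (1 - Cmod z) -> Cmod w < 1 /\ w <> 0%C).
      { intros w Hw. destruct (disk_Rmin _ _ _ _ Hw). unfold disk in *.
        pose proof (Cmod_rev_tri w z). pose proof (Cmod_rev_tri z w). rewrite (Cmod_sym z w) in *.
        split; [lra|]. apply Cmod_gt_0. lra. }
      split; [eapply sol_mono; [|apply LiS_sol]; intros w Hw; apply B, Hw|].
      intros k w Hw. destruct Rlt_dec; auto. exfalso. apply n. apply B; auto.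
    - assert (D : disk m1 1 z) by (destruct Hz as [Hz|Hz]; [auto|lra]).
      destruct (disk_open _ _ _ D) as [r [Hr K]]. exists Y, r. split; auto. split.
      + eapply sol_mono; [|apply HY]. intros w Hw. apply K, Hw.
      + intros k w Hw. destruct Rlt_dec; auto. apply agree. split; [apply K; auto|apply V0; auto]. }
  destruct loc as [Z [r [Hr [HZ E]]]]. destruct (HZ z (disk_center z r Hr)) as [Hp [h0 hk]].
  assert (E' : forall k, Z k z = if Rlt_dec (Cmod z) 1 then LiS c Hc k z else Y k z).
  { intros k. apply E. rewrite Cmod_self. auto. }
  split; [auto|]. split.
  - apply (cderiv_local (Z O) _ _ _ r Hr); auto.
  - intros k. rewrite <- !E'. apply (cderiv_local (Z (S k)) _ _ _ r Hr); auto.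
Qed.

Definition LiG : nat -> C -> C := proj1_sig (constructive_indefinite_description _ li_global).

Lemma LiG_spec : sol c li_dom LiG /\ forall k z, Cmod z < 1 -> LiG k z = LiS c Hc k z.
Proof. unfold LiG. destruct constructive_indefinite_description. auto. Qed.

Lemma loopZ0_circle t : big_circle (loopZ0 t).
Proof.
  exists (- cos (2 * PI * t)), (- sin (2 * PI * t)). split.
  - pose proof (sin2_cos2 (2 * PI * t)) as E. unfold Rsqr in E. lra.
  - unfold loopZ0. f_equal; ring.
Qed.

Lemma loopZ0_ends : loopZ0 0 = m1 /\ loopZ0 1 = m1.
Proof.
  unfold loopZ0, m1. rewrite Rmult_0_r, cos_0, sin_0, (Rmult_1_r (2 * PI)), cos_2PI, sin_2PI.
  split; apply C_eq; simpl; field.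
Qed.

Lemma lift_Z0_li : pathc loopZ0 0 1 -> lift c loopZ0 0 1 (fun k => LiG k m1) (fun k => LiG k m1).
Proof.
  intros Hp. destruct loopZ0_ends as [e0 e1].
  pose proof (lift_sol c loopZ0 0 1 li_dom LiG ltac:(lra) Hp (proj1 LiG_spec) li_dom_open) as L.
  rewrite e0, e1 in L. apply L. intros t _. apply big_circle_li_dom, loopZ0_circle.
Qed.

Lemma lift_bsol g a b i ell U : (0 < i)%nat -> a <= b -> pathc g a b -> copen U ->
  (forall z, U z -> cderiv ell z (/ z)%C) -> (forall t, a <= t <= b -> U (g t) /\ punctured (g t)) ->
  lift c g a b (fun k => bsol c i ell k (g a)) (fun k => bsol c i ell k (g b)).
Proof.
  intros Hi Hab Hp HO HU Hg.
  apply (lift_sol c g a b (fun z => U z /\ punctured z)); auto.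
  - apply bsol_sol; auto. intros z [h1 h2]. auto.
  - apply inter_open; auto. intros z Hz. exists (rad z). split; [apply rad_pos; auto|]. intros w Hw. apply (rad_disk z), Hw.
Qed.

Lemma li_dom_punctured z : li_dom z -> punctured z.
Proof.
  intros H. apply (proj1 LiG_spec z H).
Qed.

Lemma loopZ0_coord t : Re (loopZ0 t) = -/4 - 3/4 * cos (2 * PI * t) /\ Im (loopZ0 t) = - (3/4) * sin (2 * PI * t).
Proof. auto. Qed.

Lemma lift_Z0_b i : (0 < i)%nat -> pathc loopZ0 0 1 ->
  lift c loopZ0 0 1 (fun k => bsol c i log_up k m1) (fun k => bsol c i (fun z => log_up z + twopii)%C k m1).
Proof.
  intros Hi Hp. destruct loopZ0_ends as [e0 e1]. pose proof PI_RGT_0 as Hpi.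
  assert (Hpt : forall t, punctured (loopZ0 t)) by (intros; apply li_dom_punctured, big_circle_li_dom, loopZ0_circle).
  (* The loop starts downwards from -1. The branch cut along the positive axis serves on the two
     left quarters, the principal one shifted by [twopii] on the right half; they meet at the lowest
     and the highest point. *)
  set (l1 := log_left). set (l2 := fun z => (Clog z + twopii)%C). set (l3 := fun z => (log_left z + twopii)%C).
  assert (D2 : forall z, slit z -> cderiv l2 z (/ z)%C).
  { intros z Hz. eapply cderiv_eq; [apply cderiv_plus; [apply cderiv_Clog; auto|apply cderiv_const]|ring]. }
  assert (D3 : forall z, slit (0 + -(1) * z)%C -> cderiv l3 z (/ z)%C).
  { intros z Hz. eapply cderiv_eq; [apply cderiv_plus; [apply log_left_spec; auto|apply cderiv_const]|ring]. }
  assert (Sl : forall t, 0 <= cos (2 * PI * t) -> slit (0 + -(1) * loopZ0 t)%C).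
  { intros t Ht. left. destruct (loopZ0_coord t) as [h1 h2].
    replace (Re (0 + -(1) * loopZ0 t)%C) with (- Re (loopZ0 t)) by (unfold Re; simpl; ring). rewrite h1. lra. }
  assert (Sm : forall t, cos (2 * PI * t) <= 0 -> slit (loopZ0 t)).
  { intros t Ht. destruct (loopZ0_coord t) as [h1 h2]. destruct (Req_dec (sin (2 * PI * t)) 0) as [e|e].
    - left. rewrite h1. pose proof (sin2_cos2 (2 * PI * t)) as E. unfold Rsqr in E. rewrite e in E. nra.
    - right. rewrite h2. lra. }
  assert (q1 : Im (loopZ0 (/4)) < 0).
  { rewrite (proj2 (loopZ0_coord _)). replace (2 * PI * /4) with (PI / 2) by field. rewrite sin_PI2. lra. }
  assert (q3 : 0 < Im (loopZ0 (3/4))).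
  { rewrite (proj2 (loopZ0_coord _)). replace (2 * PI * (3/4)) with (3 * (PI / 2)) by field. rewrite sin_3PI2. lra. }
  assert (c1 : cos (2 * PI * /4) = 0) by (replace (2 * PI * /4) with (PI / 2) by field; apply cos_PI2).
  assert (c3 : cos (2 * PI * (3/4)) = 0) by (replace (2 * PI * (3/4)) with (3 * (PI / 2)) by field; apply cos_3PI2).
  assert (E12 : l1 (loopZ0 (/4)) = l2 (loopZ0 (/4))).
  { unfold l1, l2, log_left. rewrite Clog_opp_lower by auto. do 2 f_equal. ring. }
  assert (E23 : l2 (loopZ0 (3/4)) = l3 (loopZ0 (3/4))).
  { unfold l2, l3, log_left. rewrite Clog_opp_upper by auto. do 3 f_equal. ring. }
  assert (L1 : lift c loopZ0 0 (/4) (fun k => bsol c i l1 k (loopZ0 0)) (fun k => bsol c i l1 k (loopZ0 (/4)))).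
  { apply (lift_bsol loopZ0 0 (/4) i l1 (fun z => slit (0 + -(1) * z)%C)); auto; try lra.
    - apply (pathc_sub _ 0 1); auto; lra.
    - apply slit_affine_open.
    - intros z Hz. apply log_left_spec; auto.
    - intros t Ht. split; auto. apply Sl. apply cos_ge_0; nra. }
  assert (L2 : lift c loopZ0 (/4) (3/4) (fun k => bsol c i l2 k (loopZ0 (/4))) (fun k => bsol c i l2 k (loopZ0 (3/4)))).
  { apply (lift_bsol loopZ0 (/4) (3/4) i l2 slit); auto; try lra.
    - apply (pathc_sub _ 0 1); auto; lra.
    - apply slit_open.
    - intros t Ht. split; auto. apply Sm. apply cos_le_0; nra. }
  assert (L3 : lift c loopZ0 (3/4) 1 (fun k => bsol c i l3 k (loopZ0 (3/4))) (fun k => bsol c i l3 k (loopZ0 1))).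
  { apply (lift_bsol loopZ0 (3/4) 1 i l3 (fun z => slit (0 + -(1) * z)%C)); auto; try lra.
    - apply (pathc_sub _ 0 1); auto; lra.
    - apply slit_affine_open.
    - intros t Ht. split; auto. apply Sl. apply cos_ge_0_3PI2; nra. }
  rewrite e0 in L1. rewrite e1 in L3.
  assert (L23 : lift c loopZ0 (/4) 1 (fun k => bsol c i l2 k (loopZ0 (/4))) (fun k => bsol c i l3 k m1)).
  { apply (lift_concat c loopZ0 (/4) (3/4) 1 _ (fun k => bsol c i l2 k (loopZ0 (3/4)))); auto; [lra|apply (pathc_sub _ 0 1); auto; lra|].
    eapply lift_eq; [exact L3| |reflexivity]. intros k. apply bsol_ext. symmetry. exact E23. }
  apply (lift_concat c loopZ0 0 (/4) 1 _ (fun k => bsol c i l2 k (loopZ0 (/4)))); auto; [lra| |].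
  - eapply lift_eq; [exact L1| |]; intros k; apply bsol_ext; [symmetry; exact log_up_m1|exact E12].
  - eapply lift_eq; [exact L23|reflexivity|]. intros k. apply bsol_ext. unfold l3. rewrite log_up_m1. auto.
Qed.

Lemma loopZ1_a t : t <= /3 -> loopZ1 t = (-/4 + 3/4 * cos (PI * (1 - 3 * t)), 3/4 * sin (PI * (1 - 3 * t))).
Proof. intros H. unfold loopZ1. destruct Rle_dec; [auto|lra]. Qed.

(** A continuous logarithm of [1 - z] along the small circle: the radius fixes the real part, and
    the imaginary part grows from 0 to [2 pi]. *)
Definition log_path (t : R) : C := (ln (/2), 2 * PI * (3 * t - 1)).

Lemma loopZ1_b t : /3 <= t <= 2/3 -> loopZ1 t = (1 - Cexp (log_path t))%C.
Proof.
  intros H. unfold loopZ1, Cexp, log_path. simpl Re; simpl Im. rewrite exp_ln by lra.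
  destruct Rle_dec as [h|h].
  - assert (t = /3) by lra. subst t. replace (1 - 3 * /3) with 0 by field. replace (3 * /3 - 1) with 0 by field.
    rewrite !Rmult_0_r, cos_0, sin_0. apply C_eq; simpl; field.
  - destruct Rle_dec; [|lra]. rewrite (Rplus_comm PI), neg_cos, neg_sin. apply C_eq; simpl; ring.
Qed.

Lemma loopZ1_c t : 2/3 <= t -> loopZ1 t = (-/4 + 3/4 * cos (PI * (3 * t - 2)), 3/4 * sin (PI * (3 * t - 2))).
Proof.
  intros H. destruct (Req_dec t (2/3)) as [->|n].
  - rewrite loopZ1_b by lra. replace (3 * (2/3) - 2) with 0 by field.
    unfold Cexp, log_path; simpl Re; simpl Im. replace (3 * (2/3) - 1) with 1 by field. rewrite exp_ln, !Rmult_0_r, cos_0, sin_0, Rmult_1_r, cos_2PI, sin_2PI by lra.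
    apply C_eq; simpl; field.
  - unfold loopZ1. destruct Rle_dec; [lra|]. destruct Rle_dec; [lra|auto].
Qed.

Lemma loopZ1_pts : loopZ1 0 = m1 /\ loopZ1 (/3) = RtoC (/2) /\ loopZ1 (2/3) = RtoC (/2) /\ loopZ1 1 = m1.
Proof.
  rewrite !loopZ1_a, !loopZ1_c by lra.
  replace (1 - 3 * 0) with 1 by ring. replace (1 - 3 * /3) with 0 by field.
  replace (3 * (2/3) - 2) with 0 by field. replace (3 * 1 - 2) with 1 by ring.
  rewrite Rmult_0_r, Rmult_1_r, cos_0, sin_0, cos_PI, sin_PI.
  unfold m1; repeat split; apply C_eq; simpl; field.
Qed.

Lemma upper_arc a : 0 <= a <= PI -> let z := (-/4 + 3/4 * cos a, 3/4 * sin a) in li_dom z /\ up_slit z.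
Proof.
  intros Ha z. pose proof (sin2_cos2 a) as E. unfold Rsqr in E. split.
  - apply big_circle_li_dom. exists (cos a), (sin a). split; [lra|auto].
  - unfold up_slit, slit. unfold z. simpl.
    pose proof (sin_ge_0 a ltac:(lra) ltac:(lra)) as [h|h]; [left; lra|right]. rewrite <- h in E.
    assert ((cos a - 1) * (cos a + 1) = 0) as K by lra. apply Rmult_integral in K. lra.
Qed.

Lemma loopZ1_arc t : 0 <= t <= 1 -> t <= /3 \/ 2/3 <= t -> li_dom (loopZ1 t) /\ up_slit (loopZ1 t).
Proof.
  pose proof PI_RGT_0. intros Ht [h|h]; [rewrite loopZ1_a by auto|rewrite loopZ1_c by auto]; apply upper_arc; nra.
Qed.

Lemma li_up_open : copen (fun z => li_dom z /\ up_slit z).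
Proof. apply inter_open; [apply li_dom_open|apply slit_affine_open]. Qed.

Lemma lift_Z1_arc_b i a b : (0 < i)%nat -> 0 <= a <= b -> b <= 1 -> (b <= /3 \/ 2/3 <= a) -> pathc loopZ1 0 1 ->
  lift c loopZ1 a b (fun k => bsol c i log_up k (loopZ1 a)) (fun k => bsol c i log_up k (loopZ1 b)).
Proof.
  intros Hi Hab Hb Hor Hp.
  apply (lift_bsol loopZ1 a b i log_up (fun z => li_dom z /\ up_slit z)); auto; try lra.
  - apply (pathc_sub _ 0 1); auto; lra.
  - apply li_up_open.
  - intros z [_ h]. apply cderiv_log_up; auto.
  - intros t Ht. assert (K : li_dom (loopZ1 t) /\ up_slit (loopZ1 t)) by (apply loopZ1_arc; [|destruct Hor]; lra).
    split; auto. apply li_dom_punctured, K.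
Qed.

Lemma loopZ1_circle t : /3 <= t <= 2/3 -> 0 < Re (loopZ1 t) /\ Cmod (loopZ1 t - 1) < 1 /\ punctured (loopZ1 t).
Proof.
  intros Ht. rewrite loopZ1_b by auto. set (w := log_path t).
  assert (Hw : Re w < 0). { unfold w; simpl. rewrite <- ln_1. apply ln_increasing; lra. }
  split; [apply one_minus_exp_Re; auto|]. split.
  - replace (1 - Cexp w - 1)%C with (- Cexp w)%C by ring. rewrite Cmod_opp, Cmod_Cexp. unfold w; simpl. rewrite exp_ln; lra.
  - split; [apply one_minus_exp_neq0; auto|]. intros E. apply (Cexp_neq0 w).
    replace (Cexp w) with (1 - (1 - Cexp w))%C by ring. rewrite E. ring.
Qed.

(** The small circle lies in the right half-plane, where the principal logarithm is one-valued, and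
    at 1/2 it agrees with [log_up], used on the arc there and back. *)
Lemma lift_Z1_b i : (0 < i)%nat -> pathc loopZ1 0 1 ->
  lift c loopZ1 0 1 (fun k => bsol c i log_up k m1) (fun k => bsol c i log_up k m1).
Proof.
  intros Hi Hp. destruct loopZ1_pts as [e0 [e1 [e2 e3]]].
  pose proof (lift_Z1_arc_b i 0 (/3) Hi ltac:(lra) ltac:(lra) ltac:(lra) Hp) as L1.
  pose proof (lift_Z1_arc_b i (2/3) 1 Hi ltac:(lra) ltac:(lra) ltac:(lra) Hp) as L3.
  assert (L2 : lift c loopZ1 (/3) (2/3) (fun k => bsol c i Clog k (loopZ1 (/3))) (fun k => bsol c i Clog k (loopZ1 (2/3)))).
  { apply (lift_bsol loopZ1 (/3) (2/3) i Clog slit); auto; try lra.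
    - apply (pathc_sub _ 0 1); auto; lra.
    - apply slit_open.
    - intros; apply cderiv_Clog; auto.
    - intros t Ht. destruct (loopZ1_circle t Ht) as [h1 [_ h2]]. split; auto. left; auto. }
  rewrite e0, e1 in L1. rewrite e2, e3 in L3. rewrite e1, e2 in L2.
  apply (lift_concat c loopZ1 0 (/3) 1 _ (fun k => bsol c i log_up k (RtoC (/2)))); auto; [lra|].
  apply (lift_concat c loopZ1 (/3) (2/3) 1 _ (fun k => bsol c i log_up k (RtoC (/2)))); auto; [lra|apply (pathc_sub _ 0 1); auto; lra|].
  eapply lift_eq; [exact L2| |]; intros k; apply bsol_ext; symmetry; apply log_up_half.
Qed.

Lemma lift_Z1_li : pathc loopZ1 0 1 ->
  lift c loopZ1 0 1 (fun k => LiG k m1) (fun k => 1 * LiG k m1 + - twopii * bsol c 1 log_up k m1)%C.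
Proof.
  intros Hp. destruct loopZ1_pts as [e0 [e1 [e2 e3]]]. pose proof PI_RGT_0 as Hpi.
  destruct LiG_spec as [HL HLS].
  assert (L1 : lift c loopZ1 0 (/3) (fun k => LiG k m1) (fun k => LiG k (RtoC (/2)))).
  { pose proof (lift_sol c loopZ1 0 (/3) li_dom LiG) as L. rewrite e0, e1 in L. apply L; auto using li_dom_open; try lra.
    - apply (pathc_sub _ 0 1); auto; lra.
    - intros t Ht. apply loopZ1_arc; lra. }
  assert (L3 : lift c loopZ1 (2/3) 1 (fun k => 1 * LiG k (RtoC (/2)) + - twopii * bsol c 1 log_up k (RtoC (/2)))%C
     (fun k => 1 * LiG k m1 + - twopii * bsol c 1 log_up k m1)%C).
  { pose proof (lift_sol c loopZ1 (2/3) 1 (fun z => li_dom z /\ up_slit z) (fun k z => 1 * LiG k z + - twopii * bsol c 1 log_up k z)%C) as L.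
    rewrite e2, e3 in L. apply L; auto using li_up_open; try lra.
    - apply (pathc_sub _ 0 1); auto; lra.
    - apply sol_lin; [eapply sol_mono; [|exact HL]; tauto|]. apply bsol_sol; auto. intros z [h1 h2].
      split; [apply li_dom_punctured; auto|apply cderiv_log_up; auto].
    - intros t Ht. apply loopZ1_arc; lra. }
  (* At the junction [1 - h = h], so [w0] is both the coordinate [log (1 - h)] and the value
     [log h]; hence [lam w0 = w0]. *)
  set (h := RtoC (/2)) in *. set (w0 := Clog h).
  assert (Ew0 : w0 = (ln (/2), 0)) by (unfold w0, h; rewrite Clog_pos by lra; auto).
  assert (Hln : ln (/2) < 0) by (rewrite <- ln_1; apply ln_increasing; lra).
  assert (Hh : Cmod h < 1) by (unfold h; rewrite Cmod_R, Rabs_right; lra).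
  assert (h0 : h <> 0%C) by (intros E; apply RtoC_inj in E; lra).
  assert (h1 : (1 - h)%C = h) by (unfold h; rewrite <- RtoC_minus; f_equal; lra).
  (* The initial values are [z^(c-1) u_(j+1)] at [z = 1/2], so that [sol1] starts from the values of
     [LiG]. *)
  destruct (iter_prim (fun w : C => Re w < 0) (fun w => - Cexp ((c - 1) * lam w))%C dlam w0
     (fun j => Cexp ((c - 1) * w0) * LiG (S j) h)%C) as [X [X0 [XS Xp]]].
  { apply halfplane_open. } { apply halfplane_convex. }
  { intros w Hw. eexists. apply cderiv_opp, cderiv_exp_scal, cderiv_lam; auto. }
  { intros w Hw. apply holo_dlam; auto. }
  (* Three branches of [log (1 - z)], matching at the points where [1 - z] is on the imaginary axis,
     that is at [t = 5/12] and [t = 7/12]. *)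
  set (lA := fun z => (Clog (1 + -(1) * z) + 0)%C). set (lB := fun z => (Clog (-(1) + 1 * z) + i_pi)%C).
  set (lC := fun z => (Clog (1 + -(1) * z) + twopii)%C).
  assert (Rer : forall z k, Re k = 0 -> Cmod (z - 1) < 1 -> z <> 1%C -> forall u, Cmod u = Cmod (z - 1) -> Re (Clog u + k)%C < 0).
  { intros z k Hk Hz n u Hu. change (Re (Clog u + k)%C) with (ln (Cmod u) + Re k). rewrite Hk, Hu, Rplus_0_r, <- ln_1.
    apply ln_increasing; auto. apply Cmod_gt_0. intros E. apply n, Ceq_minus, E. }
  assert (M1 : forall z, Cmod (1 + -(1) * z) = Cmod (z - 1)) by (intros z; rewrite (Cmod_sym z 1); f_equal; ring).
  assert (M2 : forall z, Cmod (-(1) + 1 * z) = Cmod (z - 1)) by (intros z; f_equal; ring).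
  assert (piece : forall a b al be k, /3 <= a -> a <= b -> b <= 2/3 -> Re k = 0 ->
     (forall z, Cmod (al + be * z) = Cmod (z - 1)) -> (forall z : C, z <> 1%C -> be / (al + be * z) = - / (1 - z))%C ->
     (forall z, (al + be * z) * Cexp k = 1 - z)%C ->
     (forall t, a <= t <= b -> slit (al + be * loopZ1 t)%C) ->
     lift c loopZ1 a b (fun j => sol1 c X (fun z => Clog (al + be * z) + k)%C j (loopZ1 a))
       (fun j => sol1 c X (fun z => Clog (al + be * z) + k)%C j (loopZ1 b))).
  { intros a b al be k ha hab hb Hk Ha Hbe He Hsl.
    apply (lift_sol c loopZ1 a b (fun z => (disk 1%C 1 z /\ slit (al + be * z)%C))); auto.
    - apply (pathc_sub _ 0 1); auto; lra.
    - apply sol1_sol; auto. intros z [hz1 hz2].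
      assert (n1 : z <> 1%C). { intros ->. apply slit_neq0 in hz2. apply hz2. apply Cmod_eq_0. rewrite Ha. apply Cmod_self. }
      split; [split; auto|].
      + intros ->. unfold disk in hz1. replace (0 - 1)%C with (- (1))%C in hz1 by ring. rewrite Cmod_m1 in hz1. lra.
      + split; [apply (Rer z); auto|]. split.
        * rewrite Cexp_plus, Cexp_Clog by (apply slit_neq0; auto). apply He.
        * eapply cderiv_eq; [apply cderiv_Clog_affine; auto|apply Hbe; auto].
    - apply inter_open; [apply disk_open|apply slit_affine_open].
    - intros t Ht. destruct (loopZ1_circle t ltac:(lra)) as [_ [q _]]. split; [exact q|auto]. }
  assert (be1 : forall z : C, (z <> 1%C -> -(1) / (1 + -(1) * z) = - / (1 - z))%C).
  { intros z _. replace (1 + -(1) * z)%C with (1 - z)%C by ring. unfold Cdiv. ring. }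
  assert (E1z : forall t, /3 <= t <= 2/3 -> (1 + -(1) * loopZ1 t)%C = Cexp (log_path t)).
  { intros t Ht. rewrite loopZ1_b by auto. ring. }
  assert (sl : forall t, /3 <= t <= 2/3 -> (0 <= cos (2 * PI * (3 * t - 1)) -> slit (1 + -(1) * loopZ1 t)%C) /\
     (cos (2 * PI * (3 * t - 1)) <= 0 -> slit (-(1) + 1 * loopZ1 t)%C)).
  { intros t Ht. pose proof (E1z t Ht) as E. set (a := 2 * PI * (3 * t - 1)) in *.
    assert (E' : (-(1) + 1 * loopZ1 t)%C = (- Cexp (log_path t))%C) by (rewrite <- E; ring).
    rewrite E, E'. unfold slit, Cexp, log_path. fold a. simpl. rewrite exp_ln by lra.
    pose proof (sin2_cos2 a) as Q. unfold Rsqr in Q.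
    split; intros [H|H]; try (left; lra); right; [rewrite <- H in Q|rewrite H in Q]; nra. }
  assert (t1 : 2 * PI * (3 * (5/12) - 1) = PI / 2) by field.
  assert (t2 : 2 * PI * (3 * (7/12) - 1) = 3 * (PI / 2)) by field.
  assert (ePi : Cexp i_pi = (-(1))%C) by (unfold i_pi; rewrite Cexp_ipi; apply RtoC_m1).
  assert (be2 : forall z : C, (z <> 1%C -> 1 / (-(1) + 1 * z) = - / (1 - z))%C).
  { intros z n. field. split; [apply one_minus_neq0; auto|]. intros E. apply n, Ceq_minus. rewrite <- E. ring. }
  assert (exp0 : Cexp 0%C = 1%C) by apply Cexp_0.
  pose proof (piece (/3) (5/12) 1%C (-(1))%C 0%C ltac:(lra) ltac:(lra) ltac:(lra) eq_refl M1 be1) as P1.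
  pose proof (piece (5/12) (7/12) (-(1))%C 1%C i_pi ltac:(lra) ltac:(lra) ltac:(lra) eq_refl M2 be2) as P2.
  pose proof (piece (7/12) (2/3) 1%C (-(1))%C twopii ltac:(lra) ltac:(lra) ltac:(lra) eq_refl M1 be1) as P3.
  specialize (P1 ltac:(intros z; rewrite exp0; ring)
    ltac:(intros t Ht; apply sl; [lra|apply cos_ge_0; nra])).
  specialize (P2 ltac:(intros z; rewrite ePi; ring)
    ltac:(intros t Ht; apply sl; [lra|apply cos_le_0; nra])).
  specialize (P3 ltac:(intros z; rewrite Cexp_2pi; ring)
    ltac:(intros t Ht; apply sl; [lra|apply cos_ge_0_3PI2; nra])).
  fold lA in P1. fold lB in P2. fold lC in P3.
  assert (ext : forall l l' z k, l z = l' z -> sol1 c X l k z = sol1 c X l' k z).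
  { intros l l' z k E. destruct k; simpl; [auto|rewrite E; auto]. }
  assert (EAB : lA (loopZ1 (5/12)) = lB (loopZ1 (5/12))).
  { unfold lA, lB. rewrite Cplus_0_r, (Clog_opp_upper (1 + -(1) * loopZ1 (5/12))%C); [do 2 f_equal; ring|].
    rewrite E1z by lra. unfold Cexp, log_path. rewrite t1. simpl. rewrite sin_PI2, exp_ln; lra. }
  assert (EBC : lB (loopZ1 (7/12)) = lC (loopZ1 (7/12))).
  { unfold lB, lC. rewrite Clog_opp_lower; [do 2 f_equal; ring|].
    rewrite E1z by lra. unfold Cexp, log_path. rewrite t2. cbn [Re Im fst snd]. rewrite sin_3PI2, exp_ln; lra. }
  rewrite e1 in P1. rewrite e2 in P3.
  assert (lAh : Clog (1 + -(1) * h)%C = w0).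
  { replace (1 + -(1) * h)%C with (1 - h)%C by ring. rewrite h1. auto. }
  assert (LG0 : LiG 0 h = 1%C) by (rewrite HLS; auto).
  assert (EE : (Cexp ((1 - c) * w0) * Cexp ((c - 1) * w0))%C = 1%C).
  { rewrite <- Cexp_plus. replace ((1 - c) * w0 + (c - 1) * w0)%C with (RtoC 0) by ring. apply Cexp_0. }
  assert (Start : forall k, sol1 c X lA k h = LiG k h).
  { intros [|j]; simpl; [auto|]. unfold lA. rewrite lAh, Cplus_0_r, Xp. fold w0.
    transitivity ((Cexp ((1 - c) * w0) * Cexp ((c - 1) * w0)) * LiG (S j) h)%C; [ring|]. rewrite EE. ring. }
  assert (lamw : lam w0 = w0).
  { unfold lam, w0. rewrite Cexp_Clog by auto. rewrite h1. auto. }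
  assert (Hw0 : Re w0 < 0) by (rewrite Ew0; simpl; auto).
  (* Back at 1/2 the coordinate has become [w0 + twopii], so [monodromy_at_1] yields the added
     multiple of the solution with index 1. *)
  assert (End : forall k, sol1 c X lC k h = (1 * LiG k h + - twopii * bsol c 1 log_up k h)%C).
  { intros [|j]; simpl sol1.
    - rewrite LG0. unfold bsol. simpl. ring.
    - unfold lC. rewrite lAh, (monodromy_at_1 c X X0 XS j w0 Hw0), lamw, Xp. fold w0.
      unfold bsol. destruct (Nat.ltb_spec (S j) 1); [lia|]. replace (S j - 1)%nat with j by lia.
      replace (log_up h) with w0 by (symmetry; apply log_up_half).
      transitivity ((Cexp ((1 - c) * w0) * Cexp ((c - 1) * w0)) * LiG (S j) h + - twopii * (/ RtoC (INR (fact j)) * Cexp ((1 - c) * w0) * Cpow w0 j))%C; [ring|].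
      rewrite EE. ring. }
  assert (pc : forall a b, 0 <= a -> b <= 1 -> pathc loopZ1 a b) by (intros; apply (pathc_sub _ 0 1); auto).
  apply (lift_concat c loopZ1 0 (/3) 1 _ (fun k => LiG k h)); auto; [lra|].
  apply (lift_concat c loopZ1 (/3) (2/3) 1 _ (fun k => 1 * LiG k h + - twopii * bsol c 1 log_up k h)%C); auto; [lra|apply pc; lra|].
  apply (lift_concat c loopZ1 (/3) (5/12) (2/3) _ (fun k => sol1 c X lA k (loopZ1 (5/12)))); [lra|apply pc; lra| |].
  { eapply lift_eq; [exact P1|exact Start|reflexivity]. }
  apply (lift_concat c loopZ1 (5/12) (7/12) (2/3) _ (fun k => sol1 c X lB k (loopZ1 (7/12)))); [lra|apply pc; lra| |].
  { eapply lift_eq; [exact P2| |reflexivity]. intros k. apply ext. auto. }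
  eapply lift_eq; [exact P3| |exact End]. intros k. apply ext. auto.
Qed.

End Loops.

(** * Monodromy matrices *)

Lemma Csum_ext (f g : nat -> C) n : (forall k, (k < n)%nat -> f k = g k) -> Csum f n = Csum g n.
Proof. induction n; intros H; simpl; auto. rewrite IHn, H; auto. Qed.

Lemma Csum_zero (f : nat -> C) n : (forall k, (k < n)%nat -> f k = 0%C) -> Csum f n = 0%C.
Proof. induction n; intros H; simpl; auto. rewrite IHn, H; auto. ring. Qed.

Lemma Csum_one (f : nat -> C) n i : (i < n)%nat -> (forall k, (k < n)%nat -> k <> i -> f k = 0%C) -> Csum f n = f i.
Proof.
  induction n; intros Hi H; [lia|]. simpl. destruct (Nat.eq_dec i n) as [->|ne].
  - rewrite Csum_zero; [ring|]. intros k Hk. apply H; lia.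
  - rewrite IHn, (H n); auto; try lia. ring.
Qed.

Lemma Csum_shift (f : nat -> C) k n : (forall l, (l < k)%nat -> f l = 0%C) -> Csum f (k + n) = Csum (fun a => f (k + a)%nat) n.
Proof.
  intros H. induction n; simpl.
  - rewrite Nat.add_0_r. apply Csum_zero. auto.
  - rewrite Nat.add_succ_r. simpl. rewrite IHn. auto.
Qed.

Lemma Csum_plus (f g : nat -> C) n : Csum (fun k => f k + g k)%C n = (Csum f n + Csum g n)%C.
Proof. induction n; simpl; [ring|]. rewrite IHn. ring. Qed.

Lemma Csum_scal a (f : nat -> C) n : Csum (fun k => a * f k)%C n = (a * Csum f n)%C.
Proof. induction n; simpl; [ring|]. rewrite IHn. ring. Qed.

Lemma Csum_first (f : nat -> C) n : Csum f (S n) = (f O + Csum (fun k => f (S k)) n)%C.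
Proof. induction n; [simpl; ring|]. change (Csum f (S (S n))) with (Csum f (S n) + f (S n))%C. rewrite IHn. simpl. ring. Qed.

Definition divpow (j : nat) (x : C) : C := (/ RtoC (INR (fact j)) * Cpow x j)%C.

Lemma divpow_S j x : (RtoC (INR (S j)) * divpow (S j) x)%C = (x * divpow j x)%C.
Proof.
  unfold divpow. change (fact (S j)) with (S j * fact j)%nat. rewrite mult_INR, RtoC_mult, Cpow_S.
  assert (RtoC (INR (S j)) <> 0%C) by (apply RtoC_INR_neq0; lia).
  assert (RtoC (INR (fact j)) <> 0%C) by (apply RtoC_INR_neq0, lt_O_fact). field; auto.
Qed.

(** Binomial theorem for the divided powers [x^j / j!]. After multiplication by
    [n + 1 = a + (n + 1 - a)], each summand lowers one of the two divided powers, which gives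
    [(x + y)] times the preceding case. *)
Lemma divpow_binomial x y n : Csum (fun a => divpow a x * divpow (n - a) y)%C (S n) = divpow n (x + y).
Proof.
  induction n.
  - simpl. unfold divpow. simpl. field.
  - assert (Hn : RtoC (INR (S n)) <> 0%C) by (apply RtoC_INR_neq0; lia).
    enough (E : (RtoC (INR (S n)) * Csum (fun a => divpow a x * divpow (S n - a) y) (S (S n)))%C = (RtoC (INR (S n)) * divpow (S n) (x + y))%C).
    { apply (f_equal (fun u => / RtoC (INR (S n)) * u)%C) in E. rewrite !Cmult_assoc, Cinv_l, !Cmult_1_l in E by auto. exact E. }
    rewrite divpow_S, <- IHn, <- Csum_scal.
    rewrite (Csum_ext _ (fun a => RtoC (INR a) * divpow a x * divpow (S n - a) y + divpow a x * (RtoC (INR (S n - a)) * divpow (S n - a) y))%C).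
    2:{ intros k Hk. replace (INR (S n)) with (INR k + INR (S n - k)) by (rewrite <- plus_INR; f_equal; lia).
        rewrite RtoC_plus. ring. }
    rewrite Csum_plus.
    rewrite (Csum_first (fun a => RtoC (INR a) * divpow a x * divpow (S n - a) y)%C).
    change (Csum (fun a => divpow a x * (RtoC (INR (S n - a)) * divpow (S n - a) y))%C (S (S n)))
      with (Csum (fun a => divpow a x * (RtoC (INR (S n - a)) * divpow (S n - a) y))%C (S n) + divpow (S n) x * (RtoC (INR (S n - S n)) * divpow (S n - S n) y))%C.
    rewrite Nat.sub_diag. change (INR 0) with 0.
    rewrite (Csum_ext (fun k => RtoC (INR (S k)) * divpow (S k) x * divpow (S n - S k) y)%C (fun k => x * (divpow k x * divpow (n - k) y))%C).
    2:{ intros k Hk. rewrite divpow_S. replace (S n - S k)%nat with (n - k)%nat by lia. ring. }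
    rewrite (Csum_ext (fun a => divpow a x * (RtoC (INR (S n - a)) * divpow (S n - a) y))%C (fun k => y * (divpow k x * divpow (n - k) y))%C (S n)).
    2:{ intros k Hk. replace (S n - k)%nat with (S (n - k)) by lia. rewrite divpow_S. ring. }
    rewrite !Csum_scal. ring.
Qed.

Lemma mmul_upper n (A B : Mat) : upper_tri n A -> upper_tri n B ->
  upper_tri n (mmul n A B) /\ forall i, (i < n)%nat -> mmul n A B i i = (A i i * B i i)%C.
Proof.
  intros HA HB. split.
  - intros i j Hi Hj. unfold mmul. apply Csum_zero. intros k Hk. destruct (le_lt_dec i k).
    + rewrite (HB k j) by lia. ring.
    + rewrite (HA i k) by lia. ring.
  - intros i Hi. unfold mmul. rewrite (Csum_one _ n i); auto. intros k Hk ne.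
    destruct (le_lt_dec i k); [rewrite (HB k i) by lia|rewrite (HA i k) by lia]; ring.
Qed.

(** Back substitution: the rows of [N] are treated from the last one upwards, whence the induction
    on a bound for [n - i]. *)
Lemma upper_inv n (A N : Mat) : upper_tri n A -> (forall i, (i < n)%nat -> A i i <> 0%C) -> mat_eq n (mmul n A N) mat_id ->
  upper_tri n N /\ forall i, (i < n)%nat -> N i i = (/ A i i)%C.
Proof.
  intros HA Hd HN.
  assert (U : forall p i j, (n - i <= p)%nat -> (i < n)%nat -> (j < i)%nat -> N i j = 0%C).
  { induction p; intros i j Hp Hi Hj; [lia|].
    pose proof (HN i j Hi ltac:(lia)) as E. unfold mmul in E. rewrite (Csum_one _ n i) in E; auto.
    - unfold mat_id in E. destruct (Nat.eqb_spec i j); [lia|].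
      destruct (classic (N i j = 0%C)) as [h|h]; auto. exfalso. apply (Cmult_neq_0 _ _ (Hd i Hi) h). auto.
    - intros k Hk ne. destruct (le_lt_dec i k); [rewrite (IHp k j) by lia|rewrite (HA i k) by lia]; ring. }
  assert (UN : upper_tri n N) by (intros i j Hi Hj; apply (U n); auto; lia).
  split; auto. intros i Hi. pose proof (HN i i Hi Hi) as E.
  rewrite (proj2 (mmul_upper n A N HA UN) i Hi) in E. unfold mat_id in E. rewrite Nat.eqb_refl in E.
  apply (f_equal (fun u => / A i i * u)%C) in E. rewrite Cmult_assoc, Cinv_l, Cmult_1_l, Cmult_1_r in E by auto. auto.
Qed.

Lemma strict_upper_nilpotent n (A : Mat) : (forall i j, (i < n)%nat -> (j <= i)%nat -> A i j = 0%C) ->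
  forall k i j, (i < n)%nat -> (j < i + k)%nat -> mpow n A k i j = 0%C.
Proof.
  intros HA. induction k; intros i j Hi Hj.
  - simpl. unfold mat_id. destruct (Nat.eqb_spec i j); [lia|auto].
  - simpl. unfold mmul. apply Csum_zero. intros l Hl. destruct (le_lt_dec (i + k) l).
    + rewrite (HA l j) by lia. ring.
    + rewrite (IHk i l) by lia. ring.
Qed.

Lemma unipotent_upper n (A : Mat) : upper_tri n A -> (forall i, (i < n)%nat -> A i i = 1%C) -> unipotent n A.
Proof.
  intros HU HD i j Hi Hj. apply strict_upper_nilpotent; auto; [|lia].
  intros k l Hk Hl. unfold msub, mat_id. destruct (Nat.eqb_spec k l) as [->|ne].
  - rewrite HD by auto. ring.
  - rewrite HU by lia. ring.
Qed.

Lemma mat_id_upper n : upper_tri n mat_id.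
Proof. intros i j Hi Hj. unfold mat_id. destruct (Nat.eqb_spec i j); [lia|auto]. Qed.

Lemma mpow_upper n (A : Mat) k : upper_tri n A -> upper_tri n (mpow n A k) /\ forall i, (i < n)%nat -> mpow n A k i i = Cpow (A i i) k.
Proof.
  intros HA. induction k as [|k [IH1 IH2]]; simpl.
  - split; [apply mat_id_upper|]. intros i _. unfold mat_id. rewrite Nat.eqb_refl. auto.
  - destruct (mmul_upper n _ _ IH1 HA) as [h1 h2]. split; auto. intros i Hi. rewrite h2, IH2 by auto. ring.
Qed.

(* The image of the monodromy consists of upper triangular matrices with diagonal
   [(1, d, ..., d)], where [d] is a power of [exp (- 2 i pi c)]. *)
Definition tri_diag (n : nat) (D : C -> Prop) (X : Mat) : Prop :=
  upper_tri n X /\ X O O = 1%C /\ exists d : C, d <> 0%C /\ D d /\ forall i, (0 < i < n)%nat -> X i i = d.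

(** The predicate [D] is any property stable under products and inverses: it is taken trivial for
    the Borel subgroup, [d = 1] for unipotency, and [d^n = 1] for quasi-unipotency. *)
Lemma in_gen_tri_diag n (D : C -> Prop) A B : (0 < n)%nat -> D 1%C -> (forall a b, D a -> D b -> D (a * b)%C) -> (forall a : C, a <> 0%C -> D a -> D (/ a)%C) ->
  tri_diag n D A -> tri_diag n D B -> forall X, in_gen n A B X -> tri_diag n D X.
Proof.
  intros Hn D1 DM DV HA HB.
  assert (M : forall X Y, tri_diag n D X -> tri_diag n D Y -> tri_diag n D (mmul n X Y)).
  { intros X Y [u1 [o1 [d1 [n1 [p1 q1]]]]] [u2 [o2 [d2 [n2 [p2 q2]]]]].
    destruct (mmul_upper n X Y u1 u2) as [u3 q3]. split; auto. split.
    - rewrite q3, o1, o2 by auto. ring.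
    - exists (d1 * d2)%C. split; [apply Cmult_neq_0; auto|]. split; auto. intros i Hi. rewrite q3, q1, q2 by lia. auto. }
  assert (V : forall Y N, tri_diag n D Y -> mat_inv n Y N -> tri_diag n D N).
  { intros Y N [u1 [o1 [d1 [n1 [p1 q1]]]]] [hN _].
    destruct (upper_inv n Y N u1) as [u2 q2]; auto.
    { intros [|i] Hi; [rewrite o1; apply C1_nz|rewrite q1; auto; lia]. }
    split; auto. split.
    - rewrite q2, o1 by auto. field.
    - exists (/ d1)%C. split; [|split; auto].
      + intros E. apply C1_nz. rewrite <- (Cinv_r d1 n1), E. ring.
      + intros i Hi. rewrite q2, q1 by lia. auto. }
  induction 1; auto.
  - split; [apply mat_id_upper|]. split; auto. exists 1%C. split; [apply C1_nz|]. split; auto.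
    intros i _. unfold mat_id. rewrite Nat.eqb_refl. auto.
  - apply M; auto. apply (V A); auto.
  - apply M; auto. apply (V B); auto.
Qed.

Lemma rhoZ0_tri_diag n D c : D (Cexp (- (twopii * c))) -> tri_diag n D (rhoZ0 c).
Proof.
  intros HD. split; [|split; [auto|]].
  - intros [|i] j Hi Hj; [lia|]. unfold rhoZ0. destruct (Nat.ltb_spec j (S i)); [auto|lia].
  - exists (Cexp (- (twopii * c))). split; [apply Cexp_neq0|]. split; auto. intros [|i] Hi; [lia|].
    unfold rhoZ0. rewrite Nat.ltb_irrefl, Nat.sub_diag. simpl. field.
Qed.

Lemma rhoZ1_tri_diag n (D : C -> Prop) : D 1%C -> tri_diag n D rhoZ1.
Proof.
  intros HD. split; [|split; [auto|]].
  - intros i j Hi Hj. unfold rhoZ1, mat_id. destruct (Nat.eqb_spec i 0); [lia|]. simpl. destruct (Nat.eqb_spec i j); [lia|auto].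
  - exists 1%C. split; [apply C1_nz|]. split; auto. intros i Hi. unfold rhoZ1, mat_id.
    destruct (Nat.eqb_spec i 0); [lia|]. simpl. rewrite Nat.eqb_refl. auto.
Qed.

Lemma Cexp_mult_nat z n : Cpow (Cexp z) n = Cexp (RtoC (INR n) * z).
Proof.
  induction n; [simpl; rewrite Cmult_0_l, Cexp_0; auto|].
  rewrite Cpow_S, IHn, S_INR, RtoC_plus, <- Cexp_plus. f_equal. ring.
Qed.

Lemma Cexp_2pi_int (k : Z) : Cexp (twopii * RtoC (IZR k)) = 1%C.
Proof.
  assert (P : forall n, Cexp (RtoC (INR n) * twopii) = 1%C).
  { intros n. rewrite <- Cexp_mult_nat, Cexp_2pi. apply Cpow_1_l. }
  destruct (Z_le_dec 0 k) as [h|h].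
  - rewrite <- (Z2Nat.id k h), <- INR_IZR_INZ, Cmult_comm. apply P.
  - replace k with (- Z.of_nat (Z.to_nat (- k)))%Z by (rewrite Z2Nat.id; lia).
    rewrite opp_IZR, <- INR_IZR_INZ, RtoC_opp.
    replace (twopii * - RtoC (INR (Z.to_nat (- k))))%C with (- (RtoC (INR (Z.to_nat (- k))) * twopii))%C by ring.
    rewrite Cexp_opp, P. field.
Qed.

Lemma Cpow_inv_1 (a : C) q : a <> 0%C -> Cpow a q = 1%C -> Cpow (/ a) q = 1%C.
Proof. intros H E. rewrite Cpow_inv, E by auto. field. Qed.

(** * Comparison of germs at -1 and passage to homotopy classes *)

Lemma cos_half_bound t : 0 < t < /2 -> /2 < cos t.
Proof.
  intros Ht. replace t with (2 * (t / 2)) by field. rewrite cos_2a_sin.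
  pose proof (sin_lt_x (t / 2) ltac:(lra)). 
  assert (0 < sin (t / 2)) by (apply sin_gt_0; pose proof PI2_1; lra). nra.
Qed.

(** The wedge of angles between 0 and 1/2 at -1 lies in the upper half-plane and in the unit disk:
    the squared modulus [1 - 2 p cos + p^2] is below 1, as [p < 1] and the cosine exceeds 1/2. *)
Lemma germ_unique_m1 (G S : C -> C) r : 0 < r <= 1 -> holo (disk m1 r) G -> holo (disk m1 r) S ->
  (forall z, disk m1 r z -> 0 < Im z -> Cmod z < 1 -> G z = S z) ->
  exists e, 0 < e /\ forall z, disk m1 e z -> G z = S z.
Proof.
  intros Hr HG HS H.
  destruct (wedge_uniqueness (fun z => G z - S z)%C m1 r) as [e [He K]]; [lra| | |].
  - intros z Hz. destruct (HG z Hz) as [l Hl]. destruct (HS z Hz) as [l' Hl']. eexists.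
    apply cderiv_minus; eauto.
  - intros w Hw Hi. rewrite H; [ring| | |].
    + unfold disk. replace (m1 + Cexp w - m1)%C with (Cexp w) by ring. rewrite Cmod_Cexp.
      rewrite <- (exp_ln r) by lra. apply exp_increasing; auto.
    + replace (Im (m1 + Cexp w)%C) with (exp (Re w) * sin (Im w)) by (unfold m1; simpl; ring).
      apply Rmult_lt_0_compat; [apply exp_pos|]. apply sin_gt_0; pose proof PI2_1; lra.
    + set (p := exp (Re w)). assert (Hp : 0 < p) by apply exp_pos.
      assert (p < 1). { apply Rlt_le_trans with r; [|lra]. rewrite <- (exp_ln r) by lra. apply exp_increasing; auto. }
      pose proof (cos_half_bound (Im w) Hi) as Hc.
      assert (E : Cmod (m1 + Cexp w) ^ 2 = 1 - 2 * p * cos (Im w) + p ^ 2).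
      { rewrite Cmod2_alt. unfold m1. simpl. fold p.
        pose proof (sin2_cos2 (Im w)) as Q. unfold Rsqr in Q.
        assert (Q2 : p * p * (sin (Im w) * sin (Im w) + cos (Im w) * cos (Im w)) = p * p) by (rewrite Q; ring). lra. }
      pose proof (Cmod_ge_0 (m1 + Cexp w)). nra.
  - exists e. split; auto. intros z Hz. apply Ceq_minus, K, Hz.
Qed.

Lemma continues_along_germ f f' g h h' : continues_along f g h ->
  (exists e, 0 < e /\ forall z, disk (g 0) e z -> f z = f' z) ->
  (exists e, 0 < e /\ forall z, disk (g 1) e z -> h z = h' z) -> continues_along f' g h'.
Proof.
  intros [F [r [H1 [H2 [[e0 [p0 k0]] [e1 [p1 k1]]]]]]] [e2 [p2 k2]] [e3 [p3 k3]].
  exists F, r. split; [auto|]. split; [auto|]. split.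
  - exists (Rmin e0 e2). split; [apply Rmin_pos; auto|]. intros z Hz.
    destruct (disk_Rmin _ _ _ _ Hz). rewrite k0, k2; auto.
  - exists (Rmin e1 e3). split; [apply Rmin_pos; auto|]. intros z Hz.
    destruct (disk_Rmin _ _ _ _ Hz). rewrite k1, k3; auto.
Qed.

Lemma lift_ext c g g' a b x y : (forall t, a <= t <= b -> g t = g' t) -> lift c g a b x y -> lift c g' a b x y.
Proof.
  intros E [v [Hv Hxy]]. exists v. split; auto. intros t Ht.
  destruct (Hv t Ht) as [e [Y [d [h1 [h2 [h3 h4]]]]]]. exists e, Y, d. rewrite <- (E t Ht).
  split; [auto|]. split; [auto|]. split; [auto|]. intros s Hs Hd. rewrite <- (E s Hs). auto.
Qed.

Lemma filterlim_Hcont (H : R -> R -> C) :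
  (forall p, I01sq p -> filterlim (fun q : R * R => H (fst q) (snd q)) (within I01sq (locally p)) (locally (H (fst p) (snd p)))) ->
  Hcont H.
Proof.
  intros HF s t Hs Ht e He.
  assert (He2 : 0 < e / sqrt 2) by (apply Rdiv_lt_0_compat; [auto|apply sqrt_lt_R0; lra]).
  pose proof (proj1 (filterlim_locally (U := C_UniformSpace) _ _) (HF (s, t) (conj Hs Ht)) (mkposreal _ He2)) as K.
  destruct K as [d K]. exists d. split; [apply cond_pos|]. intros s' t' hs ht h1 h2.
  specialize (K (s', t') (conj h1 h2) (conj hs ht)).
  apply C_NormedModule_mixin_compat2 in K. simpl in K.
  replace (sqrt 2 * (e / sqrt 2)) with e in K by (field; apply Rgt_not_eq, sqrt_lt_R0; lra). exact K.
Qed.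

(** The homotopy runs from [gamma] to [Z]. Its edge at 1 also supplies the continuity of the
    explicit loop, so that none has to be derived from the formulas. *)
Lemma class_lift c Z gamma x y : in_class Z gamma -> (pathc Z 0 1 -> lift c Z 0 1 x y) -> lift c gamma 0 1 x y.
Proof.
  intros [_ [H [HF [H01 [Hends HP]]]]] HL. pose proof (filterlim_Hcont H HF) as Hc.
  apply (lift_ext c (H 0)); [intros t Ht; apply H01; auto|].
  apply homotopy_lift; auto. apply (lift_ext c Z); [intros t Ht; symmetry; apply H01; auto|].
  apply HL. intros t Ht e He. destruct (Hc 1 t ltac:(unfold I01; lra) Ht e He) as [d [Hd K]].
  exists d. split; auto. intros s Hs Hsd. rewrite <- (proj2 (H01 s Hs)), <- (proj2 (H01 t Ht)).
  apply K; auto; [unfold I01; lra|]. rewrite Rminus_diag, Rabs_R0; auto.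
Qed.

Lemma common_radius (P : nat -> C -> Prop) p m : (forall l, (l <= m)%nat -> exists e, 0 < e /\ forall z, disk p e z -> P l z) ->
  exists e, 0 < e /\ forall z, disk p e z -> forall l, (l <= m)%nat -> P l z.
Proof.
  induction m; intros H.
  - destruct (H O (le_n O)) as [e [He K]]. exists e. split; auto. intros z Hz l Hl. replace l with O by lia. auto.
  - destruct IHm as [e [He K]]; [intros; apply H; lia|]. destruct (H (S m) (le_n _)) as [e' [He' K']].
    exists (Rmin e e'). split; [apply Rmin_pos; auto|]. intros z Hz l Hl.
    destruct (disk_Rmin _ _ _ _ Hz). destruct (Nat.eq_dec l (S m)) as [->|ne]; [auto|apply K; [auto|lia]].
Qed.

Lemma m1_disk_up_slit z : disk m1 1 z -> up_slit z.
Proof.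
  intros H. right. unfold disk, m1 in H. pose proof (re_le_Cmod (z - RtoC (-1))) as K.
  change (Re (z - RtoC (-1))%C) with (Re z - -1) in K. apply Rabs_le_between in K.
  replace (Im (0 + - Ci * z)%C) with (- Re z) by (unfold Re; simpl; ring). lra.
Qed.

Section Germs.
Variables (m : nat) (c : C) (Li : C -> C) (G : nat -> C -> C).
Hypothesis Hm : (1 <= m)%nat.
Hypothesis Hc : forall k : nat, c <> RtoC (- INR k).
Hypothesis HLi : forall z, cut_plane z -> Cmod z < 1 ->
  @is_series C_AbsRing C_NormedModule (fun n => (Cpow z (S n) / Cpow (RtoC (INR n) + c) m)%C) (Li z).
Hypothesis HG : forall k, (k <= m)%nat -> upper_germ_at_m1 (Bvec m c Li k) (G k).

(** Each basis germ is completed to a solution of the whole system, of which it is component [m]. *)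
Definition basis_sol (l : nat) : nat -> C -> C :=
  match l with O => LiG c Hc | S _ => bsol c l log_up end.

Lemma basis_sol_sol l : sol c (disk m1 1) (basis_sol l).
Proof.
  destruct l; simpl.
  - eapply sol_mono; [|apply LiG_spec]. intros z Hz. left. auto.
  - apply bsol_sol; [lia|]. intros z Hz. split; [apply m1_disk_punctured; auto|]. apply cderiv_log_up, m1_disk_up_slit; auto.
Qed.

Lemma sol_holo U Y k : sol c U Y -> holo U (Y k).
Proof. intros H z Hz. destruct (H z Hz) as [_ [h0 hk]]. destruct k; eauto. Qed.

Lemma bsol_last i ell z : (i <= m)%nat -> bsol c i ell m z = (Cexp ((1 - c) * ell z) * divpow (m - i) (ell z))%C.
Proof. intros Hi. unfold bsol, divpow. destruct (Nat.ltb_spec m i); [lia|]. ring. Qed.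

(** The comparison takes place at points of the upper half-plane inside the unit disk, where
    [log_up] is the principal logarithm and [Li] is the sum of its series. *)
Lemma germ_basis l : (l <= m)%nat -> exists e, 0 < e /\ forall z, disk m1 e z -> G l z = basis_sol l m z.
Proof.
  intros Hl. destruct (HG l Hl) as [r [Hr [Hh E]]]. apply holo_on_iff in Hh.
  assert (R1 : Rmin r 1 <= r) by apply Rmin_l. assert (R2 : Rmin r 1 <= 1) by apply Rmin_r.
  apply (germ_unique_m1 _ _ (Rmin r 1)).
  - split; auto. apply Rmin_pos; lra.
  - intros z Hz. apply Hh. unfold disk in *. lra.
  - intros z Hz. apply (sol_holo (disk m1 1) (basis_sol l) m (basis_sol_sol l)). unfold disk in *. lra.
  - intros z Hz Hi H1. rewrite E by (auto; unfold disk in *; lra). destruct l.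
    + simpl. rewrite (proj2 (LiG_spec c Hc)) by auto. apply LiS_series; auto. apply HLi; auto.
      intros [h _]. lra.
    + simpl basis_sol. rewrite bsol_last by auto. rewrite log_up_upper by auto.
      unfold Bvec, bfun, Cpowc, divpow. ring.
Qed.

Lemma continues_basis gamma k Y1 (h : C -> C) : gamma 0 = m1 -> gamma 1 = m1 -> (k <= m)%nat ->
  lift c gamma 0 1 (fun j => basis_sol k j m1) (fun j => Y1 j m1) -> sol c (disk m1 1) Y1 ->
  (forall z, disk m1 1 z -> (forall l, (l <= m)%nat -> G l z = basis_sol l m z) -> Y1 m z = h z) ->
  continues_along (G k) gamma h.
Proof.
  intros g0 g1 Hk HL HY Hh.
  destruct (common_radius (fun l z => G l z = basis_sol l m z) m1 m germ_basis) as [e [He K]].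
  apply (continues_along_germ (basis_sol k m) _ _ (Y1 m)).
  - apply (continues_of_lift c gamma _ _ m (basis_sol k) Y1 1 Rlt_0_1 HL); rewrite ?g0, ?g1; auto using basis_sol_sol.
  - exists e. split; auto. intros z Hz. rewrite g0 in Hz. symmetry. apply K; auto.
  - exists (Rmin e 1). split; [apply Rmin_pos; lra|]. intros z Hz. rewrite g1 in Hz.
    destruct (disk_Rmin _ _ _ _ Hz). apply Hh; auto.
Qed.

Lemma monodromy_Z0 gamma k : in_class loopZ0 gamma -> (k <= m)%nat ->
  continues_along (G k) gamma (fun z => Csum (fun l => (rhoZ0 c k l * G l z)%C) (S m)).
Proof.
  intros Hg Hk. destruct (proj1 Hg) as [_ [g0 [g1 _]]]. destruct k as [|k].
  - apply (continues_basis _ _ (LiG c Hc)); auto.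
    + apply (class_lift c loopZ0); auto. apply lift_Z0_li.
    + apply (basis_sol_sol 0).
    + intros z _ H. rewrite (Csum_one _ (S m) 0); [|lia|].
      * simpl rhoZ0. rewrite H by lia. simpl. ring.
      * intros [|l] _ n; [lia|]. simpl. ring.
  - apply (continues_basis _ _ (bsol c (S k) (fun z => log_up z + twopii)%C)); auto.
    + apply (class_lift c loopZ0); auto. apply (lift_Z0_b c Hc); lia.
    + apply bsol_sol; [lia|]. intros z Hz. split; [apply m1_disk_punctured; auto|].
      eapply cderiv_eq; [apply cderiv_plus; [apply cderiv_log_up, m1_disk_up_slit; auto|apply cderiv_const]|ring].
    + intros z _ H. rewrite bsol_last by auto. set (L := log_up z).
      assert (Em : S m = (S k + S (m - S k))%nat) by lia. rewrite Em.
      rewrite Csum_shift.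
      2:{ intros l Hl. unfold rhoZ0. destruct (Nat.ltb_spec l (S k)); [ring|lia]. }
      rewrite (Csum_ext _ (fun a => Cexp (- (twopii * c)) * Cexp ((1 - c) * L) * (divpow a twopii * divpow (m - S k - a) L))%C).
      (* The power of [L + twopii] gives the binomial sum, and
         [exp ((1 - c) twopii) = exp (- twopii c)] gives the common factor of the row. *)
      * rewrite Csum_scal, divpow_binomial, (Cplus_comm twopii).
        replace ((1 - c) * (L + twopii))%C with ((1 - c) * L + (- (twopii * c) + twopii))%C by ring.
        rewrite Cexp_plus, Cexp_per. ring.
      * intros a Ha. rewrite H by lia. replace (basis_sol (S k + a) m z) with (bsol c (S k + a) log_up m z) by reflexivity.
        rewrite bsol_last by lia. unfold rhoZ0. simpl (S k + a)%nat. destruct (Nat.ltb_spec (S (k + a)) (S k)); [lia|].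
        replace (S (k + a) - S k)%nat with a by lia. replace (m - S (k + a))%nat with (m - S k - a)%nat by lia.
        fold L. unfold divpow, Cdiv. ring.
Qed.

Lemma monodromy_Z1 gamma k : in_class loopZ1 gamma -> (k <= m)%nat ->
  continues_along (G k) gamma (fun z => Csum (fun l => (rhoZ1 k l * G l z)%C) (S m)).
Proof.
  intros Hg Hk. destruct (proj1 Hg) as [_ [g0 [g1 _]]]. destruct k as [|k].
  - apply (continues_basis _ _ (fun j z => 1 * LiG c Hc j z + - twopii * bsol c 1 log_up j z)%C); auto.
    + apply (class_lift c loopZ1); auto. apply lift_Z1_li.
    + apply sol_lin; [apply (basis_sol_sol 0)|apply (basis_sol_sol 1)].
    + intros z _ H. rewrite Csum_first, (Csum_one _ m 0); [|lia|].
      * rewrite !H by lia. unfold rhoZ1, mat_id. simpl. ring.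
      * intros [|l] _ n; [lia|]. unfold rhoZ1, mat_id. simpl. ring.
  - apply (continues_basis _ _ (bsol c (S k) log_up)); auto.
    + apply (class_lift c loopZ1); auto. apply (lift_Z1_b c Hc); lia.
    + apply (basis_sol_sol (S k)).
    + intros z _ H. rewrite (Csum_one _ (S m) (S k)); [|lia|].
      * rewrite H by auto. unfold rhoZ1, mat_id. simpl. rewrite Nat.eqb_refl. ring.
      * intros l _ n. unfold rhoZ1, mat_id. destruct (Nat.eqb_spec (S k) l); [lia|]. simpl. ring.
Qed.

End Germs.

Theorem theorem8p4 (m : nat) (c : C) (Li : C -> C) :
  (1 <= m)%nat ->
  (forall k : nat, c <> RtoC (- INR k)) ->
  (* Li = Li_{m,c}: the analytic continuation of the series to the cut plane *)
  holo_on cut_plane Li ->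
  (forall z, cut_plane z -> Cmod z < 1 ->
     @is_series C_AbsRing C_NormedModule
       (fun n => (Cpow z (S n) / Cpow (RtoC (INR n) + c) m)%C) (Li z)) ->
  (* monodromy of the basis germs at -1 along loops in [Z_0] and [Z_1] *)
  (forall G : nat -> C -> C,
     (forall k, (k <= m)%nat -> upper_germ_at_m1 (Bvec m c Li k) (G k)) ->
     (forall gamma, in_class loopZ0 gamma ->
        forall k, (k <= m)%nat ->
          continues_along (G k) gamma
            (fun z => Csum (fun l => (rhoZ0 c k l * G l z)%C) (S m))) /\
     (forall gamma, in_class loopZ1 gamma ->
        forall k, (k <= m)%nat ->
          continues_along (G k) gamma
            (fun z => Csum (fun l => (rhoZ1 k l * G l z)%C) (S m)))) /\
  (* the image of rho_{m,c} lies in a Borel subgroup of GL(m+1, C) *)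
  in_Borel (S m) (in_gen (S m) (rhoZ0 c) rhoZ1) /\
  (* it is unipotent if c is an integer > 1 *)
  ((exists k : Z, (1 < k)%Z /\ c = RtoC (IZR k)) ->
     forall X, in_gen (S m) (rhoZ0 c) rhoZ1 X -> unipotent (S m) X) /\
  (* it is quasi-unipotent if c is rational but not an integer *)
  (is_rat c -> ~ is_int c ->
     forall X, in_gen (S m) (rhoZ0 c) rhoZ1 X -> quasi_unipotent (S m) X).
Proof.
  intros Hm Hc _ HLi. split; [|split; [|split]].
  - intros G HG. split; intros gamma Hg k Hk.
    + apply (monodromy_Z0 m c Li G Hm Hc HLi HG); auto.
    + apply (monodromy_Z1 m c Li G Hm Hc HLi HG); auto.
  (* No change of basis is necessary: in the given order both generators are already upper
     triangular. *)
  - exists mat_id, mat_id. split.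
    + assert (E : mat_eq (S m) (mmul (S m) mat_id mat_id) mat_id).
      { intros i j Hi Hj. unfold mmul. rewrite (Csum_one _ (S m) i); auto.
        - unfold mat_id. rewrite Nat.eqb_refl. ring.
        - intros k _ n. unfold mat_id. destruct (Nat.eqb_spec i k); [lia|ring]. }
      split; exact E.
    + intros X HX. pose proof (mat_id_upper (S m)).
      repeat apply mmul_upper; auto.
      apply (in_gen_tri_diag (S m) (fun _ => True) (rhoZ0 c) rhoZ1); auto using rhoZ0_tri_diag, rhoZ1_tri_diag.
  (* For an integer [c] the factor [exp (- twopii c)] is 1, so every diagonal entry in the group is
     1. *)
  - intros [k [_ ->]] X HX.
    destruct (in_gen_tri_diag (S m) (fun d => d = 1%C) (rhoZ0 (RtoC (IZR k))) rhoZ1) with (7 := HX) as [U [o [d [_ [-> Hd]]]]].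
    + lia.
    + auto.
    + intros a b -> ->. ring.
    + intros a _ ->. field.
    + apply rhoZ0_tri_diag. rewrite Cexp_opp, Cexp_2pi_int. field.
    + apply rhoZ1_tri_diag. auto.
    + apply unipotent_upper; auto. intros [|i] Hi; auto. apply Hd. lia.
  (* With [n = |q|] the product [n c] is an integer, so [exp (- twopii c)] is an [n]-th root of
     unity and the [n]-th power of every element has unit diagonal. *)
  - intros [p [q [Hq Ec]]] _ X HX. set (n := Z.to_nat (Z.abs q)).
    assert (Hn : (0 < n)%nat) by (unfold n; lia).
    destruct (in_gen_tri_diag (S m) (fun d => Cpow d n = 1%C) (rhoZ0 c) rhoZ1) with (7 := HX) as [U [o [d [_ [Dd Hd]]]]].
    + lia.
    + apply Cpow_1_l.
    + intros a b Ha Hb. rewrite Cpow_mult_l, Ha, Hb. ring.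
    + intros a Ha E. apply Cpow_inv_1; auto.
    + apply rhoZ0_tri_diag. rewrite Cexp_mult_nat.
      assert (En : exists k : Z, (RtoC (INR n) * c)%C = RtoC (IZR k)).
      { assert (q0 : IZR q <> 0) by (apply not_0_IZR; auto).
        unfold n. rewrite INR_IZR_INZ, Z2Nat.id by lia. subst c. rewrite <- RtoC_mult.
        destruct (Z_le_dec 0 q).
        - exists p. rewrite Z.abs_eq by lia. f_equal. field. auto.
        - exists (- p)%Z. rewrite Z.abs_neq, !opp_IZR by lia. f_equal. field. auto. }
      destruct En as [k En].
      replace (RtoC (INR n) * - (twopii * c))%C with (- (twopii * (RtoC (INR n) * c)))%C by ring.
      rewrite En, Cexp_opp, Cexp_2pi_int. field.
    + apply rhoZ1_tri_diag. apply Cpow_1_l.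
    + exists n. split; auto. destruct (mpow_upper (S m) X n U) as [U' D'].
      apply unipotent_upper; auto. intros [|i] Hi; rewrite D' by auto.
      * rewrite o. apply Cpow_1_l.
      * rewrite Hd by lia. auto.
Qed.
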